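(* Let $e$ be the ramification index of $F/\mathbb{Q}_2$, and let $\Gamma(k)\subset K$ be the $k$-th principal congruence subgroup of $K$. Then: (1) there exists a splitting $\mathbf{s}_{\Gamma(2e)}:\Gamma(2e)\to\widetilde{G}$ such that its image $\mathbf{s}_{\Gamma(2e)}(\Gamma(2e))$ is normal in $\widetilde{K}$; (2) if $\Gamma(2e-1)$ splits into $\widetilde{K}$, then the image of this splitting is not normal in $\widetilde{K}$, nor in $\widetilde{I}$.
   Context: $F$ is a finite extension of $\mathbb{Q}_2$ with ring of integers $\mathcal{O}$ and uniformizer $\varpi$, so $2\mathcal{O}=\varpi^e\mathcal{O}$. $(-,-):F^\times\times F^\times\to\{\pm1\}$ is the quadratic Hilbert symbol of $F$. $G$ is the group of $F$-points of an almost simple simply-connected split (Chevalley) group with irreducible simply-laced root system $\Phi$ (relative to a split maximal torus $T$) of rank at least $2$, i.e. type $A_r$ ($r\ge2$), $D_r$ ($r\ge3$), $E_6,E_7,E_8$. $\Delta\subset\Phi$ is a set of simple roots, with positive/negative roots $\Phi^\pm$. $G$ is generated by the Chevalley elements $x_\alpha(t)$ ($\alpha\in\Phi$, $t\in F$); $w_\alpha(t)=x_\alpha(t)x_{-\alpha}(-t^{-1})x_\alpha(t)$, $h_\alpha(t)=w_\alpha(t)w_\alpha(-1)$ for $t\in F^\times$. $\widetilde{G}$ is the unique nontrivial topological central extension $1\to\mu_2\to\widetilde{G}\xrightarrow{\mathrm{pr}}G\to1$; concretely it is generated by $\mu_2$ and elements $\tilde{x}_\alpha(t)$ lifting $x_\alpha(t)$,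 with relations $\tilde x_\alpha(t)\tilde x_\alpha(u)=\tilde x_\alpha(t+u)$; for $\alpha+\beta\ne0$, $[\tilde x_\alpha(t),\tilde x_\beta(u)]=\tilde x_{\alpha+\beta}(ctu)$ if $\alpha+\beta\in\Phi$ (with $c=c(\alpha,\beta)\in\{\pm1\}$ the same sign as in $G$) and $1$ otherwise; and $\tilde h_\alpha(t)\tilde h_\alpha(u)=(t,u)\tilde h_\alpha(tu)$, where $\tilde w_\alpha(t)=\tilde x_\alpha(t)\tilde x_{-\alpha}(-t^{-1})\tilde x_\alpha(t)$ and $\tilde h_\alpha(t)=\tilde w_\alpha(t)\tilde w_\alpha(-1)$. For a subgroup $H\subseteq G$, $\widetilde{H}=\mathrm{pr}^{-1}(H)$; a splitting of $H$ is a group homomorphism $\mathbf{s}:H\to\widetilde{G}$ with $\mathrm{pr}\circ\mathbf{s}=\mathrm{id}_H$, and $H$ splits if one exists. $K$ is the hyperspecial maximal compact subgroup generated by all $x_\alpha(t)$, $\alpha\in\Phi$, $t\in\mathcal{O}$. For $k\ge1$, $\Gamma(k)$ is the subgroup generated by the $h_\alpha(u)$ with $u\in1+\varpi^k\mathcal{O}$ and the $x_\alpha(t)$ with $t\in\varpi^k\mathcal{O}$ ($\alpha\in\Phi$). $I$ is the Iwahori subgroup generated by $x_\alpha(t)$ ($\alpha\in\Phi^+$, $t\in\mathcal{O}$), $h_\alpha(u)$ ($u\in\mathcal{O}^\times$), and $x_\alpha(t)$ ($\alpha\in\Phi^-$, $t\in\varpi\mathcal{O}$). *)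

(* Defs.v *)
From HB Require Import structures.
From mathcomp Require Import all_boot all_order all_algebra all_field.
From mathcomp Require Import boolp classical_sets reals.

Set Implicit Arguments.
Unset Strict Implicit.
Unset Printing Implicit Defensive.

Import Order.TTheory GRing.Theory Num.Theory.
Local Open Scope classical_set_scope.
Local Open Scope ring_scope.

(** * Finite extensions of Q_2 *)

Definition abs2 (q : rat) : rat :=
  if q == 0 then 0
  else 2%:R ^+ logn 2 `|denq q|%N / 2%:R ^+ logn 2 `|numq q|%N.

(* (K, absv) is the completion of rat for the 2-adic absolute value.  The value
   group of that absolute value is discrete, so its extension to the completion
   still takes its values in rat. *)
Record is_Q2 (K : fieldType) (absv : K -> rat) : Prop := IsQ2 {
  Q2_abs_eq0 : forall x, (absv x == 0) = (x == 0);
  Q2_abs_ge0 : forall x, 0 <= absv x;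
  Q2_absM : forall x y, absv (x * y) = absv x * absv y;
  Q2_absD : forall x y, absv (x + y) <= Num.max (absv x) (absv y);
  Q2_abs_rat : forall q : rat, absv (ratr q) = abs2 q;
  Q2_dense : forall (x : K) (eps : rat), 0 < eps ->
    exists q : rat, absv (x - ratr q) < eps;
  Q2_complete : forall u : nat -> K,
    (forall eps : rat, 0 < eps -> exists N : nat, forall m n : nat,
       (N <= m)%N -> (N <= n)%N -> absv (u m - u n) < eps) ->
    exists l : K, forall eps : rat, 0 < eps -> exists N : nat, forall n : nat,
       (N <= n)%N -> absv (u n - l) < eps
}.

Section LocalField.
Variables (Q2 : fieldType) (absv : Q2 -> rat) (F : fieldExtType Q2).

(* The integral closure in F of Z_2 = {a | absv a <= 1}. *)
Definition ring_of_integers : set F :=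
  [set x | exists p : {poly Q2},
     [/\ p \is monic, forall i : nat, absv p`_i <= 1
       & root (map_poly (in_alg F) p) x]].

Local Notation O := ring_of_integers.

Definition principal_ideal (a : F) : set F := [set y | exists2 b, O b & y = a * b].

(* pi generates the maximal ideal of O, i.e. the set of non-units of O. *)
Definition uniformizer (pi : F) : Prop :=
  O pi /\
  forall x, O x -> (principal_ideal pi x <-> ~ exists2 y, O y & x * y = 1).

Definition ramification_index (pi : F) (e : nat) : Prop :=
  principal_ideal 2%:R = principal_ideal (pi ^+ e).

End LocalField.

Definition hilbert (F : fieldType) (a b : F) : int :=
  if `[< exists x y z : F,
           (x, y, z) <> (0, 0, 0) /\ z ^+ 2 = a * x ^+ 2 + b * y ^+ 2 >]
  then 1 else -1.

(** * Root systems in Euclidean space *)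

Section RootSystem.
Variables (R : realType) (r : nat).
Local Notation E := 'rV[R]_r.

Definition dot (u v : E) : R := \sum_(i < r) u 0 i * v 0 i.

(* <beta, alpha^\vee> *)
Definition cartan (beta alpha : E) : R := 2%:R * dot beta alpha / dot alpha alpha.

Record root_system (Phi : seq E) : Prop := RootSystem {
  rs_neq0 : 0 \notin Phi;
  rs_span : <<Phi>>%VS = fullv;
  rs_refl : forall a b, a \in Phi -> b \in Phi -> b - cartan b a *: a \in Phi;
  rs_int : forall a b, a \in Phi -> b \in Phi -> cartan b a \is a Num.int;
  rs_red : forall (a : E) (k : R), a \in Phi -> k *: a \in Phi -> k = 1 \/ k = -1
}.

Definition irreducible_rs (Phi : seq E) : Prop :=
  Phi <> [::] /\
  forall P : pred E,
    (exists2 a, a \in Phi & P a) -> (exists2 b, b \in Phi & ~~ P b) ->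
    exists a b, [/\ a \in Phi, b \in Phi, P a, ~~ P b & dot a b <> 0].

Definition simply_laced (Phi : seq E) : Prop :=
  forall a b, a \in Phi -> b \in Phi -> dot a a = dot b b.

Definition nneg_comb (Delta : seq E) (a : E) : Prop :=
  exists m : E -> nat, a = \sum_(d <- Delta) (m d)%:R *: d.

Record simple_roots (Phi Delta : seq E) : Prop := SimpleRoots {
  sr_sub : {subset Delta <= Phi};
  sr_basis : basis_of fullv Delta;
  sr_sign : forall a, a \in Phi -> nneg_comb Delta a \/ nneg_comb Delta (- a)
}.

Definition pos_roots (Phi Delta : seq E) : set E :=
  [set a | a \in Phi /\ nneg_comb Delta a].

Definition neg_roots (Phi Delta : seq E) : set E :=
  [set a | a \in Phi /\ nneg_comb Delta (- a)].

End RootSystem.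

(** * Subgroups of a possibly infinite group *)

Section Subgroups.
Variable G : groupType.

Record is_subgroup (H : set G) : Prop := IsSubgroup {
  sg1 : H 1%g;
  sgM : forall a b, H a -> H b -> H (a * b)%g;
  sgV : forall a, H a -> H (a^-1)%g
}.

Definition generated (S : set G) : set G :=
  [set g | forall H : set G, is_subgroup H -> S `<=` H -> H g].

Definition normal_in (N H : set G) : Prop :=
  [/\ is_subgroup N, N `<=` H
    & forall h a, H h -> N a -> N (h * a * h^-1)%g].

End Subgroups.

(** * Chevalley groups *)

Section Elements.
Variables (R : realType) (r : nat) (F : fieldType) (G : groupType).
Local Notation E := 'rV[R]_r.
Variable x : E -> F -> G.

Definition w_elt (a : E) (t : F) : G := (x a t * x (- a) (- t^-1) * x a t)%g.
Definition h_elt (a : E) (t : F) : G := (w_elt a t * w_elt a (- 1%R))%g.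

End Elements.

Definition lie (F : fieldType) (n : nat) (A B : 'M[F]_n) : 'M[F]_n :=
  A *m B - B *m A.

(* The exponential of a nilpotent n x n matrix over a field of
   characteristic 0. *)
Definition expmx (F : fieldType) (n : nat) (A : 'M[F]_n) : 'M[F]_n :=
  \sum_(k < n) (k`!%:R)^-1 *: A ^+ k.

Section Chevalley.
Variables (R : realType) (r : nat) (F : fieldType) (n : nat).
Local Notation E := 'rV[R]_r.
Variables (Phi Delta : seq E).

Definition coroot (X : E -> 'M[F]_n) (a : E) : 'M[F]_n := lie (X a) (X (- a)).

(* X is the family of root vectors, in a representation on F^n, of a Chevalley
   basis of the split Lie algebra with root system Phi; c gives the structure
   constants, all of which are 1 or -1 as Phi is simply laced. *)
Record chevalley_rep (c : E -> E -> int) (X : E -> 'M[F]_n) : Prop :=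
  ChevalleyRep {
  cr_sign : forall a b, a \in Phi -> b \in Phi -> a + b \in Phi ->
    c a b = 1 \/ c a b = -1;
  cr_lie : forall a b, a \in Phi -> b \in Phi -> a + b \in Phi ->
    lie (X a) (X b) = (c a b)%:~R *: X (a + b);
  cr_lie0 : forall a b, a \in Phi -> b \in Phi -> a + b \notin Phi ->
    a + b <> 0 -> lie (X a) (X b) = 0;
  cr_coroot : forall (a b : E) (m : int), a \in Phi -> b \in Phi ->
    cartan b a = m%:~R -> lie (coroot X a) (X b) = m%:~R *: X b
}.

(* A weight is identified with its values on the simple coroots. *)
Definition is_weight (X : E -> 'M[F]_n) (mu : E -> int) : Prop :=
  exists2 v : 'cV[F]_n, v <> 0
    & forall d, d \in Delta -> coroot X d *m v = (mu d)%:~R *: v.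

(* The weights of the representation span the whole weight lattice (the dual of
   the coroot lattice): the Chevalley group attached to it is then the simply
   connected one. *)
Definition weights_span (X : E -> 'M[F]_n) : Prop :=
  forall lam : E -> int,
  exists (m : nat) (k : 'I_m -> int) (mu : 'I_m -> E -> int),
    (forall i, is_weight X (mu i)) /\
    forall d, d \in Delta -> lam d = \sum_(i < m) k i * mu i d.

(* G is, via rho, the subgroup of GL_n(F) generated by the exp (t X_a). *)
Record chevalley_group (c : E -> E -> int) (X : E -> 'M[F]_n)
    (G : groupType) (rho : G -> 'M[F]_n) (x : E -> F -> G) : Prop :=
  ChevalleyGroup {
  cg_rep : chevalley_rep c X;
  cg_sc : weights_span X;
  cg_rho1 : rho 1%g = 1%:M;
  cg_rhoM : forall g h, rho (g * h)%g = rho g *m rho h;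
  cg_rho_inj : injective rho;
  cg_x : forall a t, a \in Phi -> rho (x a t) = expmx (t *: X a);
  cg_gen : generated [set x a t | a in [set` Phi] & t in setT] = setT
}.

(* zeta is the image in Gt of -1 in mu_2 = {1, -1}. *)
Definition mu2_elt (Gt : groupType) (zeta : Gt) (s : int) : Gt :=
  if s == 1 then 1%g else zeta.

(* The double cover of G given by the Hilbert symbol, with its projection pr.
   As all roots have the same length, the two usual conventions for the
   commutator give the same relations. *)
Record double_cover (c : E -> E -> int) (G : groupType) (x : E -> F -> G)
    (Gt : groupType) (pr : Gt -> G) (zeta : Gt) (xt : E -> F -> Gt) : Prop :=
  DoubleCover {
  dc_prM : forall g h, pr (g * h)%g = (pr g * pr h)%g;
  dc_prS : forall g, exists gt, pr gt = g;
  dc_zeta : zeta <> 1%g;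
  dc_ker : forall g, pr g = 1%g <-> (g = 1%g \/ g = zeta);
  dc_central : forall g, commute zeta g;
  dc_lift : forall a t, a \in Phi -> pr (xt a t) = x a t;
  dc_gen : generated
    ([set zeta] `|` [set xt a t | a in [set` Phi] & t in setT]) = setT;
  dc_add : forall a t u, a \in Phi -> (xt a t * xt a u)%g = xt a (t + u);
  dc_comm : forall a b t u, a \in Phi -> b \in Phi -> a + b \in Phi ->
    [~ xt a t, xt b u]%g = xt (a + b) ((c a b)%:~R * t * u);
  dc_comm0 : forall a b t u, a \in Phi -> b \in Phi -> a + b \notin Phi ->
    a + b <> 0 -> [~ xt a t, xt b u]%g = 1%g;
  dc_hilbert : forall a t u, a \in Phi -> t <> 0 -> u <> 0 ->
    (h_elt xt a t * h_elt xt a u)%g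
    = (mu2_elt zeta (hilbert t u) * h_elt xt a (t * u))%g
}.

End Chevalley.

(* A section over the subset H only: the values of s outside H are
   irrelevant. *)
Definition splitting (G Gt : groupType) (pr : Gt -> G) (H : set G)
    (s : G -> Gt) : Prop :=
  (forall g h, H g -> H h -> s (g * h)%g = (s g * s h)%g) /\
  (forall g, H g -> pr (s g) = g).

Section CompactSubgroups.
Variables (R : realType) (r : nat) (Q2 : fieldType) (absv : Q2 -> rat).
Variables (F : fieldExtType Q2) (pi : F) (Phi Delta : seq 'rV[R]_r).
Variables (G : groupType) (x : 'rV[R]_r -> F -> G).

Local Notation O := (@ring_of_integers Q2 absv F).
Local Notation ideal := (@principal_ideal Q2 absv F).

Definition K_group : set G :=
  generated [set x a t | a in [set` Phi] & t in O].

Definition Gamma (k : nat) : set G :=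
  generated
    ([set h_elt x a (1 + t) | a in [set` Phi] & t in ideal (pi ^+ k)]
     `|` [set x a t | a in [set` Phi] & t in ideal (pi ^+ k)]).

Definition O_units : set F := [set u | O u /\ exists2 v, O v & u * v = 1].

Definition Iwahori : set G :=
  generated
    ([set x a t | a in pos_roots Phi Delta & t in O]
     `|` [set h_elt x a u | a in [set` Phi] & u in O_units]
     `|` [set x a t | a in neg_roots Phi Delta & t in ideal pi]).

End CompactSubgroups.

(* Main.v *)
Require Import Defs.
From HB Require Import structures.
From mathcomp Require Import all_boot all_order all_algebra all_field.
From mathcomp Require Import boolp classical_sets reals.
From mathcomp Require Import zify ring lra.

Set Implicit Arguments.
Unset Strict Implicit.
Unset Printing Implicit Defensive.

Import Order.TTheory GRing.Theory Num.Theory.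
Local Open Scope classical_set_scope.
Local Open Scope ring_scope.

(** The relations of the cover alone give the conjugation action of [h_elt] and the rank one
    formula [x_b(t) x_(-b)(s) = (1+ts, t/(1+ts)) x_(-b)(s/(1+ts)) h_b(1+ts) x_b(t/(1+ts))];
    its symbol is trivial when [t] is integral and [s] is in [4 O].  Hence the subgroup [N] of the
    cover generated by the lifts of the generators of [Gamma(2e)] is normalized by the
    lift of [K], and it lies in the big cell [U^- T U^+].  The projection is injective
    on this part of the big cell: if [v t u] maps to 1, conjugating [v^-1 = t u] by a
    generic cocharacter [tau(w)] turns one side into a polynomial in [1/w] and the other
    into a polynomial in [w], so both are constant; the torus part uses that [1 + 4 O] is
    torsion free.  So [N] meets [mu_2] trivially and yields the splitting.

    For [Gamma(2e-1)], choose [A] in [1 + pi^(2e-1) O] and a unit [B] with [(A, B) = -1] and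
    roots with [<a, b^vee> = -1].  Conjugating any lift of [h_a(A)] by a lift of
    [h_b(B)] multiplies it by [-1], which a normal image of a section forbids. *)

(** * Finite extensions of Q_2 *)

(** The level 2e is natural because [pi ^+ (2 * e)] generates 4O, and adjoining a square root of 1 +
    4c is unramified, so that all units are norms; one power of [pi] lower this fails. The
    arithmetic starts from the record [is_Q2] alone: F carries no norm and no residue field is
    formed. Completeness of O is expressed through powers of 2 and obtained from binary digits in
    Q_2, and finiteness of the residue field is replaced by linear dependence over F_2 of long
    families. Two properties of the symbol have unusual sources: bimultiplicativity is read off the
    given cover, because conjugation by h_a(u) is a homomorphism, and nontriviality comes from an
    Artin-Schreier equation without solution modulo [pi]. Injectivity of x_a and nonvanishing of X_a
    are not assumed either: if x_a(t) were trivial for some nonzero t, its lift would be central and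
    the commutator relations would collapse the whole cover. *)

Section DyadicNumbers.
Variables (Q2 : fieldType) (absv : Q2 -> rat) (HQ2 : is_Q2 absv).

Lemma absv1 : absv 1 = 1.
Proof.
have := Q2_abs_rat HQ2 (1%:Z)%:~R.
by rewrite /ratr /abs2 intr_eq0 numq_int denq_int divr1 /=.
Qed.

Lemma absv0 : absv 0 = 0.
Proof. by apply/eqP; rewrite (Q2_abs_eq0 HQ2). Qed.

Lemma absvN x : absv (- x) = absv x.
Proof.
have h : absv (-1) ^+ 2 = 1 by rewrite expr2 -(Q2_absM HQ2) mulrNN mulr1 absv1.
have h1 : absv (-1) = 1.
  have := Q2_abs_ge0 HQ2 (-1); move: h; nra.
by rewrite -mulN1r (Q2_absM HQ2) h1 mul1r.
Qed.

Lemma absvD_le x y c : absv x <= c -> absv y <= c -> absv (x + y) <= c.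
Proof.
move=> hx hy; apply: le_trans (Q2_absD HQ2 x y) _.
by rewrite ge_max hx hy.
Qed.

Lemma absv_nat (n : nat) : absv n%:R <= 1.
Proof.
elim: n => [|n IHn]; first by rewrite absv0.
by rewrite -addn1 natrD absvD_le ?absv1.
Qed.

Lemma absv_int (m : int) : absv m%:~R <= 1.
Proof.
case: m => n; first exact: absv_nat.
by rewrite NegzE mulrNz absvN absv_nat.
Qed.

Lemma absv2 : absv 2%:R = 2%:R^-1.
Proof.
have := Q2_abs_rat HQ2 (2%:Z)%:~R.
by rewrite /ratr /abs2 intr_eq0 numq_int denq_int divr1 /= mul1r.
Qed.

Lemma Q2_two_neq0 : (2%:R : Q2) != 0.
Proof. by rewrite -(Q2_abs_eq0 HQ2) absv2. Qed.

Lemma absvV x : absv x^-1 = (absv x)^-1.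
Proof.
have [->|x0] := eqVneq x 0; first by rewrite invr0 absv0 invr0.
apply: (mulfI (x := absv x)); first by rewrite (Q2_abs_eq0 HQ2).
by rewrite -(Q2_absM HQ2) !mulfV ?absv1 ?(Q2_abs_eq0 HQ2).
Qed.

Lemma absvX x n : absv (x ^+ n) = absv x ^+ n.
Proof. by elim: n => [|n IHn]; rewrite ?expr0 ?absv1 // !exprS (Q2_absM HQ2) IHn. Qed.

(** If an odd [d] had absolute value below 1, so would 1, which is [d] minus an even integer. *)
Lemma absv_odd (d : nat) : odd d -> absv d%:R = 1.
Proof.
move=> od; apply/eqP; rewrite eq_le absv_nat /=.
rewrite -absv1 -(odd_double_half d) od add1n -addn1 natrD.
rewrite leNgt; apply/negP => hlt.
have : absv (1 : Q2) < 1.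
  have -> : (1 : Q2) = ((d./2).*2%:R + 1) - (d./2).*2%:R by rewrite addrAC subrr add0r.
  apply: le_lt_trans (Q2_absD HQ2 _ _) _; rewrite gt_max; apply/andP; split.
    by rewrite absv1 in hlt.
  rewrite absvN -muln2 natrM (Q2_absM HQ2) absv2.
  by have := absv_nat d./2; lra.
by rewrite absv1.
Qed.

(** Integrality forces the denominator to be odd, so the parity of the numerator is the residue. *)
Lemma rat_mod2 (q : rat) : absv (ratr q) <= 1 ->
  exists b : bool, absv (ratr q - b%:R) <= 2%:R^-1.
Proof.
move=> hq.
have [q0|q0] := eqVneq q 0.
  by exists false; rewrite q0 /ratr (numq_int 0) mul0r subr0 absv0 invr_ge0.
have od : odd `|denq q|%N.
  apply: contraT => ed.
  move: hq; rewrite (Q2_abs_rat HQ2) /abs2 (negbTE q0).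
  have cop := coprime_num_den q.
  have on : ~~ (2 %| `|numq q|)%N.
    rewrite dvdn2 negbK; apply: contraT => en.
    have : (2 %| gcdn `|numq q| `|denq q|)%N by rewrite dvdn_gcd !dvdn2 en ed.
    by rewrite (eqP cop).
  rewrite (lognE 2 `|numq q|) (negbTE on) !andbF expr0 divr1 => hle.
  have : (0 < logn 2 `|denq q|)%N.
    by rewrite logn_gt0 mem_primes /= absz_gt0 denq_neq0 dvdn2 ed.
  case: (logn 2 _) hle => // k hle _.
  have : (1 : rat) < 2%:R ^+ k.+1 by rewrite exprn_egt1 // ltr1n.
  by rewrite ltNge hle.
have ad : absv (denq q)%:~R = 1 by rewrite -[denq q]absz_denq -pmulrn absv_odd.
have d0 : (denq q)%:~R != 0 :> Q2 by rewrite -(Q2_abs_eq0 HQ2) ad oner_neq0.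
have key (m : int) : ~~ odd `|m|%N -> absv (m%:~R / (denq q)%:~R) <= 2%:R^-1.
  move=> em; rewrite (Q2_absM HQ2) absvV ad invr1 mulr1.
  have [s ->] : exists s : int, m = 2%:Z * s.
    by exists (m %/ 2%:Z)%Z; lia.
  rewrite intrM (Q2_absM HQ2) absv2.
  by have := absv_int s; lra.
have [ev|oq] := boolP (~~ odd `|numq q|%N).
  by exists false; rewrite subr0 /ratr key.
exists true; rewrite /ratr.
have -> : (numq q)%:~R / (denq q)%:~R - true%:R = (numq q - denq q)%:~R / (denq q)%:~R :> Q2.
  by rewrite rmorphB /= mulrBl divff.
by apply: key; lia.
Qed.

Lemma Z2_mod2 (a : Q2) : absv a <= 1 ->
  exists b : bool, exists2 c, absv c <= 1 & a = b%:R + 2%:R * c.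
Proof.
move=> ha.
have [|q hq] := Q2_dense HQ2 a (eps := 2%:R^-1); first by [].
have hq1 : absv (ratr q) <= 1.
  have -> : ratr q = a - (a - ratr q) by rewrite opprB addrC subrK.
  by apply: absvD_le; rewrite // absvN; lra.
have [b hb] := rat_mod2 hq1.
exists b; exists ((a - b%:R) / 2%:R); last first.
  by rewrite mulrC divfK ?Q2_two_neq0 // addrC subrK.
rewrite (Q2_absM HQ2) absvV absv2 invrK.
have : absv (a - b%:R) <= 2%:R^-1.
  have -> : a - b%:R = (a - ratr q) + (ratr q - b%:R) by rewrite addrA subrK.
  by apply: absvD_le => //; apply: ltW.
lra.
Qed.

(** The only use of completeness of Q_2. The bound is explicit in [K] so that it can be turned into
    divisibility by 2^K. *)
Lemma Q2_digits (eps : nat -> bool) : exists A : Q2, forall K,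
  absv (A - \sum_(k < K) (eps k)%:R * 2%:R ^+ k) <= 2%:R^-1 ^+ K.
Proof.
pose u K := \sum_(k < K) (eps k)%:R * (2%:R : Q2) ^+ k.
have hu m K : (K <= m)%N -> absv (u m - u K) <= 2%:R^-1 ^+ K.
  move=> /subnK <-; elim: (m - K)%N => [|d IHd].
    by rewrite add0n subrr absv0 exprn_ge0.
  have -> : u (d.+1 + K)%N - u K = (u (d + K)%N - u K) + (eps (d + K)%N)%:R * 2%:R ^+ (d + K)%N.
    by rewrite /u addSn big_ord_recr /=; ring.
  apply: absvD_le => //.
  rewrite (Q2_absM HQ2) absvX absv2 exprD.
  have h1 := absv_nat (eps (d + K)%N).
  have h0 := Q2_abs_ge0 HQ2 (eps (d + K)%N)%:R.
  have h2 : (2%:R^-1 : rat) ^+ d <= 1 by rewrite exprn_ile1.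
  have h3 : 0 <= (2%:R^-1 : rat) ^+ d by rewrite exprn_ge0.
  have h4 : 0 <= (2%:R^-1 : rat) ^+ K by rewrite exprn_ge0.
  rewrite mulrA ler_piMl //; nra.
have small (e : rat) : 0 < e -> exists K, 2%:R^-1 ^+ K < e.
  move=> e0.
  pose k := Num.bound e^-1.
  exists k.
  have hk : e^-1 < k%:R by have := archi_boundP (ltW (x := 0) (y := e^-1) _); apply;
    rewrite invr_gt0.
  have : (k%:R : rat) < 2%:R ^+ k by rewrite -natrX ltr_nat ltn_expl.
  move=> h; rewrite exprVn -[e]invrK ltf_pV2 ?posrE ?exprn_gt0 ?invr_gt0 //.
  exact: lt_trans h.
have [e e0|l hl] := Q2_complete HQ2 (u := u).
  have [K hK] := small _ e0; exists K => m n hm hn.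
  have -> : u m - u n = (u m - u K) - (u n - u K) by ring.
  apply: le_lt_trans hK; apply: absvD_le; first exact: hu.
  by rewrite absvN hu.
exists l => K; have e0 : 0 < (2%:R^-1 : rat) ^+ K by rewrite exprn_gt0.
have [N hN] := hl _ e0.
have -> : l - u K = (u (maxn N K) - u K) - (u (maxn N K) - l) by ring.
apply: absvD_le; first by rewrite hu // leq_maxr.
by rewrite absvN ltW // hN // leq_maxl.
Qed.

End DyadicNumbers.

(** * The ring of integers, and linear dependence modulo 2 *)

Section Integers.
Variables (Q2 : fieldType) (absv : Q2 -> rat) (HQ2 : is_Q2 absv).

Definition Z2 : {pred Q2} := [pred a | absv a <= 1].

Lemma Z2_subring : subring_closed Z2.
Proof.
split.
- by rewrite inE absv1.
- by move=> x y; rewrite !inE => hx hy; apply: absvD_le; rewrite ?absvN.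
- move=> x y; rewrite !inE (Q2_absM HQ2) => hx hy.
  by rewrite mulr_ile1 // (Q2_abs_ge0 HQ2).
Qed.

HB.instance Definition _ := GRing.isSubringClosed.Build Q2 Z2 Z2_subring.

(** With Z_2 bundled as a ring, [integralOver] applies, and closure of [ring_of_integers] under sums
    and products is inherited from it. *)
Record Z2_type := MkZ2 { Z2_val : Q2; Z2_valP : Z2_val \in Z2 }.
HB.instance Definition _ := [isSub for Z2_val].
HB.instance Definition _ := [Choice of Z2_type by <:].
HB.instance Definition _ := [SubChoice_isSubComNzRing of Z2_type by <:].

Variable F : fieldExtType Q2.
Definition Z2_to_F : {rmorphism Z2_type -> F} := in_alg F \o \val.

Lemma ring_of_integersE x : ring_of_integers absv x <-> integralOver Z2_to_F x.
Proof.
split=> [[p [mp hp rp]]|[p mp rp]].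
  have hin : p \is a polyOver Z2 by apply/polyOverP => i; rewrite inE hp.
  pose q : {poly Z2_type} := \poly_(i < size p) insubd 0 p`_i.
  have qE : map_poly \val q = p.
    apply/polyP => i; rewrite coef_map coef_poly; case: ltnP => hi.
      exact: (insubdK _ (polyOverP hin i)).
    by rewrite nth_default //; apply: raddf0.
  exists q.
    apply/eqP/val_inj.
    rewrite /= -(lead_coef_map_inj (f := \val)) ?qE ?(eqP mp) //.
    exact: val_inj.
  by rewrite map_poly_comp qE.
exists (map_poly \val p); split.
- by rewrite monic_map.
- by move=> i; rewrite coef_map; have := Z2_valP p`_i; rewrite inE.
- by rewrite -map_poly_comp.
Qed.

Local Notation O := (@ring_of_integers Q2 absv F).

Lemma O_nat n : O n%:R.
Proof. by apply/ring_of_integersE; apply: integral_nat. Qed.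

Lemma O_add x y : O x -> O y -> O (x + y).
Proof. by move=> /ring_of_integersE hx /ring_of_integersE hy;
  apply/ring_of_integersE/integral_add. Qed.

Lemma O_opp x : O x -> O (- x).
Proof. by move=> /ring_of_integersE hx; apply/ring_of_integersE/integral_opp. Qed.

Lemma O_mul x y : O x -> O y -> O (x * y).
Proof. by move=> /ring_of_integersE hx /ring_of_integersE hy;
  apply/ring_of_integersE/integral_mul. Qed.

Lemma O_scalar a : absv a <= 1 -> O a%:A.
Proof.
move=> ha; apply/ring_of_integersE; have h : a \in Z2 by rewrite inE.
exact: (integral_id Z2_to_F (MkZ2 h)).
Qed.

Lemma two_neq0 : (2%:R : F) != 0.
Proof. by rewrite -scaler_nat scaler_eq0 oner_eq0 orbF (Q2_two_neq0 HQ2). Qed.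

(** In a monic equation for 1/2 the leading term has absolute value 2^n and the remaining sum at
    most 2^(n-1). Thus 2 is not a unit of O. *)
Lemma half_not_integral : ~ O (2%:R^-1).
Proof.
move=> [p [mp hp]].
have -> : 2%:R^-1 = (2%:R^-1)%:A :> F.
  apply: (mulfI two_neq0); rewrite divff ?two_neq0 //.
  by rewrite -scalerAr mulr1 -scaler_nat scalerA mulVf ?scale1r ?(Q2_two_neq0 HQ2).
rewrite fmorph_root => rp.
have hn : (size p).-1.+1 = size p by rewrite prednK // lt0n size_poly_eq0 monic_neq0.
move: rp; rewrite /root horner_coef -hn big_ord_recr /= -lead_coefE (eqP mp) mul1r.
set n := (size p).-1.
have habs k : absv (2%:R^-1 ^+ k) = 2%:R ^+ k.
  by rewrite (absvX HQ2) (absvV HQ2) (absv2 HQ2) invrK.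
have bnd m : (0 < m)%N -> absv (\sum_(i < m) p`_i * 2%:R^-1 ^+ i) <= 2%:R ^+ m.-1.
  elim: m => // m IHm _; rewrite big_ord_recr /=; apply: (absvD_le HQ2).
    case: m IHm => [|m] IHm; first by rewrite big_ord0 (absv0 HQ2).
    by apply: le_trans (IHm _) _ => //=; rewrite exprS ler_peMl ?exprn_ge0 ?ler1n.
  by rewrite (Q2_absM HQ2) habs ler_piMl ?exprn_ge0.
rewrite addrC addr_eq0 => /eqP h.
case: n h => [|n] h.
  move: h; rewrite big_ord0 expr0 oppr0 => /eqP.
  by rewrite oner_eq0.
have := bnd n.+1 isT; rewrite -(absvN HQ2) -h habs /= leNgt exprS.
by rewrite ltr_pMl ?exprn_gt0 // ltr1n.
Qed.

Lemma Q2_linear_dependence (x : nat -> F) :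
  exists a : 'I_(\dim {:F}).+1 -> Q2,
    (exists i, a i != 0) /\ \sum_i a i *: x i = 0.
Proof.
set d := \dim _; pose X := [tuple x i | i < d.+1].
have nf : ~~ free X.
  apply/negP; rewrite /free => /eqP hd.
  by have := dimvS (subvf <<X>>%VS); rewrite hd size_tuple ltnn.
have [a ha] : exists a : 'I_d.+1 -> Q2, ~ (\sum_i a i *: X`_i = 0 -> forall i, a i = 0).
  by apply/existsNP => h; move/negP: nf; apply; apply/freeP.
have [h0 h1] : \sum_i a i *: X`_i = 0 /\ exists i, a i != 0.
  move/not_implyP: ha => [h0 /existsNP[i /eqP hi]]; split => //; by exists i.
exists a; split => //; rewrite -[RHS]h0; apply: eq_bigr => i _.
by rewrite -tnth_nth tnth_mktuple.
Qed.

Lemma Q2_absv_bounded (s : seq Q2) : exists m, forall a, a \in s -> absv (2%:R ^+ m * a) <= 1.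
Proof.
elim: s => [|b s [m hm]]; first by exists 0%N.
pose k := Num.bound (absv b).
exists (m + k)%N => a; rewrite inE => /orP[/eqP->|/hm].
  have hk : absv b < k%:R by apply: archi_boundP; apply: (Q2_abs_ge0 HQ2).
  rewrite (Q2_absM HQ2) (absvX HQ2) (absv2 HQ2) exprVn mulrC ler_pdivrMr ?exprn_gt0 // mul1r.
  apply: le_trans (ltW hk) _; rewrite -natrX ler_nat.
  by apply: leq_trans (leq_addl m k) _; apply/ltnW/ltn_expl.
move=> h; rewrite exprD mulrAC (Q2_absM HQ2).
rewrite mulr_ile1 ?(Q2_abs_ge0 HQ2) // (absvX HQ2) (absv2 HQ2).
by rewrite exprn_ile1.
Qed.

Lemma integral_multiple x : exists m, O (2%:R ^+ m * x).
Proof.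
have [a [[i0 ai0] ha]] := Q2_linear_dependence (fun i => x ^+ i).
pose p : {poly Q2} := \poly_(i < (\dim {:F}).+1) (if insub i is Some j then a j else 0).
have p0 : p != 0.
  apply: contraNneq ai0 => /polyP/(_ i0).
  by rewrite coef_poly ltn_ord coef0 valK => ->.
have rp : (map_poly (in_alg F) p).[x] = 0.
  rewrite /p poly_def rmorph_sum horner_sum -[RHS]ha; apply: eq_bigr => i _ /=.
  rewrite -mul_polyC rmorphM /= map_polyC map_polyXn hornerM hornerXn hornerC /=.
  by rewrite valK -scalerAl mul1r.
pose q := (lead_coef p)^-1 *: p.
have lq : lead_coef q = 1 by rewrite lead_coefZ mulVf // lead_coef_eq0.
have rq : (map_poly (in_alg F) q).[x] = 0 by rewrite linearZ /= hornerZ rp mulr0.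
pose n := (size q).-1.
have hn : n.+1 = size q.
  by rewrite prednK // lt0n size_poly_eq0 -lead_coef_eq0 lq oner_eq0.
have [m hm] := Q2_absv_bounded q.
exists m.
(* [t] is 2^(mn) q(X / 2^m). It stays monic, and each lower coefficient gains at least the factor
   2^m that makes it integral. *)
pose t := \poly_(i < n.+1) (q`_i * 2%:R ^+ (m * (n - i))).
have tn : t`_n = 1.
  by rewrite coef_poly ltnSn subnn muln0 expr0 mulr1 -[q`_n]/(lead_coef q) lq.
have st : size t = n.+1.
  by rewrite size_poly_eq // subnn muln0 expr0 mulr1 -[q`_n]/(lead_coef q) lq oner_neq0.
exists t; split.
- by rewrite monicE lead_coefE st tn.
- move=> i; rewrite coef_poly; case: ltnP => hi; last by rewrite (absv0 HQ2).
  have [->|ne] := eqVneq i n.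
    by rewrite subnn muln0 expr0 mulr1 -[q`_n]/(lead_coef q) lq (absv1 HQ2).
  have [k ->] : exists k, (n - i = k.+1)%N by exists (n - i).-1; lia.
  rewrite mulnS exprD mulrA (Q2_absM HQ2) mulr_ile1 ?(Q2_abs_ge0 HQ2) //.
    by rewrite mulrC hm // mem_nth // -hn.
  by rewrite (absvX HQ2) (absv2 HQ2) exprn_ile1.
rewrite /root horner_coef size_map_poly st.
have -> : \sum_(i < n.+1) (map_poly (in_alg F) t)`_i * (2%:R ^+ m * x) ^+ i
   = 2%:R ^+ (m * n) * (map_poly (in_alg F) q).[x].
  rewrite horner_coef size_map_poly -hn mulr_sumr; apply: eq_bigr => i _.
  rewrite !coef_map /= coef_poly ltn_ord /=.
  rewrite exprMn -exprM.
  have -> : (m * n = m * (n - i) + m * i)%N by have := ltn_ord i; nia.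
  rewrite exprD -[(q`_i * _)%:A]/(in_alg F _) rmorphM rmorphXn rmorph_nat /=.
  by ring.
by rewrite rq mulr0.
Qed.

(* Scale a relation over Q_2 so that its largest coefficient is 1, and reduce it modulo 2. *)
Lemma mod2_dependence (x : nat -> F) : (forall i, O (x i)) ->
  exists eps : nat -> bool,
    (exists2 i, (i < (\dim {:F}).+1)%N & eps i) /\
    O ((\sum_(i < (\dim {:F}).+1) (eps i)%:R * x i) / 2%:R).
Proof.
move=> hx; have [a [[i0 ai0] ha]] := Q2_linear_dependence x.
have [i1 hi1] : exists i1, forall i, absv (a i) <= absv (a i1).
  case: (@arg_maxP _ _ _ i0 xpredT (fun i => absv (a i)) isT) => i1 _ hi1.
  by exists i1 => i; apply: hi1.
have a1 : a i1 != 0.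
  rewrite -(Q2_abs_eq0 HQ2) gt_eqF //.
  by apply: lt_le_trans (hi1 i0); rewrite lt_def (Q2_abs_ge0 HQ2) (Q2_abs_eq0 HQ2) ai0.
pose b i := a i / a i1.
have hb i : absv (b i) <= 1.
  rewrite (Q2_absM HQ2) (absvV HQ2) ler_pdivrMr ?mul1r; first exact: hi1.
  by rewrite lt_def (Q2_abs_ge0 HQ2) (Q2_abs_eq0 HQ2) a1.
have hsb : \sum_i b i *: x i = 0.
  have -> : \sum_i b i *: x i = (a i1)^-1 *: \sum_i a i *: x i.
    by rewrite scaler_sumr; apply: eq_bigr => i _; rewrite scalerA mulrC.
  by rewrite ha scaler0.
have hch (i : 'I_(\dim {:F}).+1) : exists e : bool * Q2,
  absv e.2 <= 1 /\ b i = e.1%:R + 2%:R * e.2.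
  by have [e [c hc ->]] := Z2_mod2 HQ2 (hb i); exists (e, c).
have [e he] := choice hch.
exists (fun i => if insub i is Some j then (e j).1 else false); split.
  exists i1; first exact: ltn_ord.
  rewrite valK; apply: contraT => /negbTE e0.
  have [h1 h2] := he i1.
  move: h2; rewrite e0 add0r /b divff // => /(congr1 absv).
  rewrite (absv1 HQ2) (Q2_absM HQ2) (absv2 HQ2) => h2.
  by clear -h1 h2; lra.
set S := \sum_(i < _) _.
have -> : S = - (2%:R * \sum_(i < (\dim {:F}).+1) (e i).2%:A * x i).
  apply/eqP; rewrite -addr_eq0 -[X in _ == X]hsb mulr_sumr -big_split;
    apply/eqP/eq_bigr => i _ /=.
  rewrite valK (he i).2 scalerDl -!scalerAl !mul1r scaler_nat mulr_natl -scalerA.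
  by rewrite scaler_nat mulr_natl.
rewrite mulrC mulrN mulKf ?two_neq0 //; apply: O_opp.
apply: (big_ind (fun z => O z)) => [|y z|i _]; [exact: (O_nat 0) | exact: O_add |].
by apply: O_mul => //; apply: O_scalar; case: (he i).
Qed.

Lemma O_0 : O 0. Proof. exact: (O_nat 0). Qed.
Lemma O_1 : O 1. Proof. exact: (O_nat 1). Qed.

Lemma O_sub x y : O x -> O y -> O (x - y).
Proof. by move=> hx hy; apply/O_add => //; apply: O_opp. Qed.

Lemma O_exp x n : O x -> O (x ^+ n).
Proof. by move=> hx; elim: n => [|n IHn]; [exact: O_1 | rewrite exprS; apply: O_mul]. Qed.

Lemma O_sum (n : nat) (f : nat -> F) : (forall i, (i < n)%N -> O (f i)) -> O (\sum_(i < n) f i).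
Proof.
move=> hf; apply: (big_ind (fun z => O z)) => [|y z|i _]; [exact: O_0 | exact: O_add |].
exact: hf.
Qed.

End Integers.

Ltac integral HQ2 := repeat first
  [ assumption | apply: (O_0 HQ2) | apply: (O_1 HQ2) | apply: (O_nat HQ2) | apply: (O_sub HQ2)
  | apply: (O_add HQ2) | apply: (O_opp HQ2) | apply: (O_exp HQ2) | apply: (O_mul HQ2) ].

(** * Completeness and separatedness of O for the powers of 2 *)

Section LocalFieldTheory.
Variables (Q2 : fieldType) (absv : Q2 -> rat) (HQ2 : is_Q2 absv).
Variable F : fieldExtType Q2.
Local Notation O := (@ring_of_integers Q2 absv F).

Let two0 := two_neq0 HQ2 F.

Lemma natr2_neq0 k : (2%:R : F) ^+ k != 0.
Proof. by rewrite expf_neq0. Qed.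

Lemma F_char0 (n : nat) : (n%:R == 0 :> F) = (n == 0)%N.
Proof.
elim/ltn_ind: n => n IHn; have [od|ev] := boolP (odd n).
  rewrite -scaler_nat scaler_eq0 oner_eq0 orbF -(Q2_abs_eq0 HQ2).
  by rewrite (absv_odd HQ2 od) oner_eq0; case: n od {IHn}.
have [->|n0] := eqVneq n 0%N; first by rewrite eqxx.
rewrite -(even_halfK ev) -mul2n natrM mulf_eq0 (negbTE two0) IHn; first by lia.
by lia.
Qed.

Lemma F_intr_eq0 (m : int) : (m%:~R == 0 :> F) = (m == 0).
Proof.
case: m => n; first exact: F_char0.
by rewrite NegzE mulrNz oppr_eq0 (F_char0 n.+1).
Qed.

(** O / 2O is finite: a family independent modulo 2 and of maximal length generates, and
    [mod2_dependence] bounds the length by the dimension of F. *)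
Lemma generators_mod2 : exists (d : nat) (b : nat -> F), (forall i, O (b i)) /\
  forall y, O y -> exists eps : nat -> bool, O ((y - \sum_(i < d) (eps i)%:R * b i) / 2%:R).
Proof.
pose Ind n := exists b : nat -> F, (forall i, O (b i)) /\
  forall eps : nat -> bool, O ((\sum_(i < n) (eps i)%:R * b i) / 2%:R) ->
  forall i, (i < n)%N -> eps i = false.
have Ind0 : Ind 0%N by exists (fun=> 0); split => // i; exact: (O_0 HQ2).
have nInd : ~ Ind (\dim {:F}).+1.
  move=> [b [hb h]]; have [eps [[i hi ei] he]] := mod2_dependence HQ2 hb.
  by have := h _ he _ hi; rewrite ei.
have [n [hn hn1]] : exists n, Ind n /\ ~ Ind n.+1.
  apply: contrapT => hno; apply: nInd.
  elim: (X in Ind X) => // k IHk; apply: contrapT => hk.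
  by apply: hno; exists k.
have [b [hb h]] := hn; exists n, b; split => // y hy.
apply: contrapT => hno; apply: hn1.
pose b' i := if i == n then y else b i.
exists b'; split=> [i|eps]; first by rewrite /b'; case: ifP.
rewrite big_ord_recr /= {2}/b' eqxx.
have -> : \sum_(i < n) (eps i)%:R * b' i = \sum_(i < n) (eps i)%:R * b i.
  by apply: eq_bigr => i _; rewrite /b' ltn_eqF.
case en : (eps n) => hO i hi; last first.
  move: hi; rewrite ltnS leq_eqVlt => /orP[/eqP -> //|]; apply: h.
  by move: hO; rewrite mul0r addr0.
case: hno; exists eps.
rewrite mul1r in hO; set S := \sum_(i < n) _ in hO *.
have -> : (y - S) / 2%:R = (S + y) / 2%:R - S by field.
apply: (O_sub HQ2) => //; apply: (@O_sum _ _ HQ2 _ n (fun i => (eps i)%:R * b i)) => j _.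
by apply: (O_mul HQ2) => //; apply: (O_nat HQ2).
Qed.

(** Without a norm on F the limit is built from digits: each step expands the current remainder over
    the generators of O / 2O, and the digits that belong to one generator are summed in Q_2. *)
Lemma complete_mod2 (z : nat -> F) : O (z 0%N) ->
    (forall k, O ((z k.+1 - z k) / 2%:R ^+ k)) ->
  exists x, O x /\ forall k, O ((x - z k) / 2%:R ^+ k).
Proof.
move=> hz0 hz.
have [d [b [hb hgen]]] := generators_mod2.
pose y k := (z k.+1 - z k) / 2%:R ^+ k.
have hEx (u : F) : exists eps : nat -> bool,
    O u -> O ((u - \sum_(i < d) (eps i)%:R * b i) / 2%:R).
  have [hu|hu] := pselect (O u); last by exists xpred0.
  by have [eps he] := hgen u hu; exists eps.
have [E hE] := choice hEx.
pose Rm u := (u - \sum_(i < d) (E u i)%:R * b i) / 2%:R.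
(* [s k] is the remainder after [k] digit extractions with the increment [y k] already added in;
   hence the correction term in [y K] in [inv]. *)
pose s := fix s k := if k is k'.+1 then Rm (s k') + y k else y 0%N.
have hs k : O (s k).
  elim: k => [|k IHk] /=; first exact: hz.
  by apply: (O_add HQ2); [apply: hE | exact: hz].
have [A hA] := choice (fun i => Q2_digits HQ2 (fun k => E (s k) i)).
pose x := z 0%N + \sum_(i < d) (A i)%:A * b i.
have inv K : z K = z 0%N + \sum_(k < K) 2%:R ^+ k * (\sum_(i < d) (E (s k) i)%:R * b i)
    + 2%:R ^+ K * s K - 2%:R ^+ K * y K.
  elim: K => [|K IHK]; first by rewrite big_ord0 /=; ring.
  have -> : z K.+1 = z K + 2%:R ^+ K * y K.
    by rewrite /y mulrC divfK ?natr2_neq0 // addrC subrK.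
  rewrite IHK big_ord_recr /= /Rm.
  set u := \sum_(i < d) _; set v := \sum_(k < K) _.
  rewrite exprS; field.
  exact: two0.
have hx k : O ((x - z k) / 2%:R ^+ k).
  have -> : (x - z k) / 2%:R ^+ k =
     \sum_(i < d) ((A i - \sum_(j < k) (E (s j) i)%:R * 2%:R ^+ j) / 2%:R ^+ k)%:A * b i
     - s k + y k.
    apply: (mulIf (natr2_neq0 k)); rewrite divfK ?natr2_neq0 // {1}(inv k) /x.
    rewrite !mulrDl mulr_suml.
    have -> : \sum_(i < d) ((A i - \sum_(j < k) (E (s j) i)%:R * 2%:R ^+ j) / 2%:R ^+ k)%:A * b i
              * 2%:R ^+ k = \sum_(i < d) (A i)%:A * b i
         - \sum_(j < k) 2%:R ^+ j * \sum_(i < d) (E (s j) i)%:R * b i.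
      have -> : \sum_(j < k) 2%:R ^+ j * \sum_(i < d) (E (s j) i)%:R * b i =
         \sum_(i < d) (\sum_(j < k) (E (s j) i)%:R * 2%:R ^+ j)%:A * b i.
        under eq_bigr do rewrite mulr_sumr.
        rewrite exchange_big; apply: eq_bigr => i _ /=.
        rewrite scaler_suml mulr_suml; apply: eq_bigr => j _.
        rewrite mulrA; congr (_ * _).
        rewrite -[(_ * _)%:A]/(in_alg F _) rmorphM rmorphXn !rmorph_nat.
        exact: mulrC.
      rewrite -sumrB; apply: eq_bigr => i _.
      rewrite mulrAC -mulrBl; congr (_ * _).
      rewrite -![_%:A]/(in_alg F _) -rmorphB /=.
      have -> : (2%:R : F) ^+ k = in_alg F (2%:R ^+ k) by rewrite rmorphXn rmorph_nat.
      rewrite -[(_ / _)%:A]/(in_alg F _) -rmorphM /= divfK //.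
      by rewrite expf_neq0 // (Q2_two_neq0 HQ2).
    by ring.
  apply: (O_add HQ2); last exact: hz.
  apply: (O_sub HQ2) => //.
  apply: (@O_sum _ _ HQ2 _ d (fun i => ((A i - \sum_(j < k) (E (s j) i)%:R * 2%:R ^+ j)
    / 2%:R ^+ k)%:A * b i)) => i _.
  apply: (O_mul HQ2) => //; apply: (O_scalar HQ2).
  rewrite (Q2_absM HQ2) (absvV HQ2) (absvX HQ2) (absv2 HQ2).
  by rewrite -exprVn invrK -ler_pdivlMr ?exprn_gt0 // mul1r -exprVn.
exists x; split => //.
have -> : x = (x - z 0%N) / 2%:R ^+ 0 + z 0%N by rewrite expr0 divr1 subrK.
exact: (O_add HQ2).
Qed.

(** If a nonzero [x] were divisible by all powers of 2, an integral multiple of its inverse would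
    make 1/2 integral. *)
Lemma integral_separated x : (forall k, O (x / 2%:R ^+ k)) -> x = 0.
Proof.
move=> hx; apply/eqP; apply: contraT => x0.
have [m hm] := integral_multiple HQ2 x^-1.
case: (half_not_integral HQ2 (F := F)).
have -> : 2%:R^-1 = (2%:R ^+ m * x^-1) * (x / 2%:R ^+ m.+1).
  by rewrite exprS; field; rewrite two0 x0 natr2_neq0.
exact: (O_mul HQ2).
Qed.

End LocalFieldTheory.

(** * The maximal ideal, valuations, and Hensel's lemma for quadratic equations *)

Section Uniformizer.
Variables (Q2 : fieldType) (absv : Q2 -> rat) (HQ2 : is_Q2 absv).
Variables (F : fieldExtType Q2) (pi : F) (e : nat).
Hypotheses (Hpi : uniformizer absv pi) (He : ramification_index absv pi e).
Local Notation O := (@ring_of_integers Q2 absv F).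
(** Membership in the maximal ideal; an equation in the residue field is written [M (x - y)]. *)
Local Notation M x := (O (x / pi)).
Let two0 := two_neq0 HQ2 F.

Lemma principal_idealE (a x : F) : a != 0 -> principal_ideal absv a x <-> O (x / a).
Proof.
move=> a0; split=> [[b hb ->]|h]; first by rewrite mulrC mulKf.
by exists (x / a); rewrite // mulrC divfK.
Qed.

Lemma integral_pi : O pi. Proof. by case: Hpi. Qed.

Lemma pi_neq0 : pi != 0.
Proof.
case: Hpi => _ h; have /h[_ h2] : O 2%:R by integral HQ2.
have [|b _ /eqP] := h2.
  move=> [y hy h2y]; apply: (half_not_integral HQ2 (F := F)).
  by have -> : 2%:R^-1 = y by apply: (mulfI two0); rewrite h2y divff.
by apply: contraTneq => ->; rewrite mul0r.
Qed.
Let pi0 := pi_neq0.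
Let Opi := integral_pi.

Lemma expfpi_neq0 k : pi ^+ k != 0. Proof. exact: expf_neq0. Qed.

Lemma nonunit_div_pi x : O x -> ~ O x^-1 -> M x.
Proof.
move=> hx hu; case: Hpi => _ /(_ x hx) [_ h]; apply/(principal_idealE _ pi0)/h.
have [->|x0] := eqVneq x 0; first by move=> [y _ /eqP]; rewrite mul0r eq_sym oner_eq0.
by move=> [y hy hxy]; apply: hu; have -> : x^-1 = y by apply: (mulfI x0); rewrite hxy divff.
Qed.

Lemma M_not_unit x : x != 0 -> M x -> ~ O x^-1.
Proof.
move=> x0 hx hu.
have Ox : O x by rewrite -(divfK pi0 x); integral HQ2.
case: Hpi => _ /(_ x Ox) [h _]; apply: h; first exact/(principal_idealE _ pi0).
by exists x^-1; rewrite ?divff.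
Qed.

Lemma pi_inv_not_integral : ~ O pi^-1.
Proof. by apply: M_not_unit => //; rewrite divff //; integral HQ2. Qed.

Lemma M_1 : ~ M 1. Proof. by rewrite mul1r; exact: pi_inv_not_integral. Qed.

Lemma M_integral x : M x -> O x.
Proof. by move=> h; rewrite -(divfK pi0 x); integral HQ2. Qed.

Lemma M_add x y : M x -> M y -> M (x + y).
Proof. by move=> hx hy; rewrite mulrDl; integral HQ2. Qed.
Lemma M_opp x : M x -> M (- x).
Proof. by move=> hx; rewrite mulNr; integral HQ2. Qed.
Lemma M_sub x y : M x -> M y -> M (x - y).
Proof. by move=> hx hy; rewrite mulrBl; integral HQ2. Qed.
Lemma M_mull x y : O x -> M y -> M (x * y).
Proof. by move=> hx hy; rewrite -mulrA; integral HQ2. Qed.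
Lemma M_mulr x y : M x -> O y -> M (x * y).
Proof. by move=> hx hy; rewrite (mulrC x); apply: M_mull. Qed.
Lemma M_pi : M pi.
Proof. by rewrite divff //; integral HQ2. Qed.

Lemma M_prime x y : O x -> O y -> M (x * y) -> M x \/ M y.
Proof.
move=> hx hy hxy; have [hu|hu] := pselect (O x^-1); last by left; apply: nonunit_div_pi.
have [->|x0] := eqVneq x 0; first by left; rewrite mul0r; integral HQ2.
right; have -> : y = x^-1 * (x * y) by rewrite mulKf.
exact: M_mull.
Qed.

Definition Ounit x := [/\ x != 0, O x & O x^-1].

Lemma Ounit_nM x : O x -> ~ M x -> Ounit x.
Proof.
move=> hx hm; split => //.
  by apply/eqP => x0; apply: hm; rewrite x0 mul0r; integral HQ2.
by apply: contrapT => hu; apply: hm; apply: nonunit_div_pi.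
Qed.

Lemma Ounit_not_M x : Ounit x -> ~ M x.
Proof. by case=> x0 _ hu hm; exact: M_not_unit hm hu. Qed.

Lemma Ounit_1 : Ounit 1.
Proof. by split; rewrite ?oner_neq0 ?invr1 //; integral HQ2. Qed.

Lemma Ounit_mul x y : Ounit x -> Ounit y -> Ounit (x * y).
Proof. by move=> [x0 Ox Oxi] [y0 Oy Oyi]; split; rewrite ?mulf_neq0 // ?invfM; integral HQ2. Qed.

Lemma Ounit_inv x : Ounit x -> Ounit x^-1.
Proof. by move=> [x0 Ox Oxi]; split; rewrite ?invr_eq0 ?invrK. Qed.

Lemma Ounit_addM x y : Ounit x -> M y -> Ounit (x + y).
Proof.
move=> hx hy; have [x0 Ox _] := hx; apply: Ounit_nM.
  by apply: (O_add HQ2) => //; exact: M_integral.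
move=> hm; apply: (Ounit_not_M hx); have -> : x = (x + y) - y by rewrite addrK.
exact: M_sub.
Qed.

Lemma pi_e_2 : O (2%:R / pi ^+ e) /\ O (pi ^+ e / 2%:R).
Proof.
split.
  apply/(principal_idealE _ (expfpi_neq0 e)); rewrite -He.
  by exists 1; rewrite ?mulr1 //; integral HQ2.
apply/(principal_idealE _ two0); rewrite He.
by exists 1; rewrite ?mulr1 //; integral HQ2.
Qed.

Lemma e_gt0 : (0 < e)%N.
Proof.
case: e He pi_e_2 => // _ [_]; rewrite expr0 mul1r => h.
by case: (half_not_integral HQ2 h).
Qed.

Lemma M_2 : M 2%:R.
Proof.
have [h _] := pi_e_2; rewrite -(divfK (expfpi_neq0 e) 2%:R); apply: M_mull => //.
case: e e_gt0 => // k _; rewrite exprSr mulfK //; integral HQ2.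
Qed.

Lemma M_double x : O x -> M (2%:R * x).
Proof. by move=> hx; apply: M_mulr => //; exact: M_2. Qed.

Lemma pi_sep x : O x -> x != 0 -> exists m, ~ O (x / pi ^+ m).
Proof.
move=> hx x0; apply: contrapT => h.
have hall m : O (x / pi ^+ m) by apply: contrapT => hm; apply: h; exists m.
move/eqP: x0; apply; apply: (integral_separated HQ2) => k.
have -> : x / 2%:R ^+ k = (x / pi ^+ (e * k)) * (pi ^+ e / 2%:R) ^+ k.
  by rewrite expr_div_n -exprM mulrA divfK // expfpi_neq0.
have [_ h2] := pi_e_2; have := hall (e * k)%N; move=> h1; integral HQ2.
Qed.

Lemma valuation_integral x : O x -> x != 0 -> exists k : nat, Ounit (x / pi ^+ k).
Proof.
move=> hx x0; have [m] := pi_sep hx x0.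
elim: m x hx x0 => [|m IHm] x hx x0; first by rewrite expr0 divr1.
have [hu _|hu hm] := pselect (O x^-1).
  by exists 0%N; rewrite expr0 divr1.
have hM := nonunit_div_pi hx hu.
have [||k hk] := IHm (x / pi) hM _; first by rewrite mulf_neq0 ?invr_eq0.
  by rewrite -mulrA -invfM -exprS.
exists k.+1; move: hk; by rewrite -mulrA -invfM -exprS.
Qed.

Lemma valuation x : x != 0 -> exists k : int, Ounit (x / pi ^ k).
Proof.
move=> x0; have [m hm] := integral_multiple HQ2 x.
have hpe : O (pi ^+ (e * m) * x).
  have [_ h2] := pi_e_2.
  have -> : pi ^+ (e * m) * x = (pi ^+ e / 2%:R) ^+ m * (2%:R ^+ m * x).
    by rewrite expr_div_n -exprM mulrA divfK // (natr2_neq0 HQ2).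
  by integral HQ2.
have [|k hk] := valuation_integral hpe; first by rewrite mulf_neq0 ?expfpi_neq0.
exists (k%:Z - (e * m)%:Z).
have -> : x / pi ^ (k%:Z - (e * m)%:Z) = pi ^+ (e * m) * x / pi ^+ k; last exact: hk.
rewrite expfzDr // -invr_expz -!exprnP.
by field; rewrite !expfpi_neq0.
Qed.

Lemma Ounit_pi_exp (k : int) : Ounit (pi ^ k) -> k = 0.
Proof.
have hpos n : ~ Ounit (pi ^+ n.+1).
  by move=> /Ounit_not_M; apply; rewrite exprSr mulfK //; integral HQ2.
case: k => [[|n]|n] // => [/hpos //|].
by rewrite NegzE -exprnN => /Ounit_inv; rewrite invrK => /hpos.
Qed.

(** A parity argument: the left side has odd valuation and the right side even. This is the
    contradiction behind [hilbert_pi_nontrivial]. *)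
Lemma odd_valuation_not_square_unit x k u : Ounit u -> pi * x ^+ 2 = pi ^ (2%:Z * k) * u -> False.
Proof.
move=> hu hx; have [u0 _ _] := hu.
have x0 : x != 0.
  apply: contra_eq_neq hx => ->; rewrite expr0n mulr0 eq_sym mulf_neq0 //.
  by rewrite expfz_neq0.
have [l hl] := valuation x0; set v := _ / _ in hl.
have hxv : x = pi ^ l * v by rewrite /v mulrC divfK // expfz_neq0.
have [v0 _ _] := hl.
have : Ounit (pi ^ (1 + 2%:Z * l - 2%:Z * k)).
  have -> : pi ^ (1 + 2%:Z * l - 2%:Z * k) = u / v ^+ 2.
    have -> : 1 + 2%:Z * l - 2%:Z * k = 1 + l + l - 2%:Z * k by ring.
    rewrite !expfzDr // expr1z -invr_expz.
    have -> : u = pi * x ^+ 2 / pi ^ (2%:Z * k) by rewrite hx mulrC mulKf // expfz_neq0.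
    by rewrite hxv; field; rewrite v0 !expfz_neq0.
  by apply: Ounit_mul => //; rewrite expr2; apply/Ounit_inv/Ounit_mul.
by move/Ounit_pi_exp; lia.
Qed.

(** The map x -> A x^2 + B contracts the maximal ideal, because the difference of two values gains
    the factor x + y, which is divisible by [pi]. *)
Lemma hensel A B : O A -> M B -> exists x, M x /\ x = A * x ^+ 2 + B.
Proof.
move=> hA hB; pose x := fix x j := if j is j'.+1 then A * (x j') ^+ 2 + B else 0.
have hM j : M (x j).
  elim: j => [|j IHj] /=; first by rewrite mul0r; integral HQ2.
  apply: M_add => //; apply: M_mull => //; rewrite expr2; apply: M_mulr => //.
  exact: M_integral.
have hO j := M_integral (hM j).
have hd j : O ((x j.+1 - x j) / pi ^+ j).
  elim: j => [|j IHj]; first by rewrite expr0 divr1; apply: (O_sub HQ2).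
  have -> : x j.+2 - x j.+1 = A * ((x j.+1 - x j) * (x j.+1 + x j)) by rewrite /=; ring.
  have -> : A * ((x j.+1 - x j) * (x j.+1 + x j)) / pi ^+ j.+1 =
    A * (((x j.+1 - x j) / pi ^+ j) * ((x j.+1 + x j) / pi)).
    by rewrite exprS; field; rewrite pi0 expfpi_neq0.
  by have := M_add (hM j.+1) (hM j) => h; integral HQ2.
have hdm j m : O ((x (j + m)%N - x j) / pi ^+ j).
  elim: m => [|m IHm]; first by rewrite addn0 subrr mul0r; integral HQ2.
  have -> : (x (j + m.+1)%N - x j) / pi ^+ j =
     (x (j + m)%N - x j) / pi ^+ j + (x (j + m).+1 - x (j + m)%N) / pi ^+ (j + m) * pi ^+ m.
    by rewrite addnS exprD; field; rewrite !expfpi_neq0.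
  by have := hd (j + m)%N => h; integral HQ2.
have [_ h2] := pi_e_2.
have pe2 y k : O (y / pi ^+ (e * k)) -> O (y / 2%:R ^+ k).
  move=> hy; have -> : y / 2%:R ^+ k = (y / pi ^+ (e * k)) * (pi ^+ e / 2%:R) ^+ k.
    by rewrite expr_div_n -exprM mulrA divfK // expfpi_neq0.
  by integral HQ2.
(* [complete_mod2] measures convergence in powers of 2, so only every [e]-th iterate is kept:
   pi^(ek) and 2^k generate the same ideal. *)
have [||y [hy hyk]] := complete_mod2 HQ2 (z := fun k => x (e * k)%N).
- exact: hO.
- by move=> k; apply: pe2; rewrite mulnS addnC; exact: hdm.
exists y; split.
  have -> : y = (y - x (e * 1)%N) / 2%:R ^+ 1 * 2%:R + x (e * 1)%N.
    by rewrite expr1 divfK // subrK.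
  by apply: M_add => //; apply: M_mull; [exact: hyk | exact: M_2].
apply/eqP; rewrite -subr_eq0; apply/eqP; apply: (integral_separated HQ2) => k.
have -> : (y - (A * y ^+ 2 + B)) / 2%:R ^+ k =
   (y - x (e * k)%N) / 2%:R ^+ k * (1 - A * (y + x (e * k)%N))
    - (x (e * k).+1 - x (e * k)%N) / 2%:R ^+ k.
  by rewrite /=; field; rewrite (natr2_neq0 HQ2).
have h3 := hyk k; have h4 := pe2 _ _ (hd (e * k)%N); have h5 := hO (e * k)%N.
by integral HQ2.
Qed.

End Uniformizer.

(** * The Hilbert symbol *)

Lemma hilbertP (F : fieldType) (a b : F) :
  (exists x y z : F, (x, y, z) <> (0, 0, 0) /\ z ^+ 2 = a * x ^+ 2 + b * y ^+ 2) <->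
  hilbert a b = 1.
Proof. by rewrite /hilbert; case: asboolP. Qed.

Lemma hilbert_sign (F : fieldType) (a b : F) : hilbert a b = 1 \/ hilbert a b = -1.
Proof. by rewrite /hilbert; case: asboolP; [left|right]. Qed.

Lemma eq_hilbert (F : fieldType) (a b a' b' : F) :
  (hilbert a b = 1 <-> hilbert a' b' = 1) -> hilbert a b = hilbert a' b'.
Proof.
move=> [h1 h2]; have [h|h] := hilbert_sign a b; first by rewrite h h1.
have [h'|h'] := hilbert_sign a' b'; last by rewrite h h'.
by move: (h2 h'); rewrite h.
Qed.

Lemma hilbertC (F : fieldType) (a b : F) : hilbert a b = hilbert b a.
Proof.
suff h : forall a b : F, hilbert a b = 1 -> hilbert b a = 1.
  by apply: eq_hilbert; split; exact: h.
move=> {a b} a b /hilbertP[x [y [z [h0 hz]]]]; apply/hilbertP; exists y, x, z; split.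
  by move=> [h1 h2 h3]; apply: h0; rewrite h1 h2 h3.
by rewrite hz addrC.
Qed.

Lemma hilbert_square (F : fieldType) (a b s : F) : s != 0 -> hilbert (a * s ^+ 2) b = hilbert a b.
Proof.
move=> s0; apply: eq_hilbert; split=> /hilbertP[x [y [z [h0 hz]]]]; apply/hilbertP.
  exists (s * x), y, z; split; last by rewrite hz; ring.
  by move=> [/eqP]; rewrite mulf_eq0 (negbTE s0) /= => /eqP h1 h2 h3; apply: h0; rewrite h1 h2 h3.
exists (x / s), y, z; split; last by rewrite hz; field.
move=> [/eqP]; rewrite mulf_eq0 invr_eq0 (negbTE s0) orbF => /eqP h1 h2 h3.
by apply: h0; rewrite h1 h2 h3.
Qed.

Lemma hilbert_solution (F : fieldType) (a b z : F) : z ^+ 2 = a + b -> hilbert a b = 1.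
Proof.
move=> hz; apply/hilbertP; exists 1, 1, z; split; last by rewrite hz; ring.
by case=> /eqP; rewrite oner_eq0.
Qed.

Lemma hilbert_square1 (F : fieldType) (s b : F) : hilbert (s ^+ 2) b = 1.
Proof.
apply/hilbertP; exists 1, 0, s; split; last by ring.
by case=> /eqP; rewrite oner_eq0.
Qed.

Section HilbertLocal.
Variables (Q2 : fieldType) (absv : Q2 -> rat) (HQ2 : is_Q2 absv).
Variables (F : fieldExtType Q2) (pi : F) (e : nat).
Hypotheses (Hpi : uniformizer absv pi) (He : ramification_index absv pi e).
Local Notation O := (@ring_of_integers Q2 absv F).
Local Notation M x := (O (x / pi)).
Let two0 := two_neq0 HQ2 F.
Let pi0 := pi_neq0 HQ2 Hpi.
Let Opi := integral_pi Hpi.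

Lemma O_bsum n (eps : nat -> bool) (y : nat -> F) : (forall i, O (y i)) ->
  O (\sum_(i < n) (eps i)%:R * y i).
Proof. by move=> hy; apply: (@O_sum _ _ HQ2 _ n (fun i => (eps i)%:R * y i)) => i _;
  integral HQ2. Qed.

Lemma freshman_sum n (eps : nat -> bool) (y : nat -> F) : (forall i, O (y i)) ->
  M ((\sum_(i < n) (eps i)%:R * y i) ^+ 2 - \sum_(i < n) (eps i)%:R * y i ^+ 2).
Proof.
move=> hy; elim: n => [|n IHn]; first by rewrite !big_ord0 expr0n subrr mul0r; integral HQ2.
rewrite !big_ord_recr /=; move: IHn (O_bsum n eps hy).
set S := \sum_(i < n) _ * y i; set T := \sum_(i < n) _ => hM hS.
have -> : (S + (eps n)%:R * y n) ^+ 2 - (T + (eps n)%:R * y n ^+ 2)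
   = (S ^+ 2 - T) + 2%:R * (S * (eps n)%:R * y n).
  by case: (eps n); rewrite /=; ring.
by apply: (M_add HQ2) => //; apply: (M_double HQ2 Hpi He); have := hy n; integral HQ2.
Qed.

Lemma M_of_half x : O (x / 2%:R) -> M x.
Proof. by move=> h; rewrite -(divfK two0 x) (mulrC (_ / _)); exact: (M_double HQ2 Hpi He). Qed.

(** Stands in for finiteness of the residue field. *)
Lemma residue_dependence (x : nat -> F) : (forall i, O (x i)) ->
  exists n (eps : nat -> bool),
    (exists2 i, (i < n)%N & eps i) /\ M (\sum_(i < n) (eps i)%:R * x i).
Proof.
move=> hx; have [eps [h1 h2]] := mod2_dependence HQ2 hx.
by exists (\dim {:F}).+1, eps; split => //; apply: M_of_half.
Qed.

(* Otherwise an infinite chain 1 = x_0, x_1, ... with x_(i+1)^2 + x_(i+1) = x_i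
   modulo pi would be independent over F_2 in the residue field. *)
Lemma artin_schreier_not_surjective :
  exists c, O c /\ forall W, O W -> ~ M (W ^+ 2 + W + c).
Proof.
apply: contrapT => hno.
have hW c : exists W, O c -> O W /\ M (W ^+ 2 + W + c).
  have [hc|hc] := pselect (O c); last by exists 0.
  apply: contrapT => h; apply: hno; exists c; split => // W hW hM.
  by apply: h; exists W.
have [g hg] := choice hW.
pose x := fix x i := if i is i'.+1 then g (- x i') else 1.
have hx i : O (x i).
  elim: i => [|i IHi] /=; first by integral HQ2.
  by have [|//] := hg (- x i); integral HQ2.
have hrec i : M (x i.+1 ^+ 2 + x i.+1 - x i) by have [|//] := hg (- x i); integral HQ2; exact: hx.
have chain n (eps : nat -> bool) : M (\sum_(i < n) (eps i)%:R * x i) ->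
    forall i, (i < n)%N -> eps i = false.
  elim: n eps => // n IHn eps hM.
  have hS := O_bsum n.+1 eps hx.
  (* The map y -> y^2 + y is additive modulo [pi]. Applied to the relation [S], it kills x_0 = 1,
     whose image is 2, and lowers every other index by one. *)
  have h1 : M (\sum_(i < n) (eps i.+1)%:R * x i).
    set S := \sum_(i < n.+1) _ in hM hS.
    pose T := \sum_(i < n) (eps i.+1)%:R * (x i.+1 ^+ 2 + x i.+1 - x i).
    have hT : M T.
      rewrite /T mulr_suml.
      apply: (@O_sum _ _ HQ2 _ n (fun i => (eps i.+1)%:R * (x i.+1 ^+ 2 + x i.+1 - x i) / pi))
        => i _.
      by apply: (M_mull HQ2) => //; integral HQ2.
    have -> : \sum_(i < n) (eps i.+1)%:R * x i =
       S * (S + 1) - (S ^+ 2 - \sum_(i < n.+1) (eps i)%:R * x i ^+ 2) - (eps 0%N)%:R * 2%:R - T.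
      have -> : S * (S + 1) - (S ^+ 2 - \sum_(i < n.+1) (eps i)%:R * x i ^+ 2) =
         S + \sum_(i < n.+1) (eps i)%:R * x i ^+ 2 by ring.
      rewrite /S -big_split /= big_ord_recl /=.
      under [\sum_(i < n) ((_ * x (bump 0 i)) + _)]eq_bigr do rewrite /bump /= add1n -mulrDr.
      have -> : T = \sum_(i < n) (eps i.+1)%:R * (x i.+1 + x i.+1 ^+ 2)
        - \sum_(i < n) (eps i.+1)%:R * x i.
        by rewrite -sumrB; apply: eq_bigr => i _; ring.
      by ring.
    apply: (M_sub HQ2) => //; apply: (M_sub HQ2); last first.
      by apply: (M_mull HQ2); [integral HQ2 | exact: (M_2 HQ2 Hpi He)].
    apply: (M_sub HQ2); last exact: freshman_sum.
    by apply: (M_mulr HQ2) => //; integral HQ2.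
  have h2 := IHn (fun i => eps i.+1) h1.
  case=> [_|i]; last by rewrite ltnS; exact: h2.
  move: hM; rewrite big_ord_recl big1 ?addr0.
    by case: (eps 0%N) => // /=; rewrite mulr1 => h; case: (M_1 HQ2 Hpi h).
  by move=> i _; rewrite lift0 h2 // mul0r.
have [n [eps [[i hi ei] hM]]] := residue_dependence hx.
by have := chain n eps hM i hi; rewrite ei.
Qed.

(* A relation over F_2 between the powers u^(2^i) in the residue field; extract square roots
   until the term u occurs. *)
Lemma frobenius_surjective u : O u -> exists w, O w /\ M (w ^+ 2 - u).
Proof.
move=> hu; pose x i := u ^+ (2 ^ i).
have hx i : O (x i) by rewrite /x; integral HQ2.
have hx2 i : x i.+1 = x i ^+ 2 by rewrite /x expnSr exprM.
have [n [eps [[i hi ei] hM]]] := residue_dependence hx.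
elim: n eps i hi ei hM => // n IHn eps i hi ei hM.
have hfr := freshman_sum n (fun i => eps i.+1) hx.
have hO := O_bsum n (fun i => eps i.+1) hx.
move: hM hfr; rewrite big_ord_recl.
under eq_bigr do rewrite lift0 hx2.
set S := \sum_(i < n) _; set T := \sum_(i < n) _ => hM hfr.
have [e0|e0] := boolP (eps 0%N).
  exists T; split; first exact: hO.
  have -> : T ^+ 2 - u = (T ^+ 2 - S) + ((eps 0%N)%:R * x 0%N + S) - 2%:R * u.
    by rewrite e0 /x expn0 expr1 /=; ring.
  apply: (M_sub HQ2); last exact: (M_double HQ2 Hpi He).
  exact: (M_add HQ2).
case: i hi ei => [|i] hi ei; first by rewrite ei in e0.
apply: (IHn (fun i => eps i.+1) i) => //.
have hT2 : M (T * T).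
  have -> : T * T = (T ^+ 2 - S) + ((eps 0%N)%:R * x 0%N + S).
    by rewrite (negbTE e0) /=; ring.
  exact: (M_add HQ2).
by case: (M_prime HQ2 Hpi _ _ hT2).
Qed.

(** F(sqrt(1 + 4c)) is unramified, so every unit is a norm. Explicitly, if [w] is a square root of
    [u] modulo [pi], the choice y = 2, z = x + 2w turns z^2 = (1 + 4c) x^2 + u y^2 into x = (c / w)
    x^2 - (w^2 - u) / w, which [hensel] solves. *)
Lemma hilbert_unramified c u : O c -> Ounit absv u -> hilbert (1 + 4%:R * c) u = 1.
Proof.
move=> hc hu; have [u0 Ou _] := hu; have [w [hw hM]] := frobenius_surjective Ou.
have hwu : Ounit absv w.
  apply: (Ounit_nM HQ2 Hpi) => // hMw; apply: (Ounit_not_M HQ2 Hpi hu).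
  have -> : u = w * w - (w ^+ 2 - u) by ring.
  by apply: (M_sub HQ2) => //; apply: (M_mull HQ2).
have [w0 _ Owi] := hwu.
have [||x [hMx hx]] := hensel HQ2 Hpi He (A := c / w) (B := - (w ^+ 2 - u) / w).
- by integral HQ2.
- by apply: (M_mulr HQ2) => //; apply: (M_opp HQ2).
apply/hilbertP; exists x, 2%:R, (x + 2%:R * w); split.
  by case=> _ /eqP; rewrite (negbTE two0).
have -> : x ^+ 2 = x * x by ring.
have : w * x = c * x ^+ 2 - w ^+ 2 + u by rewrite {1}hx; field.
move=> h; transitivity (x * x + 4%:R * (w * x) + 4%:R * w ^+ 2); first by ring.
by rewrite h; ring.
Qed.

(** If x + x^2 = c, then 1 + 4c is the square of 1 + 2x; [hensel] finds such an [x] when [c] is in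
    the maximal ideal. *)
Lemma hilbert_square_unit c z : M c -> hilbert (1 + 4%:R * c) z = 1.
Proof.
move=> hc; have [||x [hMx hx]] := hensel HQ2 Hpi He (A := -1) (B := c) => //.
  by integral HQ2.
have -> : 1 + 4%:R * c = (1 + 2%:R * x) ^+ 2; last exact: hilbert_square1.
by have -> : c = x + x ^+ 2; [rewrite {1}hx; ring | ring].
Qed.

(** A solution with x nonzero, written z = x (1 + 2W) and y = 2xY, becomes pi Y^2 = W^2 + W + c. The
    right side has even valuation: if [W] is integral it is a unit by the choice of [c], and
    otherwise W^2 dominates. *)
Lemma hilbert_pi_nontrivial : exists c, O c /\ hilbert (1 - 4%:R * c) pi = -1.
Proof.
have [c [hc hW]] := artin_schreier_not_surjective; exists c; split => //.
have [|//] := hilbert_sign (1 - 4%:R * c) pi => /hilbertP[x [y [z [h0 hz]]]]; exfalso.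
have [x0|x0] := eqVneq x 0.
  have y0 : y != 0.
    apply/eqP => y0; move: hz; rewrite x0 y0 !expr0n /= !mulr0 addr0 => /eqP.
    by rewrite expf_eq0 /= => /eqP z0; apply: h0; rewrite x0 y0 z0.
  have hpe : pi * (z / (y * pi)) ^+ 2 = pi ^ (2%:Z * 0) * 1.
    rewrite mulr0 expr0z mulr1 expr_div_n hz x0; field.
    by rewrite pi0 y0.
  exact: (odd_valuation_not_square_unit HQ2 Hpi He (Ounit_1 HQ2 F) hpe).
have four0 : 4%:R != 0 :> F by rewrite (F_char0 HQ2).
pose W := (z / x - 1) / 2%:R; pose Y := y / x / 2%:R.
have hWY : pi * Y ^+ 2 = W ^+ 2 + W + c.
  have hz2 : pi * y ^+ 2 = z ^+ 2 - (1 - 4%:R * c) * x ^+ 2 by rewrite hz; ring.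
  transitivity (pi * y ^+ 2 / (4%:R * x ^+ 2)); first by rewrite /Y; field; rewrite two0 x0 four0.
  by rewrite hz2 /W; field; rewrite two0 x0 four0.
have [OW|nOW] := pselect (O W).
  have hu : Ounit absv (W ^+ 2 + W + c) by apply: (Ounit_nM HQ2 Hpi); [integral HQ2 | exact: hW].
  apply: (odd_valuation_not_square_unit HQ2 Hpi He hu (x := Y) (k := 0)).
  by rewrite mulr0 expr0z mul1r.
have W0 : W != 0 by apply/eqP => W0; apply: nOW; rewrite W0; integral HQ2.
have [k hk] := valuation HQ2 Hpi He W0; set v := _ / _ in hk.
have hWv : W = pi ^ k * v by rewrite /v mulrC divfK // expfz_neq0.
have [n hn] : exists n : nat, k = - (n.+1)%:Z.
  case: (k) hWv => [n|n] hWv; last by exists n; rewrite NegzE.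
  by have [_ Ov _] := hk; case: nOW; rewrite hWv -exprnP; integral HQ2.
have [v0 Ov Ovi] := hk.
(* This is W^2 + W + c divided by pi^(2k), where k = -(n+1). *)
have hu : Ounit absv (v * v + (pi ^+ n.+1 * v + pi ^+ n.+1 * pi ^+ n.+1 * c)).
  apply: (Ounit_addM HQ2 Hpi); first exact: Ounit_mul.
  have hMn y' : O y' -> M (pi ^+ n.+1 * y').
    by move=> hy'; apply: (M_mulr HQ2) => //; rewrite exprSr mulfK //; integral HQ2.
  by apply: (M_add HQ2); [exact: hMn | rewrite -mulrA; apply: hMn; integral HQ2].
apply: (odd_valuation_not_square_unit HQ2 Hpi He hu (x := Y) (k := k)).
rewrite hWY hWv hn.
have -> : 2%:Z * - (n.+1)%:Z = - (n.+1)%:Z + - (n.+1)%:Z by ring.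
rewrite expfzDr // -invr_expz -exprnP.
by field; rewrite expf_neq0.
Qed.

(** Even exponents are halved, since the square of 1 + 4c has the same shape; the root -1 would need
    c = -1/2, which is not integral. For odd exponent [n], 4c is multiplied by a geometric sum
    congruent to [n] modulo [pi], hence nonzero. *)
Lemma torsion_free_unit c (m : int) : O c -> m != 0 -> (1 + 4%:R * c) ^ m = 1 -> c = 0.
Proof.
move=> hc m0 hm.
have four0 : 4%:R != 0 :> F by rewrite (F_char0 HQ2).
have [n [n0 hn]] : exists n : nat, (0 < n)%N /\ (1 + 4%:R * c) ^+ n = 1.
  case: m m0 hm => n n0 hm; first by exists n; rewrite lt0n.
  exists n.+1; split => //; move: hm; rewrite NegzE -exprnN => /(congr1 (fun z => z^-1)).
  by rewrite invrK invr1.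
elim/ltn_ind: n c {hm} hc n0 hn => n IHn c hc n0 hn.
have [od|ev] := boolP (odd n); last first.
  have h2 : 2%:R * c + 4%:R * c ^+ 2 = 0.
    apply: (IHn n./2); [lia | integral HQ2 | lia |].
    have -> : 1 + 4%:R * (2%:R * c + 4%:R * c ^+ 2) = (1 + 4%:R * c) ^+ 2 by ring.
    by rewrite -exprM mul2n even_halfK.
  have : (2%:R * c) * (1 + 2%:R * c) = 0 by rewrite -h2; ring.
  move/eqP; rewrite !mulf_eq0 (negbTE two0) /= => /orP[/eqP //|/eqP h].
  case: (half_not_integral HQ2 (F := F)).
  have -> : 2%:R^-1 = - c; last by integral HQ2.
  by apply: (mulfI two0); rewrite divff //; apply/eqP; rewrite -subr_eq0 mulrN opprK h.
have h1 : M (4%:R * c).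
  have -> : 4%:R * c = 2%:R * (2%:R * c) by ring.
  by apply: (M_double HQ2 Hpi He); integral HQ2.
have hu i : M ((1 + 4%:R * c) ^+ i - 1).
  elim: i => [|i IHi]; first by rewrite expr0 subrr mul0r; integral HQ2.
  have -> : (1 + 4%:R * c) ^+ i.+1 - 1 = (1 + 4%:R * c) ^+ i * (4%:R * c)
    + ((1 + 4%:R * c) ^+ i - 1).
    by rewrite exprS; ring.
  by apply: (M_add HQ2) => //; apply: (M_mull HQ2) => //; integral HQ2.
have : (4%:R * c) * \sum_(i < n) (1 + 4%:R * c) ^+ i = 0.
  have := subrX1 (1 + 4%:R * c) n; rewrite hn subrr => {2}->.
  by rewrite addrAC subrr add0r.
move/eqP; rewrite !mulf_eq0 (negbTE four0) /= => /orP[/eqP //|/eqP hS].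
case: (M_1 HQ2 Hpi).
have -> : 1 = n%:R - 2%:R * (n./2)%:R - \sum_(i < n) (1 + 4%:R * c) ^+ i :> F.
  by rewrite hS -{1}(odd_double_half n) od natrD -mul2n natrM /=; ring.
rewrite addrAC; apply: (M_sub HQ2); last by apply: (M_double HQ2 Hpi He); integral HQ2.
have -> : n%:R - \sum_(i < n) (1 + 4%:R * c) ^+ i = - \sum_(i < n) ((1 + 4%:R * c) ^+ i - 1).
  by rewrite sumrB sumr_const card_ord opprB.
apply: (M_opp HQ2); rewrite mulr_suml.
by apply: (@O_sum _ _ HQ2 _ n (fun i => ((1 + 4%:R * c) ^+ i - 1) / pi)).
Qed.

End HilbertLocal.

(** * The ideal 4O and the level just below it *)

Section CongruenceLevel.
Variables (Q2 : fieldType) (absv : Q2 -> rat) (HQ2 : is_Q2 absv).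
Variables (F : fieldExtType Q2) (pi : F) (e : nat).
Hypotheses (Hpi : uniformizer absv pi) (He : ramification_index absv pi e).
Local Notation O := (@ring_of_integers Q2 absv F).
Local Notation M x := (O (x / pi)).
Local Notation J := (principal_ideal absv (pi ^+ (2 * e)%N)).
Let two0 := two_neq0 HQ2 F.
Let pi0 := pi_neq0 HQ2 Hpi.

Lemma level_idealP s : J s <-> exists2 c, O c & s = 4%:R * c.
Proof.
have [h1 h2] := pi_e_2 HQ2 Hpi He; have pe0 := expf_neq0 e pi0.
have e4 : pi ^+ (2 * e) = pi ^+ e * pi ^+ e by rewrite mul2n -addnn exprD.
have four : 4%:R = 2%:R * 2%:R :> F by ring.
split=> [[b hb ->]|[b hb ->]].
  exists ((pi ^+ e / 2%:R) * (pi ^+ e / 2%:R) * b); last by rewrite e4 four; field.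
  by apply: (O_mul HQ2) => //; apply: (O_mul HQ2).
exists ((2%:R / pi ^+ e) * (2%:R / pi ^+ e) * b); last by rewrite e4 four; field.
by apply: (O_mul HQ2) => //; apply: (O_mul HQ2).
Qed.

Lemma level_M s : J s -> M s.
Proof.
move/level_idealP => [c hc ->]; have -> : 4%:R * c = 2%:R * (2%:R * c) by ring.
by apply: (M_double HQ2 Hpi He); apply: (O_mul HQ2) => //; apply: (O_nat HQ2).
Qed.

Lemma level_O s : J s -> O s.
Proof. by move/level_M/(M_integral HQ2 Hpi). Qed.

Lemma level_0 : J 0.
Proof. by apply/level_idealP; exists 0; rewrite ?mulr0 //; exact: (O_0 HQ2). Qed.

Lemma level_add s t : J s -> J t -> J (s + t).
Proof.
move=> /level_idealP[b hb ->] /level_idealP[c hc ->]; apply/level_idealP.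
by exists (b + c); rewrite ?mulrDr //; exact: (O_add HQ2).
Qed.

Lemma level_mul s t : O s -> J t -> J (s * t).
Proof.
move=> hs /level_idealP[c hc ->]; apply/level_idealP.
by exists (s * c); [exact: (O_mul HQ2) | rewrite mulrCA].
Qed.

Lemma unit_1M s : M s -> Ounit absv (1 + s).
Proof. by move=> hs; apply: (Ounit_addM HQ2 Hpi) => //; exact: (Ounit_1 HQ2). Qed.

Lemma level_unit s : J s -> Ounit absv (1 + s).
Proof. by move/level_M/unit_1M. Qed.

Lemma level_neq0 s : J s -> 1 + s != 0.
Proof. by case/level_unit. Qed.

Lemma level_inv s : J s -> O (1 + s)^-1.
Proof. by case/level_unit. Qed.

Lemma level_hilbert_unit s v : J s -> v != 0 -> O v -> O v^-1 -> hilbert (1 + s) v = 1.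
Proof. by move=> /level_idealP[c hc ->] v0 Ov Ovi; apply: (hilbert_unramified HQ2 Hpi He). Qed.

(** If [t] is a unit, so is the second entry, and the unramified case applies. Otherwise [t]
    supplies the extra factor [pi] that makes 1 + ts a square. *)
Lemma level_hilbert_rank_one s t : O t -> t != 0 -> J s ->
  hilbert (1 + t * s) (t / (1 + t * s)) = 1.
Proof.
move=> ht t0 hs; have hts := level_mul ht hs; have [q0 Oq Oqi] := level_unit hts.
have [hti|hti] := pselect (O t^-1).
  apply: level_hilbert_unit => //; first by rewrite mulf_neq0 ?invr_eq0.
    exact: (O_mul HQ2).
  by rewrite invfM invrK; exact: (O_mul HQ2).
have [c hc ->] := (level_idealP s).1 hs; rewrite mulrCA.
apply: (hilbert_square_unit HQ2 Hpi He); apply: (M_mulr HQ2) => //.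
exact: (nonunit_div_pi HQ2 Hpi).
Qed.

Lemma level_torsion s (m : int) : J s -> m != 0 -> (1 + s) ^ m = 1 -> s = 0.
Proof.
by move=> /level_idealP[c hc ->] m0 /(torsion_free_unit HQ2 Hpi He hc m0) ->; rewrite mulr0.
Qed.

(** Feeds [x_eq1], where it keeps the root subgroups from collapsing. *)
Lemma hilbert_nontrivial_pair : exists t u : F, [/\ t != 0, u != 0 & hilbert t u = -1].
Proof.
have [c [hc h]] := hilbert_pi_nontrivial HQ2 Hpi He.
exists (1 - 4%:R * c), pi; split => //; rewrite -mulrN; apply/level_neq0/level_idealP.
by exists (- c) => //; exact: (O_opp HQ2).
Qed.

(* With alpha = pi^(2e-1) and alpha beta = 4c, the identity
   (1 - alpha, 1 - beta) = (1 - alpha beta, alpha) reduces to (1 - 4c, pi) = -1. *)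
Lemma hilbert_conductor :
    (forall t t' u : F, t != 0 -> t' != 0 -> u != 0 ->
      hilbert (t * t') u = hilbert t u * hilbert t' u) ->
  exists A B : F, [/\ principal_ideal absv (pi ^+ (2 * e - 1)%N) (A - 1),
    Ounit absv A, Ounit absv B & hilbert A B = -1].
Proof.
move=> hmul; have [c [hc h]] := hilbert_pi_nontrivial HQ2 Hpi He.
have e0 := e_gt0 HQ2 Hpi He; have Opi := integral_pi Hpi.
have [h1 h2] := pi_e_2 HQ2 Hpi He; have pe0 := expf_neq0 e pi0.
pose al := pi ^+ (2 * e - 1)%N.
have eal : pi ^+ (2 * e - 1) = pi * (pi ^+ e.-1) ^+ 2.
  by rewrite -exprM -exprS; congr (_ ^+ _); lia.
have al0 : al != 0 by rewrite expf_neq0.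
(* This is 4c / [al], written with the unit 2 / pi^e; exactly one factor [pi] is left over. *)
pose be := pi * ((2%:R / pi ^+ e) * (2%:R / pi ^+ e) * c).
have epi : pi ^+ e = pi * pi ^+ e.-1 by rewrite -exprS prednK.
have albe : al * be = 4%:R * c.
  rewrite /al /be eal; have -> : 4%:R = 2%:R * 2%:R :> F by ring.
  by rewrite epi; field; rewrite pi0 expf_neq0.
have Mpi := M_pi HQ2 Hpi.
have Mal : M al by rewrite /al eal; apply: (M_mulr HQ2) => //; do 2 apply: (O_exp HQ2).
have Mbe : M be by apply: (M_mulr HQ2) => //; do 2 apply: (O_mul HQ2) => //.
have UA : Ounit absv (1 - al) by apply: unit_1M; exact: (M_opp HQ2).
have UB : Ounit absv (1 - be) by apply: unit_1M; exact: (M_opp HQ2).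
have Jd : J (- (4%:R * c)).
  by apply/level_idealP; exists (- c); [exact: (O_opp HQ2) | rewrite mulrN].
set d := 1 - 4%:R * c in h; have Ud : Ounit absv d by apply: level_unit.
have hd v : Ounit absv v -> hilbert d v = 1 by case=> v0 Ov Ovi; exact: level_hilbert_unit.
exists (1 - al), (1 - be); split => //.
  by rewrite addrAC subrr add0r; exists (-1); rewrite ?mulrN1 //; exact/(O_opp HQ2)/(O_1 HQ2).
move: UA UB Ud => /[dup] UA [A0 _ _] /[dup] UB [B0 _ _] /[dup] Ud [d0 _ _].
have Bd0 := mulf_neq0 B0 d0; have Y0 := mulf_neq0 al0 Bd0.
(* The entries add up to (1 - al be) d = d^2, a square, so the symbol is 1. In its bimultiplicative
   expansion every factor that pairs [d] with a unit is trivial, and so is (al, 1 - al). *)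
have : hilbert ((1 - al) * d) (al * ((1 - be) * d)) = 1.
  apply: (hilbert_solution (z := d)).
  have -> : (1 - al) * d + al * ((1 - be) * d) = (1 - al * be) * d by ring.
  by rewrite albe expr2.
rewrite (hmul _ _ _ A0 d0 Y0) !(hilbertC _ (al * _)) !(hmul al) // !(hmul (1 - be)) //.
rewrite (hilbertC al (1 - al)) (hilbert_solution (z := 1)); last by rewrite expr1n subrK.
rewrite !(hilbertC _ d) (hd (1 - al)) // (hd (1 - be)) // (hd d) // mul1r !mulr1.
(* The exponent 2e - 1 is odd, so [al] is [pi] times a square. *)
have -> : hilbert d al = -1 by rewrite hilbertC /al eal hilbert_square ?expf_neq0 // hilbertC.
by rewrite mulrN1 (hilbertC (1 - be)) => <-; rewrite opprK.
Qed.

End CongruenceLevel.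

(** * Generated subgroups and root systems *)

Section Generated.
Variable G : groupType.
Implicit Types (S H : set G) (Q : G -> Prop).

Lemma generated_subgroup S : is_subgroup (generated S).
Proof.
split=> [H hH _|a b ha hb H hH hS|a ha H hH hS]; first exact: sg1.
- by apply: sgM => //; [apply: ha | apply: hb].
- by apply: sgV => //; apply: ha.
Qed.

Lemma sub_generated S : S `<=` generated S.
Proof. by move=> g hg H _; apply. Qed.

Lemma generated_min S H : is_subgroup H -> S `<=` H -> generated S `<=` H.
Proof. by move=> hH hS g; apply. Qed.

Lemma generated_mono S H : S `<=` H -> generated S `<=` generated H.
Proof.
move=> hS; apply: generated_min; first exact: generated_subgroup.
by move=> g /hS; apply: sub_generated.
Qed.

(** The elements [a] such that left multiplication by [a] and by its inverse preserves [Q] form a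
    subgroup containing [S]; the claim is the case of [g] acting on 1. *)
Lemma generated_ind S Q : (forall s, S s -> S s^-1%g) -> Q 1%g ->
  (forall s g, S s -> generated S g -> Q g -> Q (s * g)%g) -> forall g, generated S g -> Q g.
Proof.
move=> hV Q1 QM g hg.
pose H : set G := [set a | generated S a /\ forall k, generated S k -> Q k ->
  Q (a * k)%g /\ Q (a^-1 * k)%g].
have Hsg : is_subgroup H.
  have [g1 gM gV] := generated_subgroup S.
  split=> [|a b [ga ha] [gb hb]|a [ga ha]].
  - by split => // k _ hk; rewrite invg1 !mul1g.
  - split; first exact: gM.
    move=> k gk hk; rewrite -mulgA invgM -mulgA; split.
      by apply: (ha _ _ _).1; [exact: gM | exact: (hb _ gk hk).1].
    by apply: (hb _ _ _).2; [apply: gM => //; exact: gV | exact: (ha _ gk hk).2].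
  - split; first exact: gV.
    by move=> k gk hk; rewrite invgK; have [] := ha k gk hk.
have : H g.
  apply: hg => // s hs; split; first exact: sub_generated.
  by move=> k gk hk; split; apply: QM => //; apply: hV.
by case=> _ /(_ 1%g (sg1 (generated_subgroup S)) Q1) []; rewrite mulg1.
Qed.

Lemma generated_conj S H g : is_subgroup H -> (forall s, S s -> H (s ^ g)%g) ->
  forall k, generated S k -> H (k ^ g)%g.
Proof.
move=> hH hS k hk; apply: (hk [set a | H (a ^ g)%g]) => //.
split=> [|a b|a] /=; rewrite ?conj1g ?conjMg ?conjVg; first exact: sg1.
- exact: sgM.
- exact: sgV.
Qed.

Lemma generated_commute S T : (forall s t, S s -> T t -> commute s t) ->
  forall a b, generated S a -> generated T b -> commute a b.
Proof.
move=> hST a b ha hb.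
have cent_sg g : is_subgroup [set k : G | commute g k].
  by split=> [|k l|k] /=; [exact: commute1 | exact: commuteM | exact: commuteV].
have h1 t : T t -> commute t a.
  by move=> ht; apply: (ha [set k | commute t k]) => // s hs; apply/commute_sym/hST.
by apply: (hb [set k | commute a k]) => // t ht; apply/commute_sym/h1.
Qed.

End Generated.

(** * Simply laced root systems *)

Section Roots.
Variables (R : realType) (r : nat).
Local Notation E := 'rV[R]_r.

Lemma dotC (u v : E) : dot u v = dot v u.
Proof. by apply: eq_bigr => i _; rewrite mulrC. Qed.
Lemma dotDl (u v w : E) : dot (u + v) w = dot u w + dot v w.
Proof. by rewrite /dot -big_split; apply: eq_bigr => i _; rewrite mxE mulrDl. Qed.
Lemma dotZl k (u v : E) : dot (k *: u) v = k * dot u v.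
Proof. by rewrite /dot mulr_sumr; apply: eq_bigr => i _; rewrite mxE mulrA. Qed.
Lemma dotNl (u v : E) : dot (- u) v = - dot u v.
Proof. by rewrite -scaleN1r dotZl mulN1r. Qed.
Lemma dotDr (u v w : E) : dot u (v + w) = dot u v + dot u w.
Proof. by rewrite !(dotC u) dotDl. Qed.
Lemma dotNr (u v : E) : dot u (- v) = - dot u v.
Proof. by rewrite !(dotC u) dotNl. Qed.
Lemma dot0l (v : E) : dot 0 v = 0.
Proof. by rewrite -(scale0r 0) dotZl mul0r. Qed.

Lemma dot_ge0 (u : E) : 0 <= dot u u.
Proof. by apply: sumr_ge0 => i _; rewrite -expr2 sqr_ge0. Qed.

Lemma dot_eq0 (u : E) : (dot u u == 0) = (u == 0).
Proof.
apply/idP/eqP => [|->]; last by rewrite dot0l.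
rewrite psumr_eq0 => [/allP h|i _]; last by rewrite -expr2 sqr_ge0.
apply/rowP => i; have := h i; rewrite mem_index_enum => /(_ isT).
by rewrite mulf_eq0 orbb mxE => /eqP.
Qed.

Lemma dot_gt0 (u : E) : u != 0 -> 0 < dot u u.
Proof. by move=> u0; rewrite lt_def dot_ge0 dot_eq0 u0. Qed.

Variable Phi : seq E.
Hypotheses (HPhi : root_system Phi) (Hsl : simply_laced Phi).

(** [cartan] is real-valued. The floor is exact on roots, where the value is an integer, and carries
    no meaning elsewhere. *)
Definition cint (a b : E) : int := Num.floor (cartan a b).

Lemma root_neq0 a : a \in Phi -> a != 0.
Proof. by move=> ha; apply: contraNneq (rs_neq0 HPhi) => <-. Qed.

Lemma root_dot_gt0 a : a \in Phi -> 0 < dot a a.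
Proof. by move=> ha; apply/dot_gt0/root_neq0. Qed.

Lemma cint_dot a b : a \in Phi -> b \in Phi -> (cint a b)%:~R * dot b b = 2%:R * dot a b.
Proof.
move=> ha hb; rewrite /cint floorK; last exact: (rs_int HPhi).
by rewrite /cartan divfK // gt_eqF // root_dot_gt0.
Qed.

Lemma cintE a b : a \in Phi -> b \in Phi -> cartan a b = (cint a b)%:~R.
Proof. by move=> ha hb; rewrite /cint floorK //; exact: (rs_int HPhi). Qed.

Lemma cint_eq a b m : a \in Phi -> b \in Phi -> 2%:R * dot a b = m%:~R * dot b b -> cint a b = m.
Proof.
move=> ha hb; rewrite -cint_dot // => /(mulIf _) h; apply: (@intr_inj R); apply: h.
by rewrite gt_eqF // root_dot_gt0.
Qed.

Lemma cint_self a : a \in Phi -> cint a a = 2%:Z.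
Proof. by move=> ha; apply: cint_eq. Qed.

Lemma opp_root a : a \in Phi -> - a \in Phi.
Proof.
move=> ha; have := rs_refl HPhi ha ha; rewrite cintE // cint_self //.
by rewrite scaler_nat mulr2n opprD addrA subrr add0r.
Qed.

Lemma cintC a b : a \in Phi -> b \in Phi -> cint a b = cint b a.
Proof.
by move=> ha hb; apply: cint_eq => //; rewrite (Hsl hb ha) cint_dot // dotC.
Qed.

Lemma cintNl a b : a \in Phi -> b \in Phi -> cint (- a) b = - cint a b.
Proof.
move=> ha hb; apply: cint_eq => //; first exact: opp_root.
by rewrite dotNl mulrNz mulNr cint_dot // mulrN.
Qed.

Lemma cintNr a b : a \in Phi -> b \in Phi -> cint a (- b) = - cint a b.
Proof.
move=> ha hb; apply: cint_eq => //; first exact: opp_root.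
by rewrite !(dotNl, dotNr) opprK mulrNz mulNr mulrN cint_dot.
Qed.

Lemma cintDl a b c : a \in Phi -> b \in Phi -> a + b \in Phi -> c \in Phi ->
  cint (a + b) c = cint a c + cint b c.
Proof.
move=> ha hb hab hc; apply: cint_eq => //.
by rewrite dotDl mulrDr intrD [in RHS]mulrDl !cint_dot.
Qed.

Lemma cintDr a b c : a \in Phi -> b \in Phi -> a + b \in Phi -> c \in Phi ->
  cint c (a + b) = cint c a + cint c b.
Proof. by move=> ha hb hab hc; rewrite cintC // cintDl // !(cintC hc). Qed.

(** All roots have the same length: comparing (a + b, a + b) with (b, b) gives one direction, and
    for the other the reflection of [a] in [b] is a + b. *)
Lemma root_addP a b : a \in Phi -> b \in Phi -> (a + b \in Phi) <-> cint a b = -1.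
Proof.
move=> ha hb; split=> [hab|h].
  apply: cint_eq => //.
  have := Hsl hab hb; rewrite !(dotDl, dotDr) (Hsl ha hb) (dotC b a) => h.
  by rewrite mulN1r; lra.
by have := rs_refl HPhi hb ha; rewrite cintE // h scaleN1r opprK.
Qed.

(** Away from the first two cases a - b and a + b are nonzero, and their positive norms confine the
    Cartan integer strictly between -2 and 2. *)
Lemma cint_trichotomy a b : a \in Phi -> b \in Phi ->
  [\/ a = b, a = - b | [\/ cint a b = -1, cint a b = 0 | cint a b = 1]].
Proof.
move=> ha hb; have [->|nab] := eqVneq a b; first by constructor 1.
have [->|nabN] := eqVneq a (- b); first by constructor 2.
constructor 3; have := cint_dot ha hb; have hN := root_dot_gt0 hb.
have h1 : 0 < dot (a - b) (a - b) by rewrite dot_gt0 // subr_eq0.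
have h2 : 0 < dot (a + b) (a + b) by rewrite dot_gt0 // addr_eq0.
move: h1 h2; rewrite !(dotDl, dotDr, dotNl, dotNr) (Hsl ha hb) (dotC b a) => h1 h2 h.
have l1 : (cint a b)%:~R < (2%:Z)%:~R :> R by rewrite -(ltr_pM2r hN) h; lra.
have l2 : (- 2%:Z)%:~R < (cint a b)%:~R :> R by rewrite -(ltr_pM2r hN) h; lra.
rewrite ltr_int in l1; rewrite ltr_int in l2.
have : cint a b = -1 \/ cint a b = 0 \/ cint a b = 1 by lia.
by case=> [|[]]; [constructor 1 | constructor 2 | constructor 3].
Qed.

Lemma diff_not_root a b : a \in Phi -> b \in Phi -> a + b \in Phi -> a - b \notin Phi.
Proof.
move=> ha hb hab; apply/negP => /(root_addP ha (opp_root hb)); rewrite cintNr //.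
by move/(root_addP ha hb): hab => ->.
Qed.

Lemma root_neq_opp a : a \in Phi -> a <> - a.
Proof.
move=> ha h; have := cint_self ha; rewrite {2}h cintNr // cint_self //.
Qed.

Lemma spanning_dot_eq0 v : (forall a, a \in Phi -> dot a v = 0) -> v = 0.
Proof.
move=> h; apply/eqP; rewrite -dot_eq0; apply/eqP.
have : v \in <<Phi>>%VS by rewrite (rs_span HPhi) memvf.
move=> hmem; have := coord_span (X := in_tuple Phi) hmem.
set c := coord _ => {hmem} hv; rewrite {1}hv.
rewrite (big_morph (fun u => dot u v) (fun u w => dotDl u w v) (dot0l v)).
by rewrite big1 // => i _; rewrite dotZl h ?mulr0 // mem_nth.
Qed.

Lemma nat_nonroot (p : {poly R}) : p != 0 -> exists n : nat, p.[n%:R] != 0.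
Proof.
move=> p0; apply: contrapT => h.
pose s := [seq k%:R | k <- iota 0 (size p)] : seq R.
have hs : all (root p) s.
  apply/allP => x /mapP[k _ ->]; rewrite /root; apply: contrapT => hk.
  by apply: h; exists k; apply/negP.
have us : uniq s by rewrite map_inj_uniq ?iota_uniq // => x y /eqP; rewrite eqr_nat => /eqP.
by have := max_poly_roots p0 hs us; rewrite size_map size_iota ltnn.
Qed.

(* A coweight sum_i M^i Phi_i^vee with M outside the roots of finitely many polynomials. *)
Lemma generic_coweight : exists L : seq (E * nat),
  (forall p, p \in L -> p.1 \in Phi) /\
  {in Phi &, injective (fun a => \sum_(p <- L) cint a p.1 *+ p.2)}.
Proof.
pose q (ab : E * E) : {poly R} := \poly_(i < size Phi) cartan (ab.1 - ab.2) Phi`_i.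
have q0 ab : ab.1 != ab.2 -> q ab != 0.
  move=> ne; apply: contraNneq ne => h; rewrite -subr_eq0; apply/eqP.
  apply: spanning_dot_eq0 => a ha; rewrite dotC.
  have hi : (index a Phi < size Phi)%N by rewrite index_mem.
  move/polyP: h => /(_ (index a Phi)); rewrite coef_poly hi coef0 nth_index // /cartan.
  move/eqP; rewrite mulf_eq0 invr_eq0 (gt_eqF (root_dot_gt0 ha)) orbF mulf_eq0 pnatr_eq0.
  by move/eqP.
pose Q := \prod_(ab <- [seq (a, b) | a <- Phi, b <- Phi] | ab.1 != ab.2) q ab.
have [M hM] : exists M : nat, Q.[M%:R] != 0.
  by apply: nat_nonroot; rewrite prodf_seq_neq0; apply/allP => ab _; apply/implyP/q0.
exists [seq (Phi`_i, (M ^ i)%N) | i <- iota 0 (size Phi)]; split.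
  by move=> p /mapP[i]; rewrite mem_iota /= add0n => hi ->; rewrite mem_nth.
move=> a b ha hb /= hab; apply: contrapT => /eqP ne.
have : (q (a, b)).[M%:R] != 0.
  move: hM; rewrite horner_prod prodf_seq_neq0 => /allP /(_ (a, b)).
  by rewrite allpairs_f // ne => /(_ isT).
move/negP; apply; apply/eqP.
have hsum c : c \in Phi -> \sum_(i < size Phi) cartan c Phi`_i * M%:R ^+ i =
  (\sum_(p <- [seq (Phi`_i, (M ^ i)%N) | i <- iota 0 (size Phi)]) cint c p.1 *+ p.2)%:~R.
  move=> hc; rewrite big_map -(big_mkord xpredT (fun i => cartan c Phi`_i * M%:R ^+ i)).
  rewrite /index_iota subn0 rmorph_sum; apply: eq_big_seq => i; rewrite mem_iota add0n /= => hi.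
  by rewrite rmorphMn /= -cintE ?mem_nth // -natrX mulr_natr.
rewrite horner_poly.
have hB i : cartan (a - b) Phi`_i * M%:R ^+ i = cartan a Phi`_i * M%:R ^+ i - cartan b Phi`_i * M%:R ^+ i.
  by rewrite /cartan dotDl dotNl mulrBr !mulrBl.
by under eq_bigr do rewrite hB; rewrite sumrB !hsum // hab subrr.
Qed.

Hypotheses (Hirr : irreducible_rs Phi) (Hr : (2 <= r)%N).

(** Irreducibility is applied to the partition into {b, -b} and the rest, which is nonempty because
    the rank is at least 2. A sign change then makes the Cartan integer -1. *)
Lemma adjacent_root b : b \in Phi -> exists2 a, a \in Phi & cint a b = -1.
Proof.
move=> hb; pose P := [pred v | (v == b) || (v == - b)].
have [c hc nPc] : exists2 c, c \in Phi & ~~ P c.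
  apply: contrapT => hno.
  have hP c : c \in Phi -> P c by move=> hc; apply: contrapT => /negP h; apply: hno; exists c.
  have : (fullv <= <[b]>)%VS.
    rewrite -(rs_span HPhi); apply/span_subvP => c /hP /= /orP[] /eqP -> ; first exact: memv_line.
    by rewrite rpredN memv_line.
  move/dimvS; rewrite dim_vline dimvf /dim /= mul1n => h.
  by have := leq_trans Hr (leq_trans h (leq_b1 _)).
have [|a [d [ha hd Pa nPd had]]] := Hirr.2 P _ (ex_intro2 _ _ c hc nPc).
  by exists b; rewrite //= eqxx.
have hdb : dot d b <> 0.
  by move: Pa => /= /orP[] /eqP e; rewrite e ?dotNl dotC in had => // h; apply: had;
    rewrite h ?oppr0.
have := cint_dot hd hb.
have := cint_trichotomy hd hb; case.
- by move=> e; move: nPd; rewrite /= e eqxx.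
- by move=> e; move: nPd; rewrite /= e eqxx orbT.
case=> e.
- by exists d.
- rewrite e mul0r => /eqP; rewrite eq_sym mulf_eq0 pnatr_eq0 /= => /eqP h; by case: hdb.
- by exists (- d); rewrite ?opp_root ?cintNl // e.
Qed.

Lemma root_decomposition b : b \in Phi -> exists c d, [/\ c \in Phi, d \in Phi & c + d = b].
Proof.
move=> hb; have [a ha h] := adjacent_root hb.
exists (a + b), (- a); split; last by rewrite addrAC subrr add0r.
  exact/(root_addP ha hb).
exact: opp_root.
Qed.

End Roots.

(** * Simple roots and the Cartan matrix *)

Section SimpleRoots.
Variables (R : realType) (r : nat) (Phi Delta : seq 'rV[R]_r).
Hypotheses (HPhi : root_system Phi) (Hsl : simply_laced Phi) (HDelta : simple_roots Phi Delta).
Local Notation cint := (@cint R r).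

Let Delta_root d : d \in Delta -> d \in Phi.
Proof. exact: (sr_sub HDelta). Qed.

Lemma simple_uniq : uniq Delta.
Proof. exact: free_uniq (basis_free (sr_basis HDelta)). Qed.

(** Induction on height: a positive root has positive product with some simple root occurring in it,
    and unless they coincide their difference is a root. The closure rules are those that [hU_opp]
    and [hU_add] supply for the torus. *)
Lemma simple_root_ind (P : 'rV[R]_r -> Prop) :
  (forall d, d \in Delta -> P d) -> (forall a, a \in Phi -> P a -> P (- a)) ->
  (forall a d, a \in Phi -> d \in Delta -> cint a d = -1 -> P a -> P (a + d)) ->
  forall a, a \in Phi -> P a.
Proof.
move=> P0 PN PD.
have pos N (m : 'rV[R]_r -> nat) : (\sum_(d <- Delta) m d = N)%N ->
    \sum_(d <- Delta) (m d)%:R *: d \in Phi -> P (\sum_(d <- Delta) (m d)%:R *: d).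
  elim: N m => [|N IHN] m hN.
    rewrite big1_seq => [|d /andP[_ hd]].
      by move/(root_neq0 HPhi); rewrite eqxx.
    move/eqP: hN; rewrite sum_nat_seq_eq0 => /allP/(_ d hd) /eqP ->.
    by rewrite scale0r.
  set a := \sum_(d <- Delta) _ => ha.
  have [d hd /andP[md da]] : exists2 d, d \in Delta & (0 < m d)%N && (0 < dot d a).
    apply: contrapT => hno; have := root_dot_gt0 HPhi ha.
    rewrite {1}/a (big_morph (fun u => dot u a) (fun u v => dotDl u v a) (dot0l a)).
    rewrite ltNge => /negP; apply; rewrite big_seq; apply: sumr_le0 => d hd.
    rewrite dotZl; have [->|md] := posnP (m d); first by rewrite mul0r.
    rewrite pmulr_rle0 ?ltr0n // leNgt; apply/negP => da.
    by apply: hno; exists d; rewrite // md.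
  have hdP := Delta_root hd.
  have hc := cint_dot HPhi hdP ha; have hn := root_dot_gt0 HPhi ha.
  have hc0 : 0 < cint d a.
    rewrite -(ltr_int R) -(pmulr_lgt0 _ hn) hc; lra.
  case: (cint_trichotomy HPhi Hsl hdP ha) => [<-|e|].
  - exact: P0.
  - by move: hc0; rewrite e (cintNl HPhi) // (cint_self HPhi).
  case=> e; rewrite e // in hc0.
  (* Truncated subtraction is harmless, since [m d] is positive. *)
  pose m' d' := (m d' - (d' == d))%N.
  have hm' d' : (m d' = m' d' + (d' == d))%N.
    by rewrite /m' subnK //; case: eqP => // ->.
  have ha' : a = \sum_(d <- Delta) (m' d)%:R *: d + d.
    rewrite /a; under eq_bigr do rewrite hm' natrD scalerDl.
    rewrite big_split; congr (_ + _).
    rewrite (big_rem d) //= eqxx scale1r big1_seq ?addr0 // => d' /andP[_ hd'].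
    case: eqP => [e'|_]; last by rewrite scale0r.
    by move: hd'; rewrite e' mem_rem_uniqF // simple_uniq.
  set b := \sum_(d <- Delta) _ in ha'.
  have eb : a - d = b by rewrite ha' addrK.
  have hbd : b \in Phi.
    rewrite -eb; apply/(root_addP HPhi Hsl) => //; first exact: (opp_root HPhi).
    by rewrite (cintNr HPhi) // (cintC HPhi Hsl) // e.
  have hcb : cint b d = -1.
    rewrite -eb (cintDl HPhi) ?(opp_root HPhi) ?eb // (cintC HPhi Hsl ha) // e.
    by rewrite (cintNl HPhi) // (cint_self HPhi).
  rewrite ha'; apply: PD => //; apply: IHN => //.
  have : (\sum_(d <- Delta) m d = \sum_(d <- Delta) m' d + 1)%N.
    under eq_bigr do rewrite hm'.
    rewrite big_split; congr (_ + _)%N.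
    rewrite (big_rem d) //= eqxx big1_seq ?addn0 // => d' /andP[_ hd'].
    by case: eqP => // e'; move: hd'; rewrite e' mem_rem_uniqF // simple_uniq.
  by rewrite hN addn1 => -[].
move=> a ha; case: (sr_sign HDelta ha) => [[m hm]|[m hm]].
  by rewrite hm; apply: (pos _ m erefl); rewrite -hm.
rewrite -[a]opprK; apply: PN; first exact: (opp_root HPhi).
by rewrite hm; apply: (pos _ m erefl); rewrite -hm (opp_root HPhi).
Qed.

Definition cartan_matrix : 'M[int]_(size Delta) := \matrix_(i, j) cint Delta`_i Delta`_j.

(** A kernel vector gives a combination of simple roots orthogonal to all of them, hence zero by
    positive definiteness. *)
Lemma cartan_matrix_det : \det cartan_matrix != 0.
Proof.
apply/negP => /eqP d0.
have : \det (map_mx (intr : int -> R) cartan_matrix) == 0 by rewrite det_map_mx d0.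
move/det0P => [v v0 hv]; move/negP: v0; apply; apply/eqP/rowP => i; rewrite mxE.
have hin k : (k < size Delta)%N -> Delta`_k \in Phi by move=> hk; apply/Delta_root/mem_nth.
pose y := \sum_(i < size Delta) v 0 i *: Delta`_i.
have y0 : y = 0.
  apply/eqP; rewrite -dot_eq0; apply/eqP.
  rewrite {2}/y dotC (big_morph (fun u => dot u y) (fun u w => dotDl u w y) (dot0l y)).
  rewrite big1 // => j _; rewrite dotZl dotC.
  suff -> : dot y Delta`_j = 0 by rewrite mulr0.
  rewrite (big_morph (fun u => dot u Delta`_j) (fun u w => dotDl u w _) (dot0l _)).
  have hdj := root_dot_gt0 HPhi (hin j (ltn_ord j)).
  have := congr1 (fun M : 'rV_ _ => M 0 j * dot Delta`_j Delta`_j) hv;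
    rewrite !mxE mul0r mulr_suml => h.
  apply: (mulfI (x := 2%:R)); first by rewrite pnatr_eq0.
  rewrite mulr0 -[RHS]h mulr_sumr; apply: eq_bigr => k _.
  by rewrite !mxE dotZl -mulrA (cint_dot HPhi) ?hin // mulrCA.
have := basis_free (sr_basis HDelta).
rewrite -[Delta]/(val (in_tuple Delta)) => /freeP/(_ (fun i => v 0 i)).
by apply.
Qed.

(** The product condition says that the torus element with coordinates [nu] centralizes the simple
    root subgroups. Combining these equations through the adjugate of the Cartan matrix leaves its
    determinant as exponent. *)
Lemma cartan_torsion (F : fieldType) (nu : 'rV[R]_r -> F) :
  (forall d, d \in Delta -> nu d != 0) ->
  (forall a, a \in Delta -> \prod_(d <- Delta) nu d ^ cint a d = 1) ->
  exists2 D : int, D != 0 & forall d, d \in Delta -> nu d ^ D = 1.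
Proof.
move=> nu0 hnu; exists (\det cartan_matrix); first exact: cartan_matrix_det.
move=> d hd; pose k := Ordinal (etrans (index_mem d Delta) hd).
have hk : nu d = nu Delta`_k by rewrite /= nth_index.
have hin (i : 'I_(size Delta)) : Delta`_i \in Delta by rewrite mem_nth.
have hprod (I : Type) (s : seq I) (f : I -> int) (u : F) : u != 0 ->
    \prod_(i <- s) u ^ f i = u ^ \sum_(i <- s) f i.
  move=> u0; elim: s => [|i s IHs]; first by rewrite !big_nil expr0z.
  by rewrite !big_cons IHs expfzDr.
have hprodz (I : Type) (s : seq I) (f : I -> F) (z : int) :
    (\prod_(i <- s) f i) ^ z = \prod_(i <- s) f i ^ z.
  elim: s => [|i s IHs]; first by rewrite !big_nil exp1rz.
  by rewrite !big_cons expfzMl IHs.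
transitivity (\prod_(j < size Delta) nu Delta`_j ^ (\adj cartan_matrix *m cartan_matrix) k j).
  rewrite (bigD1 k) //= big1 ?mulr1 => [|j jk].
    by rewrite mul_adj_mx mxE eqxx mulr1n hk.
  by rewrite mul_adj_mx mxE eq_sym (negbTE jk) mulr0n expr0z.
under eq_bigr => j _ do rewrite mxE -hprod ?nu0 ?hin //.
rewrite exchange_big big1 //= => i _.
under eq_bigr => j _ do rewrite mulrC -exprz_exp.
rewrite -hprodz.
have -> : \prod_(j < size Delta) nu Delta`_j ^ cartan_matrix i j = 1; last by rewrite exp1rz.
rewrite -[RHS](hnu _ (hin i)) (big_nth 0) big_mkord.
by apply: eq_bigr => j _; rewrite mxE.
Qed.

End SimpleRoots.

(** * The double cover *)

Section LieIdentities.
Variables (F : fieldType) (n : nat).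
Implicit Types A B C : 'M[F]_n.

Lemma lieC A B : lie A B = - lie B A.
Proof. by rewrite /lie opprB. Qed.

Lemma lieZl k A B : lie (k *: A) B = k *: lie A B.
Proof. by rewrite /lie -scalemxAl -scalemxAr scalerBr. Qed.

Lemma lieZr k A B : lie A (k *: B) = k *: lie A B.
Proof. by rewrite /lie -scalemxAl -scalemxAr scalerBr. Qed.

Lemma lieDl A B C : lie (A + B) C = lie A C + lie B C.
Proof. by rewrite /lie mulmxDl mulmxDr opprD addrACA. Qed.

Lemma lie_jacobi A B C : lie A (lie B C) = lie (lie A B) C + lie B (lie A C).
Proof.
rewrite /lie !(mulmxBl, mulmxBr) !mulmxA.
move: (_ *m C) (A *m C *m B) (B *m C *m A) (C *m B *m A) => p1 p2 p3 p4.
move: (B *m A *m C) (C *m A *m B) => p5 p6.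
by apply/matrixP => i j; rewrite !mxE; ring.
Qed.

End LieIdentities.

(** * Comparison of polynomials in u and 1/u *)

Section Polynomials.
Variables (F : fieldType) (charF : forall m : int, (m%:~R == 0 :> F) = (m == 0)).

Lemma poly_eq0_nonzero (p : {poly F}) : (forall u, u != 0 -> p.[u] = 0) -> p = 0.
Proof.
move=> hp; apply/eqP; apply: contraT => p0.
pose s := [seq (k.+1)%:R | k <- iota 0 (size p)] : seq F.
have natF (k : nat) : (k%:R == 0 :> F) = (k == 0)%N by have := charF k.
have hs : all (root p) s.
  by apply/allP => _ /mapP[k _ ->]; rewrite /root hp // natF.
have us : uniq s.
  rewrite map_inj_uniq ?iota_uniq // => k l /eqP.
  rewrite -subr_eq0 -[X in X - _]/((k.+1%:Z)%:~R) -[X in _ - X]/((l.+1%:Z)%:~R)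
    -intrB charF subr_eq0.
  by move=> /eqP [].
by have := max_poly_roots p0 hs us; rewrite size_map size_iota ltnn.
Qed.

(** Multiplied by u^D, the left side is c1 u^D plus the reversal of [p], of degree below D, and the
    right side is c2 u^D plus higher terms, so the degrees separate. *)
Lemma poly_two_sided (p q : {poly F}) (c1 c2 : F) :
  (forall u, u != 0 -> c1 + u^-1 * p.[u^-1] = c2 + u * q.[u]) -> [/\ c1 = c2, p = 0 & q = 0].
Proof.
move=> hpq; pose D := size p; pose rv := \poly_(i < D) p`_(D.-1 - i).
have hr u : u != 0 -> u ^+ D * (u^-1 * p.[u^-1]) = rv.[u].
  move=> u0; rewrite horner_coef horner_poly -/D !mulr_sumr.
  rewrite (reindex_inj rev_ord_inj); apply: eq_bigr => i _ /=.
  have hi : (D - i.+1 = D.-1 - i)%N by lia.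
  rewrite hi mulrCA [p`_ _ * _]mulrC !mulrA [RHS]mulrC; congr (_ * _).
  have -> : u ^+ D = u ^+ i * u ^+ (D.-1 - i) * u.
    by rewrite -exprD -exprSr; congr (_ ^+ _); have := ltn_ord i; rewrite -/D; lia.
  by rewrite exprVn; field; rewrite u0 expf_neq0.
have e : rv = (c2 - c1)%:P * 'X^D + 'X^(D.+1) * q.
  apply/eqP; rewrite -subr_eq0; apply/eqP; apply: poly_eq0_nonzero => u u0.
  rewrite !hornerE -hr //.
  have -> : u^-1 * p.[u^-1] = c2 + u * q.[u] - c1 by rewrite -hpq // addrAC subrr add0r.
  by rewrite exprS; ring.
have hc i : (D <= i)%N -> rv`_i = 0 by move=> hi; rewrite coef_poly ltnNge hi.
have ec : c2 - c1 = 0.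
  have := hc D (leqnn D); rewrite e coefD coefCM coefXn eqxx mulr1 coefXnM.
  by rewrite ltnSn addr0.
have eq0 : q = 0.
  apply/polyP => i; have := hc (D.+1 + i)%N (leq_trans (leqnSn _) (leq_addr _ _)).
  by rewrite e ec mul0r add0r coefXnM ltnNge leq_addr /= addKn coef0.
have c12 : c1 = c2 by apply/esym/eqP; rewrite -subr_eq0 ec.
split => //; apply: poly_eq0_nonzero => u u0; have ui0 : u^-1 != 0 by rewrite invr_eq0.
have := hpq u^-1 ui0; rewrite invrK eq0 horner0 mulr0 c12 => /addrI /eqP.
by rewrite mulf_eq0 (negbTE u0) /= => /eqP.
Qed.

End Polynomials.

(** * Consequences of the relations of the cover *)

Section Cover.
Variables (F : fieldType) (charF : forall m : int, (m%:~R == 0 :> F) = (m == 0)).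
Variables (R : realType) (r : nat) (Hr : (2 <= r)%N) (Phi Delta : seq 'rV[R]_r).
Hypotheses (HPhi : root_system Phi) (Hirr : irreducible_rs Phi) (Hsl : simply_laced Phi).
Variables (n : nat) (c : 'rV[R]_r -> 'rV[R]_r -> int) (X : 'rV[R]_r -> 'M[F]_n).
Variables (G : groupType) (rho : G -> 'M[F]_n) (x : 'rV[R]_r -> F -> G).
Hypothesis HG : chevalley_group Phi Delta c X rho x.
Variables (Gt : groupType) (pr : Gt -> G) (zeta : Gt) (xt : 'rV[R]_r -> F -> Gt).
Hypothesis HGt : double_cover Phi c x pr zeta xt.
Hypothesis hilbert_nontrivial : exists t u : F, [/\ t != 0, u != 0 & hilbert t u = -1].

Local Notation cint := (@cint R r).
Local Notation w := (w_elt xt).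
Local Notation h := (h_elt xt).
Local Notation sg a b := ((c a b)%:~R : F).
Implicit Types a b d : 'rV[R]_r.

Let opp := opp_root HPhi.
Let addP := root_addP HPhi Hsl.

Lemma pr1 : pr 1%g = 1%g.
Proof. by apply: (mulgI (pr 1%g)); rewrite -(dc_prM HGt) !mulg1. Qed.

Lemma prV g : pr g^-1%g = (pr g)^-1%g.
Proof. by apply: (mulgI (pr g)); rewrite -(dc_prM HGt) !mulgV pr1. Qed.

Lemma xt0 a : a \in Phi -> xt a 0 = 1%g.
Proof. by move=> ha; apply: (mulgI (xt a 0)); rewrite (dc_add HGt) // addr0 mulg1. Qed.

Lemma xtV a t : a \in Phi -> (xt a t)^-1%g = xt a (- t).
Proof. by move=> ha; apply: (mulgI (xt a t)); rewrite (dc_add HGt) // subrr mulgV xt0. Qed.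

Lemma zetaC g : (zeta * g = g * zeta)%g.
Proof. exact: (dc_central HGt). Qed.

Lemma pr_zeta : pr zeta = 1%g.
Proof. by apply/(dc_ker HGt); right. Qed.

Lemma zeta2 : (zeta * zeta = 1)%g.
Proof.
have : pr (zeta * zeta)%g = 1%g by rewrite (dc_prM HGt) pr_zeta mulg1.
move/(dc_ker HGt) => [//|hz]; case: (dc_zeta HGt); apply: (mulgI zeta); by rewrite hz mulg1.
Qed.

Lemma fibre g g' : pr g = pr g' -> g' = g \/ g' = (zeta * g)%g.
Proof.
move=> hg; have : pr (g' * g^-1)%g = 1%g by rewrite (dc_prM HGt) prV hg mulgV.
move/(dc_ker HGt) => [e|e].
  by left; rewrite -[LHS](mulgVK g) e mul1g.
by right; rewrite -e mulgVK.
Qed.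

Lemma kernel_central k : pr k = 1%g -> forall g, (k * g = g * k)%g.
Proof. by move/(dc_ker HGt) => [|] -> g; rewrite ?mul1g ?mulg1 ?zetaC. Qed.

(** If x_a(t) = 1 with t nonzero, the lift is central, so its commutators with an adjacent root b
    make the lifted root subgroup of a + b trivial. Irreducibility spreads this to all roots, and
    the relation for a pair with symbol -1 then reads [zeta] = 1. *)
Lemma x_eq1 a t : a \in Phi -> x a t = 1%g -> t = 0.
Proof.
move=> ha hx; apply/eqP; apply: contraT => t0.
have hc : forall g, (xt a t * g = g * xt a t)%g.
  by apply: kernel_central; rewrite (dc_lift HGt).
pose Triv d := forall v, xt d v = 1%g.
have step d d' : d \in Phi -> d' \in Phi -> d + d' \in Phi -> Triv d -> Triv (d + d').
  move=> hd hd' hdd ht v; have := dc_comm HGt 1 (sg d d' * v) hd hd' hdd.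
  rewrite ht comm1g mulr1 mulrA -intrM.
  have -> : c d d' * c d d' = 1 by case: (cr_sign (cg_rep HG) hd hd' hdd) => ->.
  by rewrite mul1r => <-.
have stepN d : d \in Phi -> Triv d -> Triv (- d).
  move=> hd ht; have [f hf /(addP hf hd) hfd] := adjacent_root HPhi Hsl Hirr Hr hd.
  rewrite addrC in hfd.
  have t1 := step _ _ hd hf hfd ht.
  have e1 : d + f + - d = f by rewrite addrAC subrr add0r.
  have t2 : Triv f by rewrite -e1; apply: step => //; [exact: opp | rewrite e1].
  have e2 : f + - (d + f) = - d by rewrite opprD addrCA subrr addr0.
  by rewrite -e2; apply: step => //; [exact: opp | rewrite e2; exact: opp].
have [b hb hba] := adjacent_root HPhi Hsl Hirr Hr ha.
have hab : a + b \in Phi by apply/addP => //; rewrite (cintC HPhi Hsl).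
have tab : Triv (a + b).
  move=> v; have := dc_comm HGt t (sg a b * v / t) ha hb hab.
  rewrite /commg /conjg mulgA (mulgA _ _ (xt b _)) -mulgA hc mulgA mulgVK mulVg => e.
  rewrite {}e; congr (xt _ _).
  case: (cr_sign (cg_rep HG) ha hb hab) => ->; by field.
have all d : d \in Phi -> Triv d.
  move=> hd; apply: contrapT => nt.
  have [||d1 [d2 [h1 h2 /asboolP P1 /asboolP P2 hdot]]] := Hirr.2 (fun d => `[< Triv d >]).
  - by exists (a + b) => //; apply/asboolP.
  - by exists d => //; apply/asboolP.
  apply: P2; have := cint_dot HPhi h1 h2; case: (cint_trichotomy HPhi Hsl h1 h2).
  - by move=> <-.
  - by move=> e; rewrite -[d2]opprK -e; move=> _; apply: stepN.
  case=> e.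
  - have h12 : d1 + d2 \in Phi by apply/addP.
    have e1 : d1 + d2 + - d1 = d2 by rewrite addrAC subrr add0r.
    by move=> _; rewrite -e1; apply: (step) => //; [exact: opp | rewrite e1 | exact: (step)].
  - rewrite e mul0r => /eqP; rewrite eq_sym mulf_eq0 pnatr_eq0 /= => /eqP; by [].
  - have h12 : d2 + - d1 \in Phi.
      by apply/addP; rewrite ?opp // (cintNr HPhi) // (cintC HPhi Hsl) // e.
    have e1 : d1 + (d2 - d1) = d2 by rewrite addrCA subrr addr0.
    by move=> _; rewrite -e1; apply: step => //; rewrite e1.
have hw v : w a v = 1%g by rewrite /w_elt !all ?opp // !mulg1.
have hh v : h a v = 1%g by rewrite /h_elt !hw mulg1.
have [t1 [u1 [t10 u10 hs]]] := hilbert_nontrivial.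
have := dc_hilbert HGt ha (elimN eqP t10) (elimN eqP u10).
by rewrite !hh hs !mulg1 /mu2_elt /= => e; case: (dc_zeta HGt).
Qed.

Lemma X_neq0 a : a \in Phi -> X a != 0.
Proof.
move=> ha; apply/negP => /eqP X0.
have : x a 1 = x a 0 by apply: (cg_rho_inj HG); rewrite !(cg_x HG) // X0 !scaler0.
have -> : x a 0 = 1%g by rewrite -(dc_lift HGt) // xt0 // pr1.
by move/(x_eq1 ha)/eqP; rewrite oner_eq0.
Qed.

Lemma scale_X_inj a (k l : int) : a \in Phi -> k%:~R *: X a = l%:~R *: X a -> k = l.
Proof.
move=> ha /eqP; rewrite -subr_eq0 -scalerBl -intrB scaler_eq0 (negbTE (X_neq0 ha)) orbF charF.
by rewrite subr_eq0 => /eqP.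
Qed.

Lemma lie_coroot a b : a \in Phi -> b \in Phi ->
  lie (lie (X a) (X (- a))) (X b) = (cint b a)%:~R *: X b.
Proof. by move=> ha hb; apply: (cr_coroot (cg_rep HG)) => //; apply: (cintE HPhi). Qed.

Lemma c_anti a b : a \in Phi -> b \in Phi -> a + b \in Phi -> c a b = - c b a.
Proof.
move=> ha hb hab; apply: (scale_X_inj hab).
rewrite -(cr_lie (cg_rep HG)) // lieC mulrNz scaleNr; congr (- _).
by rewrite (cr_lie (cg_rep HG)) ?[b + a]addrC.
Qed.

Lemma sum_neq0 a b : a \in Phi -> b \in Phi -> cint a b != - 2%:Z -> a + b <> 0.
Proof.
move=> ha hb hab /eqP; rewrite addr_eq0 => /eqP e; move: hab.
by rewrite e (cintNl HPhi) // (cint_self HPhi) // eqxx.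
Qed.

(** The Jacobi identity for a, b and -b: since a - b is not a root, one of its terms drops out and a
    coroot acting on X_a remains. *)
Lemma c_cancel a b : a \in Phi -> b \in Phi -> a + b \in Phi -> c a b * c (a + b) (- b) = 1.
Proof.
move=> ha hb hab; have hcint := (addP ha hb).1 hab; have hnb := opp hb.
have := lie_jacobi (X a) (X b) (X (- b)).
rewrite (cr_lie0 (cg_rep HG) (a := a) (b := - b)) //; last first.
- by apply: sum_neq0 => //; rewrite (cintNr HPhi) // hcint.
- exact: (diff_not_root HPhi Hsl).
rewrite [lie (X b) 0](_ : _ = 0); last by rewrite /lie mulmx0 mul0mx subr0.
rewrite addr0 (cr_lie (cg_rep HG) (b := b)) // lieZl (cr_lie (cg_rep HG) (a := a + b)) ?addrK //.
rewrite lieC lie_coroot // hcint scalerA -intrM => e.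
by apply: (scale_X_inj ha); rewrite -e -scaleNr -mulrNz opprK.
Qed.

(** The Jacobi identity for a, b and -(a + b), bracketed once more with X_b, is a relation p + q =
    -2r between three signs, which forces p = q = -r. *)
Lemma c_rotate a b : a \in Phi -> b \in Phi -> a + b \in Phi ->
  c a (- (a + b)) = - c a b /\ c b (- (a + b)) = c a b.
Proof.
move=> ha hb hab; have hcint := (addP ha hb).1 hab.
have [hna hnb hnab] : [/\ - a \in Phi, - b \in Phi & - (a + b) \in Phi] by rewrite !opp.
have e1 : b - (a + b) = - a by rewrite opprD addrCA subrr addr0.
have e2 : a - (a + b) = - b by rewrite opprD addrA subrr add0r.
have := lie_jacobi (X a) (X b) (X (- (a + b))).
rewrite (cr_lie (cg_rep HG) (a := b)) ?e1 // (cr_lie (cg_rep HG) (b := - (a + b))) ?e2 //.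
rewrite (cr_lie (cg_rep HG) (b := b)) // !(lieZr, lieZl) => /(congr1 (fun Y => lie Y (X b))).
rewrite lieDl !lieZl !lie_coroot // (cintDr HPhi Hsl) // (cintC HPhi Hsl hb ha)
  hcint (cint_self HPhi) //.
rewrite !scalerA -!intrM -scalerDl -intrD => /(scale_X_inj hb).
have s1 : c a b = 1 \/ c a b = -1 by apply: (cr_sign (cg_rep HG)).
have s2 : c b (- (a + b)) = 1 \/ c b (- (a + b)) = -1 by apply: (cr_sign (cg_rep HG));
  rewrite ?e1.
have s3 : c a (- (a + b)) = 1 \/ c a (- (a + b)) = -1 by apply: (cr_sign (cg_rep HG));
  rewrite ?e2.
lia.
Qed.

Lemma c_sq a b : a \in Phi -> b \in Phi -> a + b \in Phi -> sg a b * sg a b = 1.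
Proof. by move=> ha hb hab; case: (cr_sign (cg_rep HG) ha hb hab) => ->; rewrite -intrM. Qed.

Lemma xt_conj a b s t : a \in Phi -> b \in Phi -> a + b \in Phi ->
  (xt a s ^ xt b t = xt a s * xt (a + b) (sg a b * s * t))%g.
Proof. by move=> ha hb hab; rewrite -(dc_comm HGt) // /commg mulVKg. Qed.

Lemma xt_conj0 a b s t : a \in Phi -> b \in Phi -> a + b \notin Phi -> a + b <> 0 ->
  (xt a s ^ xt b t = xt a s)%g.
Proof.
move=> ha hb hab hn; have := dc_comm0 HGt s t ha hb hab hn.
by rewrite /commg => e; apply: (mulgI (xt a s)^-1%g); rewrite e mulVg.
Qed.

Lemma xt_conj_self a s t : a \in Phi -> (xt a s ^ xt a t = xt a s)%g.
Proof. by move=> ha; rewrite /conjg !xtV // !(dc_add HGt) // addrC addrK. Qed.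

Lemma wV b t : b \in Phi -> (w b t)^-1%g = w b (- t).
Proof. by move=> hb; rewrite /w_elt !invgM !xtV ?opp // invrN mulgA. Qed.

Lemma not_sum a b m : a \in Phi -> b \in Phi -> cint a b = m -> m != -1 -> m != - 2%:Z ->
  a + b \notin Phi /\ a + b <> 0.
Proof.
move=> ha hb hm h1 h2; split; last by apply: sum_neq0; rewrite ?hm.
by apply/negP => /(addP ha hb); rewrite hm => /eqP; rewrite (negbTE h1).
Qed.

Lemma xt_conj_cint a b m s t : a \in Phi -> b \in Phi -> cint a b = m -> m != -1 -> m != - 2%:Z ->
  (xt a s ^ xt b t = xt a s)%g.
Proof. by move=> ha hb hm h1 h2; have [h3 h4] := not_sum ha hb hm h1 h2; apply: xt_conj0. Qed.

Lemma xt_conj_w0 a b s t : a \in Phi -> b \in Phi -> cint a b = 0 -> (xt a s ^ w b t = xt a s)%g.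
Proof.
move=> ha hb hab; have hab' : cint a (- b) = 0 by rewrite (cintNr HPhi) // hab.
rewrite /w_elt !conjgM (xt_conj_cint _ _ ha hb hab) // (xt_conj_cint _ _ ha (opp hb) hab') //.
by rewrite (xt_conj_cint _ _ ha hb hab).
Qed.

Lemma xt_conj_w a b s t : a \in Phi -> b \in Phi -> cint a b = -1 -> t != 0 ->
  (xt a s ^ w b t = xt (a + b) (sg a b * s * t))%g.
Proof.
move=> ha hb hab t0; have hr := (addP ha hb).2 hab.
have hab' : cint a (- b) = 1 by rewrite (cintNr HPhi) // hab.
have hr2 : cint (a + b) b = 1 by rewrite (cintDl HPhi) // hab (cint_self HPhi).
have hr3 : cint (a + b) a = 1.
  by rewrite (cintDl HPhi) // (cintC HPhi Hsl hb) // hab (cint_self HPhi).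
rewrite /w_elt !conjgM xt_conj // conjMg. rewrite (xt_conj_cint _ _ ha (opp hb) hab') //.
rewrite xt_conj ?addrK ?opp //.
have -> : sg (a + b) (- b) * (sg a b * s * t) * - t^-1 = - s.
  have := c_cancel ha hb hr => /(congr1 (fun m : int => m%:~R : F)).
  rewrite intrM mulr1z; move: (sg a b) (sg (a + b) (- b)) => p q e.
  by transitivity (- (p * q * s)); [field | rewrite e mul1r].
have -> : (xt a s * (xt (a + b) (sg a b * s * t) * xt a (- s)))%g = xt (a + b) (sg a b * s * t).
  by rewrite -[RHS](xt_conj_cint _ (- s) hr ha hr3) // /conjg xtV // opprK.
by rewrite (xt_conj_cint _ _ hr hb hr2).
Qed.

Lemma xt_conj_w1 a b s t : a \in Phi -> b \in Phi -> cint a b = 1 -> t != 0 ->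
  (xt a s ^ w b t = xt (a - b) (- sg (a - b) b * s / t))%g.
Proof.
move=> ha hb hab t0; have hab' : cint a (- b) = -1 by rewrite (cintNr HPhi) // hab.
have hr := (addP ha (opp hb)).2 hab'.
have hr1 : cint (a - b) b = -1 by rewrite (cintDl HPhi) ?opp // hab (cintNl HPhi) //
  (cint_self HPhi).
apply: (canLR (conjgKV _)); rewrite wV // xt_conj_w ?oppr_eq0 //.
rewrite subrK; congr (xt a _).
have hs := c_sq hr hb; rewrite subrK in hs.
by transitivity (sg (a - b) b * sg (a - b) b * s); [rewrite hs // mul1r | field].
Qed.

(** The commutator relations do not cover the pair b, -b. Hence x_b(s) is written as a commutator
    for a decomposition b = a + d, whose two factors [w b t] conjugates in a known way. *)
Lemma xt_conj_w_self b s t : b \in Phi -> t != 0 ->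
  (xt b s ^ w b t = xt (- b) (- (s / t ^+ 2)))%g.
Proof.
move=> hb t0; have [a [d [ha hd hs]]] := root_decomposition HPhi Hsl Hirr Hr hb.
have had : a + d \in Phi by rewrite hs.
have hda : d + a \in Phi by rewrite addrC.
have h1 := (addP ha hd).1 had.
have hdc : cint d a = -1 by rewrite (cintC HPhi Hsl).
have hab : cint a b = 1 by rewrite -hs (cintDr HPhi Hsl) // (cint_self HPhi) // h1.
have hdb : cint d b = 1 by rewrite -hs (cintDr HPhi Hsl) // hdc (cint_self HPhi).
have ea : a - b = - d by rewrite -hs opprD addrA subrr add0r.
have ed : d - b = - a by rewrite -hs opprD addrCA subrr addr0.
have hsq := c_sq ha hd had.
have -> : xt b s = [~ xt a (sg a d * s), xt d 1]%g.
  by rewrite (dc_comm HGt) // hs; congr (xt b _); rewrite mulr1 mulrA hsq mul1r.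
rewrite conjRg !xt_conj_w1 // ea ed.
have en : - d + - a = - b by rewrite -opprD addrC hs.
rewrite (dc_comm HGt) ?opp // ?en ?opp //; congr (xt _ _).
have r1 := c_rotate (opp hd) hb; have r2 := c_rotate (opp ha) hb.
have e1 : - d + b = a by rewrite -hs addrCA addNr addr0.
have e2 : - a + b = d by rewrite -hs addrA addNr add0r.
rewrite e1 in r1; rewrite e2 in r2.
have [r1a r1b] := r1 ha; have [r2a r2b] := r2 hd.
have c1 := c_cancel ha hd had; have c2 := c_cancel hd ha hda; rewrite [d + a]addrC hs in c2;
  rewrite hs in c1.
have bnd : b + - d = a by rewrite addrC.
have bna : b + - a = d by rewrite addrC.
have a1 := c_anti (opp hd) hb; rewrite e1 in a1; have {}a1 := a1 ha.
have a2 := c_anti (opp ha) hb; rewrite e2 in a2; have {}a2 := a2 hd.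
have a3 := c_anti hd ha hda.
have s1 := cr_sign (cg_rep HG) ha hd had.
have s2 : c (- d) b = 1 \/ c (- d) b = -1 by apply: (cr_sign (cg_rep HG)); rewrite ?e1 ?opp.
have s3 : c (- a) b = 1 \/ c (- a) b = -1 by apply: (cr_sign (cg_rep HG)); rewrite ?e2 ?opp.
(* Rotation makes the first two signs multiply to -1; cancellation and antisymmetry make the last
   two multiply to 1. *)
have key : c (- d) (- a) * c (- d) b * c (- a) b * c a d = -1.
  have : c (- d) (- a) = - c (- d) b by [].
  by move=> ->; nia.
have {}key : sg (- d) (- a) * sg (- d) b * sg (- a) b * sg a d = -1.
  by rewrite -!intrM key.
transitivity (sg (- d) (- a) * sg (- d) b * sg (- a) b * sg a d * s / t ^+ 2); first by field.
by rewrite key; field.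
Qed.

Lemma xt_conj_w_opp b s t : b \in Phi -> t != 0 -> (xt (- b) s ^ w b t = xt b (- (s * t ^+ 2)))%g.
Proof.
move=> hb t0; apply: (canLR (conjgKV _)); rewrite wV // xt_conj_w_self ?oppr_eq0 //.
by congr (xt _ _); rewrite sqrrN; field.
Qed.

(** Conjugating [w b t] by itself exchanges the root subgroups of b and -b among its three
    factors. *)
Lemma w_opp b t : b \in Phi -> t != 0 -> w b t = w (- b) (- t^-1).
Proof.
move=> hb t0; have <- : (w b t ^ w b t = w b t)%g by rewrite conjgE mulKg.
rewrite {1}/w_elt !conjMg xt_conj_w_self // xt_conj_w_opp // /w_elt opprK.
have e1 : - (t / t ^+ 2) = - t^-1 by field.
have e2 : - (- t^-1 * t ^+ 2) = - (- t^-1)^-1 by rewrite invrN invrK; field.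
by rewrite e1 e2.
Qed.

(** The exponent is negative because [k ^ g] means g^-1 k g. *)
Lemma xt_conj_h a b s t : a \in Phi -> b \in Phi -> t != 0 ->
  (xt a s ^ h b t = xt a (t ^ (- cint a b) * s))%g.
Proof.
move=> ha hb t0; have n10 : -1 != 0 :> F by rewrite oppr_eq0 oner_eq0.
rewrite /h_elt conjgM; case: (cint_trichotomy HPhi Hsl ha hb).
- move=> ->; rewrite (cint_self HPhi) // xt_conj_w_self // xt_conj_w_opp // -invr_expz -exprnP.
  by congr (xt _ _); field.
- move=> ->; rewrite (cintNl HPhi) // (cint_self HPhi) // xt_conj_w_opp // xt_conj_w_self //.
  by rewrite opprK -exprnP; congr (xt _ _); field; rewrite oner_neq0.
case=> e; rewrite e.
- have hr := (addP ha hb).2 e.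
  have e1 : cint (a + b) b = 1 by rewrite (cintDl HPhi) // e (cint_self HPhi).
  rewrite xt_conj_w // xt_conj_w1 // addrK; congr (xt _ _).
  transitivity (sg a b * sg a b * (t * s)); first by field.
  by rewrite c_sq // opprK expr1z mul1r.
- by rewrite !xt_conj_w0 // oppr0 expr0z mul1r.
- have e1 : cint a (- b) = -1 by rewrite (cintNr HPhi) // e.
  have hr := (addP ha (opp hb)).2 e1.
  have e2 : cint (a - b) b = -1 by rewrite (cintDl HPhi) ?opp // e (cintNl HPhi)
    // (cint_self HPhi).
  rewrite xt_conj_w1 // xt_conj_w // subrK; congr (xt _ _).
  transitivity (sg (a - b) b * sg (a - b) b * (t^-1 * s)); first by field.
  by rewrite c_sq ?subrK // mul1r -invr_expz expr1z.
Qed.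

Lemma w_conj_h a b s t : a \in Phi -> b \in Phi -> t != 0 -> s != 0 ->
  (w a s ^ h b t = w a (t ^ (- cint a b) * s))%g.
Proof.
move=> ha hb t0 s0; rewrite /w_elt !conjMg !xt_conj_h ?opp // (cintNl HPhi) //.
by rewrite mulrN invfM invr_expz opprK.
Qed.

Lemma h_divE a t s : a \in Phi -> (h a t * (h a s)^-1 = w a t * w a (- s))%g.
Proof.
by move=> ha; rewrite /h_elt invgM mulgA mulgK wV.
Qed.

Definition sig (t u : F) : Gt := mu2_elt zeta (hilbert t u).

Lemma sigC t u g : (sig t u * g = g * sig t u)%g.
Proof. by rewrite /sig /mu2_elt; case: ifP => _; rewrite ?mul1g ?mulg1 ?zetaC. Qed.

Lemma sigK t u g : (sig t u * (sig t u * g) = g)%g.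
Proof. by rewrite /sig /mu2_elt; case: ifP => _; rewrite ?mul1g // mulgA zeta2 mul1g. Qed.

Lemma sig1 t u : hilbert t u = 1 -> sig t u = 1%g.
Proof. by rewrite /sig /mu2_elt => ->. Qed.

Lemma h_mul a t u : a \in Phi -> t != 0 -> u != 0 -> (h a t * h a u = sig t u * h a (t * u))%g.
Proof. by move=> ha t0 u0; apply: (dc_hilbert HGt) => //; apply/eqP. Qed.

(** Conjugation rescales both [w] factors by [v], turning h_a(s) into h_a(sv) h_a(v)^-1; the
    multiplication rule for h_a then produces the symbol. *)
Lemma h_conj_h a b s t : a \in Phi -> b \in Phi -> t != 0 -> s != 0 ->
  (h a s ^ h b t = sig s (t ^ (- cint a b)) * h a s)%g.
Proof.
move=> ha hb t0 s0; set v := t ^ _; have v0 : v != 0 by rewrite expfz_neq0.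
rewrite {1}/h_elt conjMg !w_conj_h // ?oppr_eq0 ?oner_neq0 // -/v mulrN1 -h_divE //.
have := h_mul ha s0 v0 => e; rewrite mulrC -(sigK s v (h a (s * v))) -e.
by rewrite -mulgA mulgK.
Qed.

(** For <b, a^vee> = -1, conjugation by h_a(u) multiplies h_b(s) by (s, u); that it respects the
    product h_b(t) h_b(t') is bimultiplicativity of the symbol. *)
Lemma sig_mull t t' u : t != 0 -> t' != 0 -> u != 0 -> sig (t * t') u = (sig t u * sig t' u)%g.
Proof.
move=> t0 t0' u0.
have [a ha] : exists a, a \in Phi.
  by case: (Phi) (Hirr.1) => // a l _; exists a; rewrite inE eqxx.
have [b hb hab] := adjacent_root HPhi Hsl Hirr Hr ha.
have hconj s : s != 0 -> (h b s ^ h a u = sig s u * h b s)%g.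
  by move=> s0; rewrite h_conj_h // hab opprK expr1z.
have := hconj _ (mulf_neq0 t0 t0'); have := h_mul hb t0 t0'; have := hconj _ t0;
  have := hconj _ t0'.
move: (h b t) (h b t') (h b (t * t')) (h a u) => A B C g hB hA hAB hC.
have := conjMg A B g; rewrite hAB conjMg hA hB hC.
have -> : (sig t t' ^ g)%g = sig t t' by rewrite /conjg sigC mulKg.
rewrite (mulgA (sig t t')) (sigC t t') -mulgA.
have -> : (sig t u * A * (sig t' u * B) = (sig t u * sig t' u) * (sig t t' * C))%g.
  by rewrite -hAB -!mulgA; congr (_ * _)%g; rewrite mulgA -sigC mulgA.
by move/mulIg.
Qed.

Lemma hilbert_mull (t t' u : F) : t != 0 -> t' != 0 -> u != 0 ->
  hilbert (t * t') u = hilbert t u * hilbert t' u.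
Proof.
move=> t0 t0' u0; have := sig_mull t0 t0' u0; rewrite /sig.
have hz := dc_zeta HGt.
case: (hilbert_sign (t * t') u) => ->; case: (hilbert_sign t u) => ->;
  case: (hilbert_sign t' u) => -> //; rewrite /mu2_elt /= ?mulg1 ?mul1g ?zeta2 => e //;
  by case: hz.
Qed.

Lemma wE b t : w b t = (xt b t * xt (- b) (- t^-1) * xt b t)%g.
Proof. by []. Qed.

Lemma xt_rank_one b t s : b \in Phi -> t != 0 -> 1 + t * s != 0 ->
  (xt b t * xt (- b) s = sig (1 + t * s) (t / (1 + t * s)) *
     (xt (- b) (s / (1 + t * s)) * h b (1 + t * s) * xt b (t / (1 + t * s))))%g.
Proof.
move=> hb t0; set q := 1 + t * s => q0; set v := t / q.
have v0 : v != 0 by rewrite mulf_neq0 ?invr_eq0.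
have e1 : xt b t = (w b t * (xt b (- t) * xt (- b) t^-1))%g.
  by rewrite wE -!mulgA (mulgA (xt b t) (xt b (- t))) (dc_add HGt) // subrr
       xt0 // mul1g (dc_add HGt) ?opp // addNr xt0 ?opp // mulg1.
have e2 : xt (- b) v^-1 = (xt b v * (w b (- v) * xt b v))%g.
  by rewrite wE -!mulgA (dc_add HGt) // addNr xt0 // mulg1 mulgA (dc_add HGt) // subrr xt0 //
    mul1g
       invrN opprK.
rewrite {1}e1 -(mulgA (w b t)) -(mulgA (xt b (- t))) (dc_add HGt) ?opp //.
have -> : t^-1 + s = v^-1 by rewrite /v invf_div /q; field.
rewrite e2 (mulgA (xt b (- t))) (dc_add HGt) // (mulgA (w b t)) (conjgCV (w b t)) wV //.
rewrite xt_conj_w_self ?oppr_eq0 // -(mulgA (xt (- b) _)) (mulgA (w b t)) -h_divE //.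
have -> : - ((- t + v) / (- t) ^+ 2) = s / q.
  transitivity ((t - v) / t ^+ 2); first by rewrite sqrrN; field.
  have -> : t - v = t ^+ 2 * s / q by rewrite /v; apply: (mulIf q0); rewrite mulrBl !divfK // /q;
    ring.
  by field; rewrite ?q0 ?t0.
(* The symbol of the rank one formula arises here, from splitting t as qv. *)
have e3 : h b t = (sig q v * (h b q * h b v))%g.
  by rewrite h_mul // sigK; congr h_elt; rewrite /v; field.
rewrite e3; move: (h b q) (h b v) (xt (- b) _) (xt b v) => A B C D.
by rewrite -!mulgA mulVKg !mulgA (sigC q v C).
Qed.

Lemma pr_h a t : a \in Phi -> pr (h a t) = h_elt x a t.
Proof. by move=> ha; rewrite /h_elt /w_elt !(dc_prM HGt) !(dc_lift HGt) ?opp. Qed.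

Lemma no_normal_splitting (Gam H : set G) (A B : F) (s : G -> Gt) :
  is_subgroup H -> A != 0 -> B != 0 -> hilbert A B = -1 ->
  (forall a, a \in Phi -> Gam (h_elt x a A)) -> (forall b, b \in Phi -> H (h_elt x b B)) ->
  splitting pr Gam s -> ~ normal_in (s @` Gam) (pr @^-1` H).
Proof.
move=> sgH A0 B0 hAB hGam hH [_ hs] [_ _ hnorm].
have [a ha] : exists a, a \in Phi.
  by case: (Phi) (Hirr.1) => // a l _; exists a; rewrite inE eqxx.
have [b hb hba] := adjacent_root HPhi Hsl Hirr Hr ha.
have hab : cint a b = -1 by rewrite (cintC HPhi Hsl).
pose g := h_elt x a A; have hg : Gam g := hGam a ha.
have hz y : pr y = g -> (y ^ h b B = zeta * y)%g.
  have hhA : (h a A ^ h b B = zeta * h a A)%g.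
    by rewrite h_conj_h // hab opprK expr1z /sig hAB.
  rewrite /g -(pr_h A ha) => /esym/fibre[->//|->].
  have zJ : (zeta ^ h b B = zeta)%g by rewrite conjgE zetaC mulKg.
  by rewrite conjMg hhA zJ.
(* Normality puts [zeta * s g] into the image of [s]. It lies over [g], so it would have to equal
   [s g]. The inverse adapts to the left conjugation in [normal_in]. *)
have := hnorm (h b B)^-1%g (s g) _ (ex_intro2 _ _ g hg erefl).
rewrite /preimage /= prV (pr_h B hb) => /(_ (sgV sgH (hH b hb))) [g' hg' e].
have e2 : s g' = (zeta * s g)%g by rewrite -(hz _ (hs g hg)) e invgK conjgE -mulgA.
have eg : g' = g by rewrite -(hs g' hg') e2 (dc_prM HGt) pr_zeta mul1g hs.
by apply: (dc_zeta HGt); apply: (mulIg (s g)); rewrite -e2 eg mul1g.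
Qed.

(** * The lifted congruence subgroup *)

Section CongruenceSubgroup.
(** [O] and [J] stand for the ring of integers and the ideal 4O; the arithmetic of the level enters
    through the hypotheses that follow. *)
Variables O J : F -> Prop.
Hypotheses (O_one : O 1) (O_addr : forall s t, O s -> O t -> O (s + t))
  (O_oppr : forall s, O s -> O (- s)) (O_mulr : forall s t, O s -> O t -> O (s * t)).
Hypotheses (J_sub : forall s, J s -> O s) (J_zero : J 0)
  (J_add : forall s t, J s -> J t -> J (s + t))
  (J_mul : forall s t, O s -> J t -> J (s * t)).
Hypotheses (J_neq0 : forall s, J s -> 1 + s != 0) (J_inv : forall s, J s -> O (1 + s)^-1).
Hypothesis hil_unit : forall s v, J s -> v != 0 -> O v -> O v^-1 -> hilbert (1 + s) v = 1.
Hypothesis hil_rank_one : forall s t, O t -> t != 0 -> J s ->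
  hilbert (1 + t * s) (t / (1 + t * s)) = 1.
Hypothesis J_torsion : forall s (m : int), J s -> m != 0 -> (1 + s) ^ m = 1 -> s = 0.
Hypothesis HDelta : simple_roots Phi Delta.

Local Notation U u := (J (u - 1)).

Lemma J_opp s : J s -> J (- s).
Proof. by move=> hs; rewrite -mulN1r; apply: J_mul => //; apply: O_oppr. Qed.

Lemma U_shift u : U u -> u = 1 + (u - 1).
Proof. by move=> _; rewrite addrCA subrr addr0. Qed.

Lemma U_neq0 u : U u -> u != 0.
Proof. by move=> hu; rewrite (U_shift hu) J_neq0. Qed.

Lemma U_O u : U u -> O u.
Proof. by move=> hu; rewrite (U_shift hu); apply: O_addr => //; apply: J_sub. Qed.

Lemma U_OV u : U u -> O u^-1.
Proof. by move=> hu; rewrite (U_shift hu); apply: J_inv. Qed.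

Lemma U_1 : U 1.
Proof. by rewrite subrr. Qed.

Lemma U_mul u v : U u -> U v -> U (u * v).
Proof.
move=> hu hv; have -> : u * v - 1 = u * (v - 1) + (u - 1) by ring.
by apply: J_add => //; apply: J_mul => //; apply: U_O.
Qed.

Lemma U_inv u : U u -> U u^-1.
Proof.
move=> hu; have -> : u^-1 - 1 = - u^-1 * (u - 1).
  by rewrite mulrBr mulNr mulVf ?U_neq0 // mulr1 opprK addrC.
by apply: J_mul => //; apply: O_oppr; apply: U_OV.
Qed.

Lemma U_expz u (m : int) : U u -> U (u ^ m).
Proof.
move=> hu; have hpos (k : nat) : U (u ^+ k).
  by elim: k => [|k IHk]; [exact: U_1 | rewrite exprS; apply: U_mul].
case: m => k; first exact: hpos.
by rewrite NegzE -exprnN; apply: U_inv.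
Qed.

Lemma sig_U u v : U u -> v != 0 -> O v -> O v^-1 -> sig u v = 1%g.
Proof. by move=> hu v0 Ov Ovi; apply: sig1; rewrite (U_shift hu) hil_unit. Qed.

Lemma sig_UU u v : U u -> U v -> sig u v = 1%g.
Proof. by move=> hu hv; apply: sig_U; rewrite ?U_neq0 //; [apply: U_O | apply: U_OV]. Qed.

Lemma hU_mul a u v : a \in Phi -> U u -> U v -> (h a u * h a v = h a (u * v))%g.
Proof. by move=> ha hu hv; rewrite h_mul ?U_neq0 // sig_UU // mul1g. Qed.

Lemma hU_1 a : a \in Phi -> h a 1 = 1%g.
Proof.
by move=> ha; apply: (mulgI (h a 1)); rewrite (hU_mul ha U_1 U_1) mulr1 mulg1.
Qed.

Lemma hU_inv a u : a \in Phi -> U u -> ((h a u)^-1 = h a u^-1)%g.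
Proof.
move=> ha hu; apply: (mulgI (h a u)).
by rewrite mulgV (hU_mul ha hu (U_inv hu)) divff ?U_neq0 // hU_1.
Qed.

Lemma hU_commute a b u v : a \in Phi -> b \in Phi -> U u -> U v -> commute (h a u) (h b v).
Proof.
move=> ha hb hu hv; rewrite /commute (conjgC (h a u)) h_conj_h ?U_neq0 //.
by rewrite sig_UU ?mul1g //; apply: U_expz.
Qed.

(** Structure constants bring in signs. As -1 is a unit of [O], its symbol with an element of 1 + J
    is trivial and the sign cancels. *)
Lemma hU_div_sign a u s : a \in Phi -> U u -> s = 1 \/ s = -1 ->
  (h a (s * u) * (h a s)^-1 = h a u)%g.
Proof.
move=> ha hu hs; have s0 : s != 0 by case: hs => ->; rewrite ?oppr_eq0 oner_eq0.
have hO : O s /\ O s^-1 by case: hs => ->; rewrite ?invrN invr1; split=> //; apply: O_oppr.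
have := h_mul ha (U_neq0 hu) s0; rewrite sig_U ?mul1g //; [|by case: hO|by case: hO].
by rewrite mulrC => <-; rewrite mulgK.
Qed.

Lemma hU_opp a u : a \in Phi -> U u -> (h (- a) u = (h a u)^-1)%g.
Proof.
move=> ha hu; have u0 := U_neq0 hu; have n10 : -1 != 0 :> F by rewrite oppr_eq0 oner_eq0.
have -> : h (- a) u = (w (- a) u * w (- a) (-1))%g by [].
have e1 : w (- a) u = w a (- u^-1).
  by rewrite [RHS]w_opp ?oppr_eq0 ?invr_eq0 //; congr w_elt; rewrite invrN invrK opprK.
have e2 : w (- a) (-1) = w a (- (-1)).
  by rewrite [RHS]w_opp ?oppr_eq0 ?oner_neq0 // opprK invr1.
rewrite e1 e2 -h_divE // (hU_inv ha hu) -(hU_div_sign (s := -1) ha (U_inv hu)); last by right.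
by rewrite mulN1r.
Qed.

(* Both sides compute the conjugate of [h b u] by [w a 1]. *)
Lemma hU_add a b u : a \in Phi -> b \in Phi -> cint a b = -1 -> U u ->
  (h (a + b) u = h b u * h a u)%g.
Proof.
move=> ha hb hab hu; have hr := (addP ha hb).2 hab.
have u0 := U_neq0 hu; have o0 := oner_neq0 F.
have hba : cint b a = -1 by rewrite (cintC HPhi Hsl).
have hba' : cint (- b) a = 1 by rewrite (cintNl HPhi) // hba.
have hrba : b + a \in Phi by rewrite addrC.
have hn : - (b + a) \in Phi by apply: opp.
have e0 : - b - a = - (b + a) by rewrite opprD.
have hs : sg b a = 1 \/ sg b a = -1 by case: (cr_sign (cg_rep HG) hb ha hrba) => ->;
  [left | right].
have hs2 : - sg (- (b + a)) a = sg b a.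
  have [_ r1] := c_rotate hb ha hrba.
  have e3 : - (b + a) + a = - b by rewrite opprD subrK.
  have r2 : c (- (b + a)) a = - c a (- (b + a)) by apply: c_anti; rewrite ?e3 ?opp.
  by rewrite r2 r1 -mulrNz opprK.
have wconj v : v != 0 -> (w b v ^ w a 1 = w (a + b) (sg b a * v))%g.
  move=> v0; rewrite (wE b v) !conjMg xt_conj_w // xt_conj_w1 ?opp // e0 hs2 (addrC a)
    !mulr1 divr1.
  rewrite wE; congr (_ * xt _ _ * _)%g; case: hs => ->; rewrite ?mulN1r ?mul1r //.
  by rewrite invrN.
have l : (h b u ^ w a 1 = h (a + b) u)%g.
  have -> : h b u = (w b u * w b (-1))%g by [].
  rewrite conjMg !wconj ?oppr_eq0 // mulrN1 -h_divE //.
  exact: hU_div_sign.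
have rr : (h b u ^ w a 1 = h b u * h a u)%g.
  rewrite conjgE (mulgA (w a 1)^-1%g) (conjgC _ (h b u)) -mulgA wV //.
  rewrite w_conj_h ?oppr_eq0 // hab opprK expr1z mulrN1.
  have <- : (w a (- u) * w a (- (-1)) = h a u)%g.
    by rewrite -h_divE // -(hU_div_sign (s := -1) ha hu) ?mulN1r //; right.
  by rewrite opprK.
by rewrite -l rr.
Qed.

Definition level_torus (L : seq 'rV[R]_r) : set Gt :=
  [set g | exists a u, [/\ a \in L, U u & g = h a u]].

Definition level_root (P : 'rV[R]_r -> Prop) : set Gt :=
  [set g | exists a s, [/\ a \in Phi, P a, J s & g = xt a s]].

Lemma level_torusV (L : seq 'rV[R]_r) : {subset L <= Phi} ->
  forall g, level_torus L g -> level_torus L g^-1%g.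
Proof.
move=> hL g [a [u [ha hu ->]]]; exists a, u^-1; split => //; first exact: U_inv.
by rewrite hU_inv // hL.
Qed.

Lemma level_rootV P g : level_root P g -> level_root P g^-1%g.
Proof. by move=> [a [s [ha hP hs ->]]]; exists a, (- s); rewrite xtV //; split=> //;
  apply: J_opp. Qed.

Local Notation T := (generated (level_torus Phi)).

Lemma level_torus_simple g : T g -> generated (level_torus Delta) g.
Proof.
apply: generated_min; first exact: generated_subgroup.
have sgD := generated_subgroup (level_torus Delta).
move=> _ [a [u [ha hu ->]]]; move: a ha u hu.
apply: (simple_root_ind HPhi Hsl HDelta (P := fun a => forall u,
  U u -> generated (level_torus Delta) (h a u))).
- by move=> d hd u hu; apply: sub_generated; exists d, u.
- by move=> a ha IH u hu; rewrite hU_opp //; apply: (sgV sgD); apply: IH.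
- move=> a d ha hd had IH u hu; have hdP := sr_sub HDelta hd.
  by rewrite hU_add //; apply: (sgM sgD); [apply: sub_generated; exists d, u | apply: IH].
Qed.

Lemma T_commute g k : T g -> T k -> commute g k.
Proof.
apply: generated_commute => _ _ [a [u [ha hu ->]]] [b [v [hb hv ->]]].
exact: hU_commute.
Qed.

Local Notation torus_prod L nu := (\prod_(d <- L) h d (nu d))%g.

Lemma level_torus_prod g : T g ->
  exists nu : 'rV[R]_r -> F, (forall d, U (nu d)) /\ g = torus_prod Delta nu.
Proof.
have subD := sr_sub HDelta.
move/level_torus_simple; move: g; apply: generated_ind => [||_ k [d [u [hd hu ->]]] _ [nu [hnu ->]]].
- exact: level_torusV.
- exists (fun=> 1); split=> [d|]; first exact: U_1.
  by rewrite big_seq big1 // => d /subD hd; rewrite hU_1.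
exists (fun d' => (if d' == d then u else 1) * nu d'); split=> [d'|].
  by apply: U_mul => //; case: eqP => _ //; exact: U_1.
pose nu1 d' : F := if d' == d then u else 1.
have hU' d' : U (nu1 d') by rewrite /nu1; case: eqP => _ //; exact: U_1.
have -> : h d u = torus_prod Delta nu1.
  have : uniq Delta by exact: (simple_uniq HDelta).
  rewrite /nu1; elim: (Delta) subD hd => // d1 L IHL subL;
    rewrite inE big_cons /= => hd /andP[nd uL].
  have subL' : {subset L <= Phi} by move=> a ha; apply: subL; rewrite inE ha orbT.
  have [e|ne] := eqVneq d d1.
    rewrite -e big_seq big1 ?mulg1 // => d' hd'.
    by case: eqP => [e'|_]; [rewrite -e -e' hd' in nd | rewrite hU_1 // subL'].
  rewrite (negbTE ne) /= in hd.
  by rewrite hU_1 ?subL ?inE ?eqxx // mul1g -IHL.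
elim: (Delta) subD {hd} => [|d1 L IHL] subL; first by rewrite !big_nil mulg1.
have subL' : {subset L <= Phi} by move=> a ha; apply: subL; rewrite inE ha orbT.
have hd1 : d1 \in Phi by rewrite subL // inE eqxx.
rewrite !big_cons -IHL // -hU_mul //; last exact: (hU' d1).
have : commute (torus_prod L nu1) (h d1 (nu d1)).
  apply: T_commute; last by apply: sub_generated; exists d1, (nu d1).
  have sgT := generated_subgroup (level_torus Phi).
  rewrite big_seq; apply: big_ind => [|y z|d' hd']; [exact: (sg1 sgT) | exact: (sgM sgT) |].
  by apply: sub_generated; exists d', (nu1 d'); split; [exact: subL' | exact: hU' |].
move: (torus_prod L nu1) (torus_prod L nu) (h d1 _) (h d1 _) => A B C D hc.
by rewrite -!mulgA; congr (_ * _)%g; rewrite !mulgA hc.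
Qed.

Lemma x_inj a s t : a \in Phi -> x a s = x a t -> s = t.
Proof.
move=> ha e; apply/eqP; rewrite -subr_eq0; apply/eqP; apply: (x_eq1 ha).
by rewrite -!(dc_lift HGt) // -(dc_add HGt) // -xtV // (dc_prM HGt) prV !(dc_lift HGt) // e mulgV.
Qed.

Lemma xt_inj a s t : a \in Phi -> xt a s = xt a t -> s = t.
Proof. by move=> ha e; apply: (x_inj ha); rewrite -!(dc_lift HGt) // e. Qed.

(** An element over 1 is central, so it centralizes the simple root subgroups; by [cartan_torsion]
    its coordinates are torsion in 1 + J, hence 1. *)
Lemma T_kernel g : T g -> pr g = 1%g -> g = 1%g.
Proof.
move=> hT hpr; have [nu [hnu e]] := level_torus_prod hT.
have subD := sr_sub HDelta.
have hconj (L : seq 'rV[R]_r) a s : {subset L <= Phi} -> a \in Phi ->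
    (xt a s ^ torus_prod L nu = xt a (\prod_(d <- L) nu d ^ (- cint a d) * s))%g.
  move=> hL ha; elim: L hL s => [|d L IHL] hL s; first by rewrite !big_nil conjg1 mul1r.
  rewrite !big_cons conjgM xt_conj_h ?U_neq0 //; last by rewrite hL // inE eqxx.
  rewrite IHL; last by move=> b hb; apply: hL; rewrite inE hb orbT.
  by rewrite mulrA [_ * \prod_(_ <- _) _]mulrC.
have hprod a : a \in Delta -> \prod_(d <- Delta) nu d ^ cint a d = 1.
  move=> /subD ha; have := hconj Delta a 1 subD ha; rewrite -e.
  rewrite conjgE -(kernel_central hpr) mulKg => /(xt_inj ha).
  rewrite mulr1 => h1; rewrite -[RHS]invr1 [X in X^-1]h1 -prodfV.
  by apply: eq_bigr => d _; rewrite -invr_expz invrK.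
have [|D D0 hD] := cartan_torsion HPhi HDelta _ hprod; first by move=> d _; apply: U_neq0.
rewrite e big_seq big1 // => d hd.
suff -> : nu d = 1 by apply/hU_1/subD.
have := hD d hd; rewrite (U_shift (hnu d)) => /(J_torsion (hnu d) D0) ->.
by rewrite addr0.
Qed.

Definition level_group : set Gt := generated (level_root (fun=> True) `|` level_torus Phi).

Lemma level_groupV g : (level_root (fun=> True) `|` level_torus Phi) g ->
  (level_root (fun=> True) `|` level_torus Phi) g^-1%g.
Proof. by case=> hg; [left; apply: level_rootV | right; apply: level_torusV]. Qed.

(** * The big cell in the cover *)

Section BigCell.
Variable f : 'rV[R]_r -> int.
Hypotheses (f_add : forall a b, a \in Phi -> b \in Phi -> a + b \in Phi -> f (a + b) = f a + f b)
  (f_opp : forall a, a \in Phi -> f (- a) = - f a) (f_neq0 : forall a, a \in Phi -> f a != 0).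

Local Notation Uneg := (generated (level_root (fun a => f a < 0))).
Local Notation Upos := (generated (level_root (fun a => 0 < f a))).

Lemma level_root_conj_T P k t : generated (level_root P) k -> T t ->
  generated (level_root P) (k ^ t)%g.
Proof.
move=> hk ht; move: t ht k hk; apply: generated_ind => [|k|t0 g [b [u [hb hu ->]]] _ IH k hk].
- exact: level_torusV.
- by rewrite conjg1.
rewrite conjgM; apply: IH; apply: (generated_conj (generated_subgroup _) _ hk).
move=> _ [a [s [ha hP hs ->]]]; rewrite xt_conj_h ?U_neq0 //.
apply: sub_generated; exists a; eexists; split; [by [] | by [] | | reflexivity].
by apply: J_mul => //; apply: U_O; apply: U_expz.
Qed.

Definition big_cell (g : Gt) := exists v t u, [/\ Uneg v, T t, Upos u & g = (v * t * u)%g].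

Lemma big_cell_negl v g : Uneg v -> big_cell g -> big_cell (v * g)%g.
Proof.
move=> hv [v1 [t [u [hv1 ht hu ->]]]]; exists (v * v1)%g, t, u; split => //.
  exact: (sgM (generated_subgroup _)).
by rewrite !mulgA.
Qed.

Lemma big_cell_torusl t g : T t -> big_cell g -> big_cell (t * g)%g.
Proof.
move=> ht [v [t1 [u [hv ht1 hu ->]]]]; have sgT := generated_subgroup (level_torus Phi).
exists (v ^ t^-1)%g, (t * t1)%g, u; split => //.
- by apply: level_root_conj_T => //; apply: (sgV sgT).
- exact: (sgM sgT).
- by rewrite !mulgA; congr (_ * _ * _)%g; rewrite -conjgCV.
Qed.

(* Moving a positive root element to the right past [Uneg] only creates negative
   root elements, torus elements, and positive root elements of smaller height. *)
Lemma big_cell_posl a s g : a \in Phi -> 0 < f a -> J s -> big_cell g -> big_cell (xt a s * g)%g.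
Proof.
move=> ha fa; have [N hN] : exists N : nat, f a < N%:Z by exists `|f a|.+1%N; lia.
(* The outer induction bounds the height [f a]; the inner one runs along the negative factor [v]. *)
elim: N a s g ha fa hN => [|N IHN] a s g ha fa hN hs; first by lia.
case=> v [t [u [hv ht hu ->]]]; move: v hv s hs.
have sgT := generated_subgroup (level_torus Phi).
have sgU := generated_subgroup (level_root (fun a => f a < 0)).
apply: generated_ind => [|s hs|_ v [b [s1 [hb fb hs1 ->]]] hv IHv s hs].
- exact: level_rootV.
- exists 1%g, t, (xt a s ^ t * u)%g; split => //; first exact: (sg1 sgU).
    apply: (sgM (generated_subgroup _)) => //; apply: level_root_conj_T => //.
    by apply: sub_generated; exists a, s.
  by rewrite !mul1g (mulgA (xt a s)) (mulgA t) -conjgC.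
have negb y : big_cell y -> big_cell (xt b s1 * y)%g.
  by move=> hy; apply: big_cell_negl => //; apply: sub_generated; exists b, s1.
rewrite -!(mulgA (xt b s1)) (mulgA (xt a s)).
case: (cint_trichotomy HPhi Hsl ha hb) => [e|e|].
- by move: fb; rewrite -e; lia.
- have [s0|s0] := eqVneq s 0; first by rewrite s0 xt0 // mul1g; apply: negb; exists v, t, u.
  have eb : b = - a by rewrite e opprK.
  have hJ : J (s * s1) by apply: J_mul => //; apply: J_sub.
  have hq := J_neq0 hJ; have hqi := J_inv hJ.
  rewrite eb xt_rank_one // sig1 ?mul1g; last by apply: hil_rank_one => //; apply: J_sub.
  rewrite -(mulgA (_ * h a _)%g) -(mulgA (xt (- a) _)).
  apply: big_cell_negl.
    apply: sub_generated; exists (- a), (s1 / (1 + s * s1)); split; rewrite -?eb //.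
    by rewrite mulrC; apply: J_mul.
  apply: big_cell_torusl.
    by apply: sub_generated; exists a, (1 + s * s1); split => //; rewrite addrC addKr.
  by apply: IHv; rewrite mulrC; apply: J_mul.
case=> e.
- have hab := (addP ha hb).2 e; have fab : f (a + b) = f a + f b by apply: f_add.
  have e1 : cint (a + b) a = 1 by rewrite (cintDl HPhi) // (cint_self HPhi)
    // (cintC HPhi Hsl hb) // e.
  have hq : J (sg a b * s * s1).
    apply: J_mul => //; apply: O_mulr; last exact: J_sub.
    by case: (cr_sign (cg_rep HG) ha hb hab) => ->; rewrite ?mulrN1z; [|apply: O_oppr].
  (* The root a + b of the commutator has smaller height than a, and its element commutes with that
     of a. Moved to the front, it joins the negative part or falls to the outer induction. *)
  rewrite (conjgC (xt a s)) xt_conj // -(xt_conj_cint (sg a b * s * s1) s hab ha e1) //.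
  rewrite -conjgC -!(mulgA (xt b s1)); apply: negb; rewrite -(mulgA (xt (a + b) _)).
  have := f_neq0 hab; case: (ltrgtP (f (a + b)) 0) => // fab0 _.
    apply: big_cell_negl; last exact: IHv.
    by apply: sub_generated; exists (a + b), (sg a b * s * s1).
  by apply: IHN => //; [lia | exact: IHv].
- by rewrite (conjgC (xt a s)) (xt_conj_cint _ _ ha hb e) // -!(mulgA (xt b s1)); apply/negb/IHv.
- by rewrite (conjgC (xt a s)) (xt_conj_cint _ _ ha hb e) // -!(mulgA (xt b s1)); apply/negb/IHv.
Qed.

Lemma level_group_big_cell g : level_group g -> big_cell g.
Proof.
move: g; apply: generated_ind => [||s g hs _ hg].
- exact: level_groupV.
- by exists 1%g, 1%g, 1%g; split; rewrite ?mulg1 //; apply: (sg1 (generated_subgroup _)).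
case: hs => [[a [s1 [ha _ hs ->]]]|ht].
  have := f_neq0 ha; case: (ltrgtP (f a) 0) => // fa _; last exact: big_cell_posl.
  by apply: big_cell_negl => //; apply: sub_generated; exists a, s1.
by apply: big_cell_torusl => //; apply: sub_generated.
Qed.

End BigCell.

Lemma level_group_root a s : a \in Phi -> J s -> level_group (xt a s).
Proof. by move=> ha hs; apply: sub_generated; left; exists a, s. Qed.

Lemma level_group_torus a u : a \in Phi -> U u -> level_group (h a u).
Proof. by move=> ha hu; apply: sub_generated; right; exists a, u. Qed.

(** Among root elements only the opposite root needs more than a commutator: [xt_rank_one] applies
    with trivial symbol, and the two resulting factors for b merge into one with parameter in
    [J]. *)
Lemma level_group_conj b t k : b \in Phi -> O t -> level_group k -> level_group (k ^ xt b t)%g.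
Proof.
move=> hb ht; have sgN := generated_subgroup (level_root (fun=> True) `|` level_torus Phi).
apply: (generated_conj sgN) => _ [[a [s [ha _ hs ->]]]|[a [u [ha hu ->]]]]; last first.
  rewrite conjgE (mulgA (xt b t)^-1%g) (conjgC _ (h a u)) -mulgA xtV // xt_conj_h ?U_neq0 //
    (dc_add HGt) //.
  apply: (sgM sgN); first exact: level_group_torus.
  apply: level_group_root => //; rewrite mulrN addrC -[X in X - _]mul1r -mulrBl mulrC.
  by apply: J_mul => //; rewrite -opprB; apply: J_opp; apply: U_expz.
case: (cint_trichotomy HPhi Hsl ha hb) => [->|->|].
- by rewrite xt_conj_self //; apply: level_group_root.
- have [t0|t0] := eqVneq t 0; first by rewrite t0 xt0 // conjg1; apply: level_group_root;
  rewrite ?opp.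
  have hJ : J (- t * s) by apply: J_mul => //; apply: O_oppr.
  have hq := J_neq0 hJ; have hqi := J_inv hJ.
  rewrite conjgE mulgA xtV // xt_rank_one ?oppr_eq0 // sig1 ?mul1g; last first.
    by apply: hil_rank_one; rewrite ?oppr_eq0 //; apply: O_oppr.
  rewrite -(mulgA _ (xt b _)) (dc_add HGt) //; apply: (sgM sgN); first apply: (sgM sgN).
  + by apply: level_group_root; rewrite ?opp // mulrC; apply: J_mul.
  + by apply: level_group_torus => //; rewrite addrC addKr.
  + apply: level_group_root => //.
    have -> : - t / (1 + - t * s) + t = (1 + - t * s)^-1 * (- t * t * s).
      by rewrite -[X in _ + X](mulfK hq) -mulrDl mulrC; congr (_ * _); ring.
    by apply: J_mul => //; apply: J_mul => //; apply: O_mulr => //; apply: O_oppr.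
case=> e.
- have hab := (addP ha hb).2 e.
  rewrite xt_conj //; apply: (sgM sgN); apply: level_group_root => //.
  rewrite mulrAC; apply: J_mul => //; apply: O_mulr => //.
  by case: (cr_sign (cg_rep HG) ha hb hab) => ->; rewrite ?mulrN1z; [|apply: O_oppr].
- by rewrite (xt_conj_cint _ _ ha hb e) //; apply: level_group_root.
- by rewrite (xt_conj_cint _ _ ha hb e) //; apply: level_group_root.
Qed.

Local Notation ev u P := (map_mx (horner_eval u) P).

Lemma evE u (P : 'M[{poly F}]_n) i j : (ev u P) i j = (P i j).[u].
Proof. by rewrite mxE. Qed.

(** For [n] at most 1 the truncated sum [expmx] keeps no linear term, so x_a would be constant. *)
Lemma dim_gt1 : (1 < n)%N.
Proof.
have [a ha] : exists a, a \in Phi.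
  by case: (Phi) (Hirr.1) => // a l _; exists a; rewrite inE eqxx.
rewrite ltnNge; apply/negP => n1.
suff : x a 1 = x a 0 by move/(x_inj ha)/eqP; rewrite oner_eq0.
apply: (cg_rho_inj HG); rewrite !(cg_x HG) // /expmx.
apply: eq_bigr => i _; have -> : (i : nat) = 0%N by have := ltn_ord i; lia.
by rewrite !expr0.
Qed.

(** * Detecting unipotent elements by a cocharacter *)

Section Cocharacter.
Variables (f : 'rV[R]_r -> int) (tau : F -> Gt).
Hypotheses (f_add : forall a b, a \in Phi -> b \in Phi -> a + b \in Phi -> f (a + b) = f a + f b)
  (f_opp : forall a, a \in Phi -> f (- a) = - f a) (f_inj : {in Phi &, injective f}).
Hypothesis xt_conj_tau : forall a s u, a \in Phi -> u != 0 -> (xt a s ^ tau u = xt a (u ^ f a * s))%g.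

(** [A] is the coefficient of u^m in the image of the conjugate by tau(u). It is additive on
    products and sees only roots of weight exactly [m]. *)
Definition expansion (m : nat) (A : 'M[F]_n) (g : Gt) :=
  exists P : 'M[{poly F}]_n, ev 0 P = A /\
    forall u, u != 0 -> rho (pr (g ^ tau u)%g) = 1%:M + u ^+ m *: ev u P.

Lemma expansion1 m : expansion m 0 1%g.
Proof.
exists 0; split=> [|u u0]; first by rewrite map_mx0.
by rewrite map_mx0 scaler0 addr0 conj1g pr1 (cg_rho1 HG).
Qed.

Lemma expansionM m A B g k : (0 < m)%N -> expansion m A g -> expansion m B k ->
  expansion m (A + B) (g * k)%g.
Proof.
move=> m0 [P [<- hP]] [Q [<- hQ]].
exists (P + Q + 'X^m *: (P *m Q)); split=> [|u u0].
  rewrite !map_mxD; apply/matrixP => i j; rewrite !mxE /= !horner_evalE hornerM hornerXn.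
  by rewrite expr0n eqn0Ngt m0 mul0r addr0.
rewrite conjMg (dc_prM HGt) (cg_rhoM HG) hP // hQ //.
have -> : ev u (P + Q + 'X^m *: (P *m Q)) = ev u P + ev u Q + u ^+ m *: (ev u P *m ev u Q).
  by rewrite !map_mxD map_mxZ map_mxM /= horner_evalE hornerXn.
rewrite mulmxDl mul1mx mulmxDr mulmx1 -scalemxAl -scalemxAr !scalerDr.
by rewrite -!addrA; congr (_ + _); rewrite addrCA.
Qed.

Lemma expansion_kernel m A g : expansion m A g -> pr g = 1%g -> A = 0.
Proof.
move=> [P [<- hP]] hg; suff -> : P = 0 by rewrite map_mx0.
apply/matrixP => i j; rewrite mxE; apply: (poly_eq0_nonzero charF) => u u0.
have := hP u u0; rewrite conjgE !(dc_prM HGt) hg mul1g prV mulVg (cg_rho1 HG).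
move/eqP; rewrite -subr_eq0 opprD addrA subrr sub0r oppr_eq0 scaler_eq0 expf_eq0 (negbTE u0)
  andbF /=.
by move=> /eqP/matrixP/(_ i j); rewrite evE mxE.
Qed.

(** The exponential of u^k s X_a has terms in u^(kj); at order [m] only j = 1 can contribute, and
    only when k = m. *)
Lemma expansion_root a s (k m : nat) : a \in Phi -> f a = k -> (0 < m <= k)%N ->
  expansion m ((s * (k == m)%:R) *: X a) (xt a s).
Proof.
move=> ha fa /andP[m0 mk].
pose P := \sum_(1 <= j < n) (((j`!%:R)^-1 * s ^+ j)%:P * 'X^(k * j - m))
  *: map_mx polyC (X a ^+ j).
have hev u : ev u P = \sum_(1 <= j < n) ((j`!%:R)^-1 * s ^+ j * u ^+ (k * j - m)) *: X a ^+ j.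
  rewrite /P map_mx_sum; apply: eq_bigr => j _; apply/matrixP => i l.
  by rewrite !mxE /= !horner_evalE !hornerE.
exists P; split=> [|u u0].
  rewrite hev big_ltn ?dim_gt1 // big1_seq ?addr0 => [|j /andP[_]]; last first.
    rewrite mem_index_iota => hj; rewrite expr0n.
    have -> : (k * j - m == 0)%N = false by apply/negP => /eqP; nia.
    by rewrite mulr0 scale0r.
  rewrite muln1 expr1 invr1 mul1r expr0n; congr ((_ * _) *: _).
  by congr (_%:R); congr nat_of_bool; lia.
rewrite xt_conj_tau // (dc_lift HGt) // (cg_x HG) // /expmx fa hev -exprnP.
rewrite -(big_mkord xpredT (fun j => (j`!%:R)^-1 *: ((u ^+ k * s) *: X a) ^+ j)).
rewrite big_ltn ?(ltn_trans _ dim_gt1) // fact0 invr1 expr0 scale1r; congr (_ + _).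
rewrite scaler_sumr; apply: eq_big_nat => j hj.
have -> : ((u ^+ k * s) *: X a) ^+ j = (u ^+ k * s) ^+ j *: X a ^+ j.
  elim: (j) => [|l IHl]; first by rewrite !expr0 scale1r.
  by rewrite !exprS IHl -[LHS]/(_ *m _) -scalemxAl -scalemxAr scalerA.
rewrite !scalerA; congr (_ *: _); rewrite exprMn -exprM.
have -> : (k * j = m + (k * j - m))%N by nia.
by rewrite exprD addKn; ring.
Qed.

Lemma expansion_level k m g : (0 < m <= k)%N ->
  generated (level_root (fun a => k%:Z <= f a)) g ->
  exists2 A, expansion m A g & ((m < k)%N -> A = 0).
Proof.
move=> /andP[m0 mk]; move: g; apply: generated_ind => [||_ g [a [s [ha fa hs ->]]] _ [A hA A0]].
- exact: level_rootV.
- by exists 0 => //; exact: expansion1.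
have [l hl] : exists l : nat, f a = l by exists `|f a|%N; lia.
exists ((s * (l == m)%:R) *: X a + A).
  by apply: expansionM => //; apply: expansion_root => //; lia.
move=> mk'; rewrite A0 // addr0.
have -> : (l == m) = false by apply/eqP => e; lia.
by rewrite mulr0 scale0r.
Qed.

(** Root elements are peeled off by increasing weight. As [f] is injective, one root occurs at each
    weight; its parameter times X_a is the leading coefficient, which vanishes for an element over
    1. *)
Lemma level_kernel g : generated (level_root (fun a => 0 < f a)) g -> pr g = 1%g -> g = 1%g.
Proof.
have [B hB] : exists B : nat, forall a, a \in Phi -> f a < 1%N%:Z + B%:Z.
  exists (\sum_(a <- Phi) `|f a|)%N => a ha.
  have : (`|f a| <= \sum_(a <- Phi) `|f a|)%N by rewrite (big_rem a) //= leq_addr.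
  lia.
have -> : (fun a => is_true (0 < f a)) = (fun a => is_true (1%N%:Z <= f a)).
  by apply/funext => a; congr is_true.
suff ind : forall B' k : nat, (0 < k)%N -> (forall a, a \in Phi -> f a < k%:Z + B'%:Z) ->
    forall g, generated (level_root (fun a => k%:Z <= f a)) g -> pr g = 1%g -> g = 1%g.
  exact: (ind B 1%N).
elim=> [|B' IHB] k k0 {}hB {}g hg hpr.
  move: g hg {hpr}; apply: generated_ind => [|//|s0 g [a [s [ha fa _ _]]] _ _].
    exact: level_rootV.
  by have := hB a ha; lia.
have hB' a : a \in Phi -> f a < (k.+1)%:Z + B'%:Z by move=> /hB; lia.
have [[a ha fa]|no] := pselect (exists2 a, a \in Phi & f a = k); last first.
  apply: (IHB k.+1) => //; apply: generated_mono hg => _ [b [s [hb fb hs ->]]].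
  exists b, s; split => //; have : f b <> k by move=> e; apply: no; exists b.
  lia.
have sgk := generated_subgroup (level_root (fun a => (k.+1)%:Z <= f a)).
have [s [g' [hs hg' eg]]] : exists s g',
    [/\ J s, generated (level_root (fun a => (k.+1)%:Z <= f a)) g' & g = (xt a s * g')%g].
  move: g hg {hpr}; apply: generated_ind => [||_ g [b [s1 [hb fb hs1 ->]]] _ [s [g' [hs hg' ->]]]].
  - exact: level_rootV.
  - by exists 0, 1%g; split; rewrite ?xt0 ?mulg1 //; exact: (sg1 sgk).
  have [eb|nb] := eqVneq (f b) k.
    have -> : b = a by apply: f_inj; rewrite ?fa.
    by exists (s1 + s), g'; split; rewrite ?mulgA ?(dc_add HGt) //; apply: J_add.
  exists s, (xt b s1 ^ xt a s * g')%g; split => //;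
    last by rewrite (mulgA (xt b s1)) (mulgA (xt a s)) -conjgC.
  apply: (sgM sgk) => //.
  have hb1 : generated (level_root (fun a => (k.+1)%:Z <= f a)) (xt b s1).
    by apply: sub_generated; exists b, s1; split => //; lia.
  case: (cint_trichotomy HPhi Hsl hb ha) => [e|e|].
  - by move: nb; rewrite e fa eqxx.
  - by move: fb; rewrite e f_opp // fa; lia.
  case=> e.
  - have hba := (addP hb ha).2 e; rewrite xt_conj //; apply: (sgM sgk) => //.
    apply: sub_generated; exists (b + a); eexists; split; [by [] | | | reflexivity].
      by rewrite f_add // fa; lia.
    apply: J_mul => //; apply: O_mulr; last exact: J_sub.
    by case: (cr_sign (cg_rep HG) hb ha hba) => ->; rewrite ?mulrN1z; [|apply: O_oppr].
  - by rewrite (xt_conj_cint _ _ hb ha e).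
  - by rewrite (xt_conj_cint _ _ hb ha e).
have [A hA A0] := expansion_level (m := k) (k := k.+1) (ltac:(lia)) hg'.
have := expansionM k0 (expansion_root s ha fa (m := k) (ltac:(lia))) hA.
rewrite -eg => /expansion_kernel /(_ hpr); rewrite A0 // addr0 eqxx mulr1 => /eqP.
rewrite scaler_eq0 (negbTE (X_neq0 ha)) orbF => /eqP s0.
have eg' : g = g' by rewrite eg s0 xt0 // mul1g.
by apply: (IHB k.+1) => //; rewrite eg'.
Qed.

End Cocharacter.

Lemma rho_prM g k : rho (pr (g * k)%g) = rho (pr g) *m rho (pr k).
Proof. by rewrite (dc_prM HGt) (cg_rhoM HG). Qed.

Lemma rho_eq1 g : rho g = 1%:M -> g = 1%g.
Proof. by move=> hg; apply: (cg_rho_inj HG); rewrite hg (cg_rho1 HG). Qed.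

Lemma T_conj_h t b u : T t -> b \in Phi -> u != 0 -> pr (t ^ h b u)%g = pr t.
Proof.
move=> ht hb u0; move: t ht; apply: generated_ind => [||_ k [a [v [ha hv ->]]] _ IH].
- exact: level_torusV.
- by rewrite conj1g.
rewrite conjMg [LHS](dc_prM HGt) [RHS](dc_prM HGt) IH; congr (_ * _)%g.
rewrite (h_conj_h ha hb u0 (U_neq0 hv)) (dc_prM HGt).
suff -> : pr (sig v (u ^ (- cint a b))) = 1%g by rewrite mul1g.
by rewrite /sig /mu2_elt; case: ifP => _; rewrite ?pr1 ?pr_zeta.
Qed.

(* Conjugating [v^-1 = t u] by [tau w] makes the left side a polynomial in [w^-1] and the
   right side a polynomial in [w]; hence both are constant. *)
Lemma big_cell_kernel (f : 'rV[R]_r -> int) (tau : F -> Gt) g :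
  (forall a b, a \in Phi -> b \in Phi -> a + b \in Phi -> f (a + b) = f a + f b) ->
  (forall a, a \in Phi -> f (- a) = - f a) -> {in Phi &, injective f} ->
  (forall a s u, a \in Phi -> u != 0 -> (xt a s ^ tau u = xt a (u ^ f a * s))%g) ->
  (forall t u, T t -> u != 0 -> pr (t ^ tau u)%g = pr t) ->
  big_cell f g -> pr g = 1%g -> g = 1%g.
Proof.
move=> f_add f_opp f_inj xt_tau T_tau [v [t [u [hv ht hu ->]]]] hpr.
(* Negating the weights and inverting the parameter lets the lemmas for the positive part serve the
   negative one. *)
pose f' a := - f a; pose tau' w := tau w^-1.
have f_add' a b : a \in Phi -> b \in Phi -> a + b \in Phi -> f' (a + b) = f' a + f' b.
  by move=> ha hb hab; rewrite /f' f_add // opprD.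
have f_opp' a : a \in Phi -> f' (- a) = - f' a by move=> ha; rewrite /f' f_opp.
have f_inj' : {in Phi &, injective f'} by move=> a b ha hb /oppr_inj; apply: f_inj.
have xt_tau' a s w0 : a \in Phi -> w0 != 0 -> (xt a s ^ tau' w0 = xt a (w0 ^ f' a * s))%g.
  by move=> ha w00; rewrite /tau' xt_tau ?invr_eq0 // /f' exprz_inv.
have hv' : generated (level_root (fun a => 0 < f' a)) v.
  apply: generated_mono hv => _ [a [s [ha fa hs ->]]]; exists a, s; split => //.
  by rewrite /f' oppr_gt0.
have one_le (k : 'rV[R]_r -> int) : (fun a => is_true (0 < k a))
  = (fun a => is_true (1%N%:Z <= k a)).
  by apply/funext => a; congr is_true.
have [A [P [_ hP]] _] : exists2 A, expansion tau' 1 A v^-1%g & ((1 < 1)%N -> A = 0).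
  apply: (expansion_level xt_tau') => //; rewrite -one_le.
  exact: (sgV (generated_subgroup _)).
have [B [Q [_ hQ]] _] : exists2 B, expansion tau 1 B u & ((1 < 1)%N -> B = 0).
  by apply: (expansion_level xt_tau) => //; rewrite -one_le.
have hvtu : pr v^-1%g = pr (t * u)%g.
  by rewrite prV; apply: mulg1_eq; rewrite -(dc_prM HGt) mulgA.
have eq_tau w0 : w0 != 0 -> 1%:M + w0^-1 *: ev w0^-1 P = rho (pr t) *m (1%:M + w0 *: ev w0 Q).
  move=> w00; have wi0 : w0^-1 != 0 by rewrite invr_eq0.
  rewrite -[w0^-1 in X in X *: _]expr1 -hP // -[w0 in X in _ + X *: _]expr1 -hQ //
    -(T_tau t w0) //.
  by rewrite -rho_prM -conjMg /tau' invrK !conjgE !(dc_prM HGt) hvtu (dc_prM HGt).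
pose Q' := map_mx polyC (rho (pr t)) *m Q.
have hent i j : [/\ (1%:M : 'M[F]_n) i j = rho (pr t) i j, P i j = 0 & Q' i j = 0].
  apply: (poly_two_sided charF) => w0 w00; have := eq_tau w0 w00 => /matrixP/(_ i j).
  rewrite mulmxDr mulmx1 -scalemxAr.
  have -> : rho (pr t) *m ev w0 Q = ev w0 Q'.
    rewrite /Q' map_mxM; congr (_ *m _); apply/matrixP => k l.
    by rewrite !mxE /= horner_evalE hornerC.
  by rewrite !mxE.
have hpt : pr t = 1%g by apply: rho_eq1; apply/matrixP => i j; have [->] := hent i j.
have hpv : pr v = 1%g.
  have P0 : P = 0 by apply/matrixP => i j; have [_ -> _] := hent i j; rewrite mxE.
  have := hP 1 (oner_neq0 F); rewrite P0 map_mx0 scaler0 addr0 => /rho_eq1.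
  rewrite conjgE !(dc_prM HGt) !prV => /(congr1 (fun k => pr (tau' 1%R) * k)%g).
  rewrite mulgA mulgV mul1g mulg1 => /(congr1 (fun k => k * (pr (tau' 1%R))^-1)%g).
  by rewrite mulgK mulgV => /(congr1 (fun k => k^-1)%g); rewrite invgK invg1.
have hpu : pr u = 1%g by move: hpr; rewrite !(dc_prM HGt) hpv hpt !mul1g.
(* So far the three factors are trivial only in G; [level_kernel] and [T_kernel] lift this to the
   cover. *)
have v1 : v = 1%g by apply: (level_kernel f_add' f_opp' f_inj' xt_tau').
have u1 : u = 1%g by apply: (level_kernel f_add f_opp f_inj xt_tau).
by rewrite v1 u1 (T_kernel ht hpt) !mulg1.
Qed.

Lemma level_group_kernel g : level_group g -> pr g = 1%g -> g = 1%g.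
Proof.
have [L [hL f_inj]] := generic_coweight HPhi.
pose f a := \sum_(p <- L) cint a p.1 *+ p.2.
(* The inverse of [u] compensates the negative exponent in [xt_conj_h]. Only the conjugation action
   of [tau] is needed, not multiplicativity in the cover. *)
pose tau u := (\prod_(p <- L) h p.1 u^-1 ^+ p.2)%g.
have f_add a b : a \in Phi -> b \in Phi -> a + b \in Phi -> f (a + b) = f a + f b.
  move=> ha hb hab; rewrite /f -big_split; apply: eq_big_seq => p hp.
  by rewrite (cintDl HPhi) ?hL // mulrnDl.
have f_opp a : a \in Phi -> f (- a) = - f a.
  move=> ha; rewrite /f -sumrN; apply: eq_big_seq => p hp.
  by rewrite (cintNl HPhi) ?hL // mulNrn.
have f_neq0 a : a \in Phi -> f a != 0.
  move=> ha; apply/eqP => fa; apply: (root_neq_opp HPhi ha).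
  by apply: f_inj; rewrite ?opp // -/(f a) -/(f (- a)) f_opp // fa oppr0.
have xt_tau a s u : a \in Phi -> u != 0 -> (xt a s ^ tau u = xt a (u ^ f a * s))%g.
  move=> ha u0; rewrite /tau /f; elim: L hL s {f_inj f tau f_add f_opp f_neq0} => [|[b k] L IHL] hL s.
    by rewrite !big_nil conjg1 mul1r.
  have hb : b \in Phi by apply: (hL (b, k)); rewrite inE eqxx.
  rewrite !big_cons conjgM /=.
  have -> : (xt a s ^ (h b u^-1 ^+ k) = xt a (u ^ (cint a b *+ k) * s))%g.
    elim: k {hL} s => [|k IHk] s; first by rewrite expg0 conjg1 mul1r.
    rewrite expgS conjgM xt_conj_h ?invr_eq0 // IHk; congr (xt a _).
    by rewrite exprz_inv opprK mulrS expfzDr // mulrCA mulrA.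
  rewrite IHL; last by move=> p hp; apply: hL; rewrite inE hp orbT.
  by rewrite expfzDr // mulrA [_ ^ _ * _ in RHS]mulrC.
(* Conjugation in the cover may multiply [t] by symbols, so the torus is fixed only after
   projection. *)
have T_tau t u : T t -> u != 0 -> pr (t ^ tau u)%g = pr t.
  move=> ht u0.
  have conj_pr g1 k : (pr (g1 ^ k) = pr g1 ^ pr k)%g by rewrite !conjgE !(dc_prM HGt) prV.
  rewrite /tau; elim: L hL {f_inj f tau f_add f_opp f_neq0 xt_tau} => [|[b k] L IHL] hL.
    by rewrite big_nil conjg1.
  have hb : b \in Phi by apply: (hL (b, k)); rewrite inE eqxx.
  rewrite big_cons conjgM /= conj_pr.
  have -> : pr (t ^ (h b u^-1 ^+ k))%g = pr t.
    elim: k {hL} => [|k IHk]; first by rewrite expg0 conjg1.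
    by rewrite expgSr conjgM conj_pr IHk -conj_pr T_conj_h // invr_eq0.
  by rewrite -conj_pr IHL // => p hp; apply: hL; rewrite inE hp orbT.
move=> hg; apply: (big_cell_kernel f_add f_opp f_inj xt_tau T_tau).
exact: (level_group_big_cell f_add f_neq0).
Qed.

(** * From the lifted group to the splitting *)

Lemma preimage_subgroup (H : set G) : is_subgroup H -> is_subgroup (pr @^-1` H).
Proof.
move=> [H1 HM HV]; split=> [|a b|a] /=; rewrite ?pr1 ?(dc_prM HGt) ?prV //.
- exact: HM.
- exact: HV.
Qed.

Lemma image_subgroup (H : set Gt) : is_subgroup H -> is_subgroup (pr @` H).
Proof.
move=> [H1 HM HV]; split=> [|_ _ [a ha <-] [b hb <-]|_ [a ha <-]].
- by exists 1%g => //; exact: pr1.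
- by exists (a * b)%g; [exact: HM | exact: (dc_prM HGt)].
- by exists a^-1%g; [exact: HV | exact: prV].
Qed.

Local Notation KO := (generated [set x a t | a in [set` Phi] & t in O]).
Local Notation GJ := (generated ([set h_elt x a (1 + t) | a in [set` Phi] & t in J]
     `|` [set x a t | a in [set` Phi] & t in J])).

Lemma h_in_KO a u : a \in Phi -> O u -> O u^-1 -> KO (h_elt x a u).
Proof.
move=> ha hu hui; have sgK := generated_subgroup [set x a t | a in [set` Phi] & t in O].
have hx b t : b \in Phi -> O t -> KO (x b t).
  by move=> hb ht; apply: sub_generated; exists b => //; exists t.
have hw v : O v -> O v^-1 -> KO (w_elt x a v).
  move=> hv hvi; apply: (sgM sgK); first apply: (sgM sgK).
  - exact: hx.
  - by apply: hx; [exact: opp | exact: O_oppr].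
  - exact: hx.
apply: (sgM sgK); apply: hw => //; first exact: O_oppr.
by rewrite invrN invr1; exact: O_oppr.
Qed.

Lemma pr_level_group : pr @` level_group = GJ.
Proof.
rewrite eqEsubset; split=> [_ [k hk <-]|g hg].
  have sgG := generated_subgroup ([set h_elt x a (1 + t) | a in [set` Phi] & t in J]
     `|` [set x a t | a in [set` Phi] & t in J]).
  apply: (generated_min (preimage_subgroup sgG) _ hk)
    => _ [[a [s [ha _ hs ->]]]|[a [u [ha hu ->]]]].
    by rewrite /preimage /= (dc_lift HGt) //; apply: sub_generated; right; exists a => //;
      exists s.
  rewrite /preimage /= pr_h //; apply: sub_generated; left; exists a => //.
  by exists (u - 1); rewrite // -U_shift.
apply: (generated_min (image_subgroup (generated_subgroup _)) _ hg) => _ [|] [a ha [s hs <-]].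
  exists (h a (1 + s)); last exact: pr_h.
  by apply: level_group_torus; rewrite // addrAC subrr add0r.
by exists (xt a s); [exact: level_group_root | exact: (dc_lift HGt)].
Qed.

(** An element over K is a product of lifted generators up to the central [zeta], which does not
    affect conjugation. *)
Lemma level_group_normalized g k : KO (pr g) -> level_group k -> level_group (k ^ g)%g.
Proof.
move=> hg; pose KL : set Gt := [set y | exists a t, [/\ a \in Phi, O t & y = xt a t]].
have [y hy ey] : (pr @` generated KL) (pr g).
  apply: (generated_min (image_subgroup (generated_subgroup KL)) _ hg) => _ [a ha [t ht <-]].
  by exists (xt a t); [apply: sub_generated; exists a, t | exact: (dc_lift HGt)].
have hconj : forall k, level_group k -> level_group (k ^ y)%g.
  move: y hy {ey}; apply: generated_ind => [_ [a [t [ha ht ->]]]|k0 h0|_ y [a [t [ha ht ->]]] _ IH k0 h0].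
  - by exists a, (- t); rewrite xtV //; split => //; exact: O_oppr.
  - by rewrite conjg1.
  - by rewrite conjgM; apply: IH; exact: level_group_conj.
case: (fibre ey) => -> hk; first exact: hconj.
have -> : (k ^ (zeta * y) = k ^ y)%g; last exact: hconj.
by rewrite conjgM; congr (_ ^ _)%g; rewrite conjgE -zetaC mulKg.
Qed.

Lemma level_splitting : exists s : G -> Gt,
  splitting pr GJ s /\ normal_in (s @` GJ) (pr @^-1` KO).
Proof.
have sgN := generated_subgroup (level_root (fun=> True) `|` level_torus Phi).
have inj y y' : level_group y -> level_group y' -> pr y = pr y' -> y = y'.
  move=> hy hy' e; apply: (mulIg y'^-1%g); rewrite mulgV; apply: level_group_kernel.
    by apply: (sgM sgN) => //; exact: (sgV sgN).
  by rewrite (dc_prM HGt) prV e mulgV.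
(* The section inverts [pr] on the lifted group; off [GJ] the value 1 is arbitrary. *)
have hs g : exists k, GJ g -> level_group k /\ pr k = g.
  have [|ng] := pselect (GJ g); last by exists 1%g.
  by rewrite -pr_level_group => -[k hk hkg]; exists k.
have [s {}hs] := choice hs.
have sgG := generated_subgroup ([set h_elt x a (1 + t) | a in [set` Phi] & t in J]
     `|` [set x a t | a in [set` Phi] & t in J]).
have him : s @` GJ = level_group.
  rewrite eqEsubset; split=> [_ [g hg <-]|k hk]; first by case: (hs g hg).
  have hpk : GJ (pr k) by rewrite -pr_level_group; exists k.
  by exists (pr k) => //; have [h1 h2] := hs _ hpk; apply: inj.
exists s; split.
  split=> [g k hg hk|g hg]; last by case: (hs g hg).
  have hgk := sgM sgG hg hk; have [h1 h2] := hs _ hgk; have [h3 h4] := hs _ hg;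
    have [h5 h6] := hs _ hk.
  by apply: inj => //; [exact: (sgM sgN) | rewrite h2 (dc_prM HGt) h4 h6].
have sgK := generated_subgroup [set x a t | a in [set` Phi] & t in O].
rewrite him; split => //.
  apply: (generated_min (preimage_subgroup sgK)) => _ [[a [t [ha _ ht ->]]]|[a [u [ha hu ->]]]].
    rewrite /preimage /= (dc_lift HGt) //; apply: sub_generated; exists a => //.
    by exists t => //; exact: J_sub.
  by rewrite /preimage /= pr_h //; apply: h_in_KO => //; [exact: U_O | exact: U_OV].
move=> g k hg hk; have := level_group_normalized (g := g^-1%g) _ hk.
by rewrite conjgE invgK mulgA; apply; rewrite prV; exact: (sgV sgK).
Qed.

End CongruenceSubgroup.

End Cover.

Theorem theorem1p2
  (Q2 : fieldType) (absv : Q2 -> rat) (HQ2 : is_Q2 absv)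
  (F : fieldExtType Q2) (pi : F) (e : nat)
  (Hpi : uniformizer absv pi) (He : ramification_index absv pi e)
  (R : realType) (r : nat) (Hr : (2 <= r)%N) (Phi Delta : seq 'rV[R]_r)
  (HPhi : root_system Phi) (Hirr : irreducible_rs Phi)
  (Hsl : simply_laced Phi) (HDelta : simple_roots Phi Delta)
  (n : nat) (c : 'rV[R]_r -> 'rV[R]_r -> int) (X : 'rV[R]_r -> 'M[F]_n)
  (G : groupType) (rho : G -> 'M[F]_n) (x : 'rV[R]_r -> F -> G)
  (HG : chevalley_group Phi Delta c X rho x)
  (Gt : groupType) (pr : Gt -> G) (zeta : Gt) (xt : 'rV[R]_r -> F -> Gt)
  (HGt : double_cover Phi c x pr zeta xt) :
  (exists s : G -> Gt,
     splitting pr (Gamma absv pi Phi x (2 * e)%N) s /\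
     normal_in (s @` Gamma absv pi Phi x (2 * e)%N)
               (pr @^-1` K_group absv Phi x)) /\
  (forall s : G -> Gt,
     splitting pr (Gamma absv pi Phi x (2 * e - 1)%N) s ->
     ~ normal_in (s @` Gamma absv pi Phi x (2 * e - 1)%N)
                 (pr @^-1` K_group absv Phi x) /\
     ~ normal_in (s @` Gamma absv pi Phi x (2 * e - 1)%N)
                 (pr @^-1` Iwahori absv pi Phi Delta x)).
Proof.
have charF := F_intr_eq0 HQ2 F.
have hnt := hilbert_nontrivial_pair HQ2 Hpi He.
have [sgK sgI] : is_subgroup (K_group absv Phi x) /\ is_subgroup (Iwahori absv pi Phi Delta x).
  by split; exact: generated_subgroup.
split.
  exact: (level_splitting charF Hr HPhi Hirr Hsl HG HGt hnt (O_1 HQ2 F) (@O_add _ _ HQ2 F)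
    (@O_opp _ _ HQ2 F) (@O_mul _ _ HQ2 F) (level_O HQ2 Hpi He) (level_0 HQ2 Hpi He)
    (level_add HQ2 Hpi He) (level_mul HQ2 Hpi He) (level_neq0 HQ2 Hpi He) (level_inv HQ2 Hpi He)
    (level_hilbert_unit HQ2 Hpi He) (level_hilbert_rank_one HQ2 Hpi He)
      (level_torsion HQ2 Hpi He) HDelta).
move=> s hs.
(* Bimultiplicativity, on which the choice of [A] and [B] rests, is supplied by the cover itself. *)
have [A [B [hA [A0 _ _] [B0 OB OBi] hAB]]] :=
  hilbert_conductor HQ2 Hpi He (hilbert_mull charF Hr HPhi Hirr Hsl HG HGt hnt).
have hGam a : a \in Phi -> Gamma absv pi Phi x (2 * e - 1) (h_elt x a A).
  by move=> ha; apply: sub_generated; left; exists a => //; exists (A - 1);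
    rewrite // addrCA subrr addr0.
(* [B] is a unit, so h_b(B) lies both in K and in the Iwahori subgroup, and one argument refutes
   normality in either preimage. *)
split; apply: (no_normal_splitting charF Hr HPhi Hirr Hsl HG HGt hnt _ A0 B0 hAB hGam _ hs) => //
  b hb.
  exact: (h_in_KO HPhi (O_1 HQ2 F) (@O_opp _ _ HQ2 F)).
apply: sub_generated; left; right; exists b => //; exists B => //.
by split => //; exists B^-1; rewrite ?divff.
Qed.
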